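(* Let $n=2$, $\eta\in[0,1]$, and let $\bar\psi$ be the $\mathcal{H}^1$-elliptic envelope of $\psi(b,t)=|b|^2+\eta(b\cdot t)^2$, $\psi:\mathbb{Z}^2\times\mathcal{S}^{1}\to\mathbb{R}$. Let $\psi_{\rm e}(b,t)=|t|\,\psi(b,t/|t|)$ for $t\in\mathbb{R}^2$ (with $\psi_{\rm e}(b,0)=0$). Then for all $\beta\in\mathbb{Z}$, $t\in\mathcal{S}^1$ we have $$\bar\psi(\beta(e_1+e_2),t)=|\beta|\min\big\{\psi_{\rm e}(e_1,z)+\psi_{\rm e}(e_2,z)+\psi_{\rm e}(e_1+e_2,t-z):\ z\in\mathbb{R}^2\big\}.$$
   Context: $e_1,e_2$ is the canonical basis of $\mathbb{R}^2$. For $\Omega\subset\mathbb{R}^2$ open, $\mathcal{M}_{\rm df}^{(2)}(\Omega)$ is the set of finite $\mathbb{R}^{2\times2}$-valued Radon measures on $\Omega$ of the form $\mu=\theta\otimes\tau\,\mathcal{H}^1\llcorner\gamma$, where $\gamma\subset\Omega$ is $1$-rectifiable, $\tau:\gamma\to\mathcal{S}^{1}$ is its unit tangent vector, $\theta:\gamma\to\mathbb{Z}^2$ is $\mathcal{H}^1$-integrable, and $\mu$ is divergence-free, i.e. $\sum_{j=1}^2\int_\Omega\partial_j\varphi\,d\mu_{ij}=0$ for all $\varphi\in C_c^\infty(\Omega)$ and $i=1,2$. The $\mathcal{H}^1$-elliptic envelope of $\psi$ is, for $b\in\mathbb{Z}^2$, $t\in\mathcal{S}^{1}$, $$\bar\psi(b,t)=\inf\Big\{\int_\gamma\psi(\theta,\tau)\,d\mathcal{H}^1:\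 \mu=\theta\otimes\tau\,\mathcal{H}^1\llcorner\gamma\in\mathcal{M}_{\rm df}^{(2)}(B_{1/2}),\ \mathrm{supp}\big(\mu-b\otimes t\,\mathcal{H}^1\llcorner(\mathbb{R}t\cap B_{1/2})\big)\subset B_{1/2}\Big\},$$ where $B_{1/2}\subset\mathbb{R}^2$ is the ball of radius $1/2$ centered at $0$; the support condition means that there is a ball $B'\subset\subset B_{1/2}$ with $\mu=b\otimes t\,\mathcal{H}^1\llcorner\mathbb{R}t$ on $B_{1/2}\setminus B'$. *)

(* Defs.v *)
(* Points of the plane are row vectors 'rV[R]_2.  The library norm on this type
   is the sup norm: it is used only for topology, differentiability and
   Lipschitz maps, where the choice of a norm is immaterial.  Lengths, diameters
   and balls use the Euclidean norm enorm. *)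
From HB Require Import structures.
From mathcomp Require Import all_boot all_order all_algebra.
From mathcomp Require Import all_classical all_reals all_analysis.

Set Implicit Arguments.
Unset Strict Implicit.
Unset Printing Implicit Defensive.
Import Order.TTheory GRing.Theory Num.Theory.
Import numFieldNormedType.Exports.
Local Open Scope classical_set_scope.
Local Open Scope ring_scope.

Definition evec (K : pzSemiRingType) (i : 'I_2) : 'rV[K]_2 := delta_mx 0 i.

Definition dot (R : realType) (u v : 'rV[R]_2) : R :=
  \sum_(i < 2) u 0 i * v 0 i.

Definition enorm (R : realType) (u : 'rV[R]_2) : R := Num.sqrt (dot u u).

Definition eball (R : realType) (c : 'rV[R]_2) (r : R) : set 'rV[R]_2 :=
  [set x | enorm (x - c) < r].

Definition toR (R : realType) (b : 'rV[int]_2) : 'rV[R]_2 := map_mx intr b.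

Section hausdorff.
Variable R : realType.
Local Open Scope ereal_scope.
Implicit Types (A : set 'rV[R]_2) (U : (set 'rV[R]_2)^nat) (d : R).

(* The point 0 is adjoined so that the empty set has diameter 0. *)
Definition diam A : \bar R :=
  ereal_sup (0 |` [set (enorm (x.1 - x.2))%:E | x in A `*` A]).

Definition small_covers d A : set ((set 'rV[R]_2)^nat) :=
  [set U | (forall i, diam (U i) <= d%:E) /\ A `<=` \bigcup_i U i].

Definition hausdorff_pre d A : \bar R :=
  ereal_inf [set \sum_(i <oo) diam (U i) | U in small_covers d A].

(* In dimension 1 the usual normalising constant is 1. *)
Definition hausdorff1 A : \bar R :=
  ereal_sup [set hausdorff_pre d A | d in [set d | (0 < d)%R]].

Lemma diam_ge0 A : 0 <= diam A.
Proof. by apply: ereal_sup_ubound; left. Qed.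

Lemma diam0 : diam set0 = 0.
Proof.
apply/eqP; rewrite eq_le diam_ge0 andbT.
by apply: ge_ereal_sup => y [->//|[x [] []]].
Qed.

Lemma hausdorff_pre_ge0 d A : 0 <= hausdorff_pre d A.
Proof.
apply: le_ereal_inf_tmp => _ [U _ <-].
by apply: nneseries_ge0 => *; exact: diam_ge0.
Qed.

Lemma hausdorff_pre0 d : (0 < d)%R -> hausdorff_pre d set0 = 0.
Proof.
move=> d0; apply/eqP; rewrite eq_le hausdorff_pre_ge0 andbT.
apply: ereal_inf_lbound; exists (fun=> set0).
  by split => // i; rewrite diam0 lee_fin ltW.
by apply: eseries0 => *; exact: diam0.
Qed.

Lemma hausdorff_pre_le d : {homo hausdorff_pre d : A B / A `<=` B >-> A <= B}.
Proof.
move=> A B AB; apply/ereal_inf_le_tmp => x [U [dU BU] <-].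
by exists U => //; split => //; apply: subset_trans AB BU.
Qed.

Lemma hausdorff_pre_sigma_subadditive d : sigma_subadditive (hausdorff_pre d).
Proof.
move=> A; have [[i ioo]|] := pselect (exists i, hausdorff_pre d (A i) = +oo).
  rewrite (eseries_pinfty _ _ ioo) ?leey// => n _.
  by rewrite -ltNye (lt_le_trans _ (hausdorff_pre_ge0 _ _)).
rewrite -forallNE => Aoo.
suff add2e (e : {posnum R}) : hausdorff_pre d (\bigcup_n A n) <=
    \sum_(i <oo) hausdorff_pre d (A i) + e%:num%:E.
  by apply/lee_addgt0Pr => _/posnumP[].
rewrite (le_trans _ (epsilon_trick _ _ _))//; last first.
  by move=> n; exact: hausdorff_pre_ge0.
pose P n U := small_covers d (A n) U /\ \sum_(k <oo) diam (U k) <=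
  hausdorff_pre d (A n) + (e%:num / (2 ^ n.+1)%:R)%:E.
have [G PG] : {G : ((set 'rV[R]_2)^nat)^nat & forall n, P n (G n)}.
  apply: (@choice _ _ P) => n; rewrite /P.
  have fin : hausdorff_pre d (A n) \is a fin_num.
    by rewrite ge0_fin_numE ?hausdorff_pre_ge0// ltey; exact/eqP.
  have en1 : (0 < e%:num / (2 ^ n.+1)%:R)%R by [].
  have [x [U cU <-] /ltW xS] := lb_ereal_inf_adherent en1 fin.
  by exists U.
have G_ge0 x : 0 <= (diam \o uncurry G) x by exact: diam_ge0.
apply: (@le_trans _ _ (\esum_(i in setT) (diam \o uncurry G) i)).
  apply: ereal_inf_lbound => /=.
  have /card_esym/ppcard_eqP[f] := card_nat2.
  exists (uncurry G \o f).
    split => [i|/=].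
      by rewrite /=; case: (f i) => a b /=; exact: (PG a).1.1.
    move=> t [i _ /(PG i).1.2[j _ Bijt]].
    by exists (f^-1%FUN (i, j)) => //=; rewrite invK ?inE.
  rewrite -(esum_pred_image (diam \o uncurry G) _ xpredT) ?[fun=> _]set_true//.
  by rewrite image_eq.
rewrite (_ : esum _ _ = \sum_(i <oo) \sum_(j <oo ) diam (G i j)); last first.
  pose J : nat -> set (nat * nat) := fun i => [set (i, j) | j in setT].
  rewrite (_ : setT = \bigcup_k J k); last first.
    by rewrite predeqE => -[a b]; split => // _; exists a => //; exists b.
  rewrite esum_bigcupT /=; last 2 first.
    - apply/trivIsetP => i j _ _ ij.
      rewrite predeqE => -[n m] /=; split => //= -[] [_] _ [<-{n} _].
      by move=> [m' _] [] /esym/eqP; rewrite (negbTE ij).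
    - by move=> /= [n m]; exact: diam_ge0.
  rewrite -(image_id [set: nat]) -fun_true esum_pred_image//; last first.
    by move=> n _; apply: esum_ge0 => *; exact: diam_ge0.
  apply: eq_eseriesr => /= j _.
  rewrite -(esum_pred_image (diam \o uncurry G) (pair j) predT)//=; last 2 first.
    by move=> ? _; exact: diam_ge0.
    by move=> ? ? _ _; exact: (@can_inj _ _ _ snd).
  by congr esum; rewrite predeqE => -[a b]; split; move=> [i _ <-]; exists i.
apply: lee_nneseries => [n _ _|n _]; last exact: (PG n).2.
by apply: nneseries_ge0 => m *; exact: diam_ge0.
Qed.

Lemma hausdorff1_0 : hausdorff1 set0 = 0.
Proof.
apply/eqP; rewrite eq_le; apply/andP; split.
  by apply: ge_ereal_sup => _ [d d0 <-]; rewrite hausdorff_pre0.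
by apply: ereal_sup_ubound; exists 1%R => //=; rewrite hausdorff_pre0.
Qed.

Lemma hausdorff1_ge0 A : 0 <= hausdorff1 A.
Proof.
apply: (le_trans (hausdorff_pre_ge0 1 A)).
by apply: ereal_sup_ubound; exists 1%R => //=.
Qed.

Lemma hausdorff1_le : {homo hausdorff1 : A B / A `<=` B >-> A <= B}.
Proof.
move=> A B AB; apply: ge_ereal_sup => _ [d d0 <-].
apply: (le_trans (hausdorff_pre_le d AB)).
by apply: ereal_sup_ubound; exists d.
Qed.

Lemma hausdorff1_sigma_subadditive : sigma_subadditive hausdorff1.
Proof.
move=> A; apply: ge_ereal_sup => _ [d d0 <-].
apply: (le_trans (hausdorff_pre_sigma_subadditive d A)).
apply: lee_nneseries => [n _ _|n _]; first exact: hausdorff_pre_ge0.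
by apply: ereal_sup_ubound; exists d.
Qed.

HB.instance Definition _ := isOuterMeasure.Build R 'rV[R]_2 hausdorff1
  hausdorff1_0 hausdorff1_ge0 hausdorff1_le hausdorff1_sigma_subadditive.

End hausdorff.

(* The plane with the sigma-algebra of H^1-measurable (Caratheodory) sets. *)
Definition hausdorff1_outer (R : realType) :
  {outer_measure set 'rV[R]_2 -> \bar R} := @hausdorff1 R.

Notation plane R := (caratheodory_type (hausdorff1_outer R)).

Definition H1 (R : realType) : {measure set (plane R) -> \bar R} :=
  (hausdorff1_outer R : set (plane R) -> \bar R).

Section measures.
Variable R : realType.
Implicit Types (gam : set (plane R)) (theta : plane R -> 'rV[int]_2)
  (tau : plane R -> 'rV[R]_2) (phi : 'rV[R]_2 -> R).

(* H^1-measurable, of finite H^1 measure, and covered up to an H^1-null set by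
   countably many Lipschitz images of the real line. *)
Definition rectifiable1 gam : Prop :=
  [/\ measurable gam, (H1 R gam < +oo)%E &
    exists f : nat -> R -> 'rV[R]_2, (forall k, lipschitz (f k)) /\
      H1 R (gam `\` \bigcup_k range (f k)) = 0%E].

Definition line (t : 'rV[R]_2) : set (plane R) := range (fun s : R => s *: t).

Definition supp phi : set 'rV[R]_2 := closure [set x | phi x != 0].

(* The approximate tangent space of gam at x is the line spanned by t: the
   blow-ups at x of the measure H^1 restricted to gam converge weakly-* to H^1
   restricted to this line. *)
Definition approx_tangent gam (x t : 'rV[R]_2) : Prop :=
  forall phi, continuous phi -> compact (supp phi) ->
    r^-1 * \int[H1 R]_(y in gam) phi (r^-1 *: (y - x)) @[r --> 0^'+]
      --> \int[H1 R]_(y in line t) phi y.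

Definition iter_partial (s : seq 'I_2) phi : 'rV[R]_2 -> R :=
  foldr (fun j g => fun x => 'D_(evec R j) g x) phi s.

Definition smooth phi : Prop := forall s : seq 'I_2,
  continuous (iter_partial s phi) /\
  forall (j : 'I_2) (x : 'rV[R]_2), derivable (iter_partial s phi) x (evec R j).

(* C_c^oo(Omega), each function being extended by 0 outside Omega. *)
Definition test_fun (Omega : set 'rV[R]_2) phi : Prop :=
  [/\ smooth phi, compact (supp phi) & supp phi `<=` Omega].

Definition density theta tau (x : plane R) : 'M[R]_2 :=
  (toR R (theta x))^T *m tau x.

(* The matrix-valued measure theta (x) tau H^1|_gam. *)
Definition curve_measure gam theta tau (A : set (plane R)) : 'M[R]_2 :=
  \matrix_(i, j) \int[H1 R]_(x in gam `&` A) density theta tau x i j.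

Definition divergence_free (Omega : set 'rV[R]_2) gam theta tau : Prop :=
  forall phi, test_fun Omega phi -> forall i : 'I_2,
    \sum_(j < 2)
      \int[H1 R]_(x in gam) ('D_(evec R j) phi x * density theta tau x i j)
    = 0.

(* The measure theta (x) tau H^1|_gam belongs to M_df^(2)(Omega).  Functions on
   gam are represented by functions on the plane, whose values outside gam play
   no role; the tangency of tau is required H^1-almost everywhere on gam. *)
Definition Mdf (Omega : set 'rV[R]_2) gam theta tau : Prop :=
  [/\ rectifiable1 gam /\ gam `<=` Omega,
      [/\ forall j, measurable_fun gam (fun x => tau x 0 j),
          forall x, gam x -> enorm (tau x) = 1 &
          {ae H1 R, forall x, gam x -> approx_tangent gam x (tau x)}],
      forall i, (H1 R).-integrable gam (fun x => (toR R (theta x) 0 i)%:E) &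
      divergence_free Omega gam theta tau].

Definition half_ball : set 'rV[R]_2 := eball 0 2^-1.

Definition borel : set (set 'rV[R]_2) := <<s open >>.

(* supp (theta (x) tau H^1|_gam - b (x) t H^1|_(line t `&` B_1/2)) is contained
   in B_1/2: the two measures agree on the Borel subsets of B_1/2 \ B' for some
   ball B' compactly contained in B_1/2. *)
Definition straight_near_boundary (b : 'rV[int]_2) (t : 'rV[R]_2)
    gam theta tau : Prop :=
  exists (c : 'rV[R]_2) (r : R),
    [/\ 0 < r, closure (eball c r) `<=` half_ball &
      forall A, borel A -> A `<=` half_ball `\` eball c r ->
        curve_measure gam theta tau A =
        curve_measure (line t `&` half_ball) (fun=> b) (fun=> t) A].

(* The H^1-elliptic envelope of psi; psi is only used at unit vectors. *)
Definition envelope (psi : 'rV[int]_2 -> 'rV[R]_2 -> R)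
    (b : 'rV[int]_2) (t : 'rV[R]_2) : \bar R :=
  ereal_inf [set e | exists gam theta tau,
    [/\ Mdf half_ball gam theta tau,
        straight_near_boundary b t gam theta tau &
        e = (\int[H1 R]_(x in gam) (psi (theta x) (tau x))%:E)%E]].

End measures.

Definition psi (R : realType) (eta : R) (b : 'rV[int]_2) (t : 'rV[R]_2) : R :=
  enorm (toR R b) ^+ 2 + eta * dot (toR R b) t ^+ 2.

Definition psi_e (R : realType) (eta : R) (b : 'rV[int]_2) (t : 'rV[R]_2) : R :=
  if t == 0 then 0 else enorm t * psi eta b ((enorm t)^-1 *: t).

(* Main.v *)
(* Write e12 = e_1 + e_2 and F for the function to be minimised.

   Lower bound, by calibration.  The functions f = psi_e(e_1, .) + psi_e(e_2, .)
   and g = psi_e(e12, .) are sublinear, so Hahn-Banach gives p with p.u <= f u,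
   p.u <= g u and p.t = min F.  Splitting p as m_1 + m_2 in proportion to the
   gradients of psi_e(e_1, .) and psi_e(e_2, .) at the direction of p yields
   b_1 m_1.u + b_2 m_2.u <= psi(b, u) for all integer b and unit u: it is enough
   to check the four shortest b, of which e_1 - e_2 is the delicate one.  Since mu
   is divergence-free and straight near the boundary, its total mass is that of
   b (x) t H^1 on the diameter, and integrating the inequality along mu gives the
   bound.

   Upper bound.  At a minimiser z, either z and t - z have a positive product or
   one of them vanishes, so by Thales the triangle with hypotenuse
   [-rho t, rho t] and legs parallel to t - z and z lies in the ball of radius
   rho.  A line of multiplicity e12 may thus split inside the ball along the
   triangle.  For |beta| copies, small perturbations of the triangles put all
   segments in general position; the network is then a divergence-free curve
   measure whose energy is the sum of the energies of its segments.  Let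
   rho -> 1/2. *)
Require Import Defs.
From mathcomp Require Import all_boot all_order all_algebra.
From mathcomp Require Import all_classical all_reals all_analysis.
From mathcomp Require Import measurable_realfun.
From mathcomp Require Import ring lra.

Set Implicit Arguments.
Unset Strict Implicit.
Unset Printing Implicit Defensive.
Import Order.TTheory GRing.Theory Num.Theory.
Import numFieldNormedType.Exports.
Local Open Scope classical_set_scope.
Local Open Scope ring_scope.

(** * The Euclidean plane and the extended energy *)

Section plane.
Variable R : realType.
Implicit Types (u v w : 'rV[R]_2) (a : R).

(** The energy is quadratic in the multiplicity while the right-hand side is linear in |beta|. This
    shapes the upper bound: the |beta| unit networks must not overlap along a positive length, hence
    the general position. Only the straight ends near the boundary carry the whole multiplicity, and
    their total length 1 - 2 rho tends to 0. In the lower bound the same growth means that the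
    energy may be infinite although theta is integrable, so only expressions linear in the density
    of mu are integrated as real functions. The sum psi_e(e_1, .) + psi_e(e_2, .) is the isotropic
    (2 + eta)|.|, so its two gradients at a unit vector nu add up to (2 + eta) nu, and the
    proportional splitting scales both by |p| / (2 + eta) <= 1. The bounds for e_1 and e_2 are then
    subgradient inequalities and the one for e_1 + e_2 is p <= g, but nothing in the duality
    controls e_1 - e_2: its bound is a trigonometric inequality combined with eta <= 1. Test
    functions come with iterated partial derivatives, and the boundary condition with values on
    Borel sets; a chain rule and a staircase approximation lead from there to line integrals. *)

Lemma I2P (i : 'I_2) : i = 0 \/ i = 1.
Proof. by case: i => -[|[|]]// i; [left|right]; apply/val_inj. Qed.

Lemma sum2E (V : zmodType) (f : 'I_2 -> V) : \sum_(i < 2) f i = f 0 + f 1.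
Proof.
rewrite big_ord_recl big_ord1; congr (_ + f _); exact/val_inj.
Qed.

Lemma rV2P u v : u 0 0 = v 0 0 -> u 0 1 = v 0 1 -> u = v.
Proof. by move=> h0 h1; apply/rowP => i; have [->|->] := I2P i. Qed.

Lemma dotE u v : dot u v = u 0 0 * v 0 0 + u 0 1 * v 0 1.
Proof. by rewrite /dot sum2E. Qed.

Lemma dotC u v : dot u v = dot v u.
Proof. by rewrite !dotE; ring. Qed.

Lemma dotDl u v w : dot (u + v) w = dot u w + dot v w.
Proof. by rewrite !dotE !mxE; ring. Qed.

Lemma dotDr u v w : dot w (u + v) = dot w u + dot w v.
Proof. by rewrite !dotE !mxE; ring. Qed.

Lemma dotZl a u v : dot (a *: u) v = a * dot u v.
Proof. by rewrite !dotE !mxE; ring. Qed.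

Lemma dotZr a u v : dot u (a *: v) = a * dot u v.
Proof. by rewrite !dotE !mxE; ring. Qed.

Lemma dotNl u v : dot (- u) v = - dot u v.
Proof. by rewrite !dotE !mxE; ring. Qed.

Lemma dotNr u v : dot u (- v) = - dot u v.
Proof. by rewrite !dotE !mxE; ring. Qed.

Lemma dot0l u : dot 0 u = 0.
Proof. by rewrite dotE !mxE; ring. Qed.

Lemma dot0r u : dot u 0 = 0.
Proof. by rewrite dotE !mxE; ring. Qed.

Lemma dot_ge0 u : 0 <= dot u u.
Proof. by rewrite dotE; nra. Qed.

Lemma enorm_ge0 u : 0 <= enorm u.
Proof. exact: sqrtr_ge0. Qed.

Lemma enorm_sq u : enorm u ^+ 2 = dot u u.
Proof. by rewrite sqr_sqrtr // dot_ge0. Qed.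

Lemma enorm0 : enorm (0 : 'rV[R]_2) = 0.
Proof. by rewrite /enorm dot0l sqrtr0. Qed.

Lemma enorm_eq0 u : (enorm u == 0) = (u == 0).
Proof.
apply/idP/eqP => [|->]; last by rewrite enorm0.
rewrite -sqrf_eq0 enorm_sq dotE => /eqP h.
by apply: rV2P; rewrite mxE; nra.
Qed.

Lemma enorm_gt0 u : (0 < enorm u) = (u != 0).
Proof. by rewrite lt0r enorm_eq0 enorm_ge0 andbT. Qed.

Lemma enormZ a u : enorm (a *: u) = `|a| * enorm u.
Proof.
by rewrite /enorm dotZl dotZr mulrA -expr2 sqrtrM ?sqr_ge0 // sqrtr_sqr.
Qed.

Lemma enormN u : enorm (- u) = enorm u.
Proof. by rewrite /enorm dotNl dotNr opprK. Qed.

Lemma enormC u v : enorm (u - v) = enorm (v - u).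
Proof. by rewrite -enormN opprB. Qed.

Lemma cauchy_schwarz u v : dot u v <= enorm u * enorm v.
Proof.
have [h|h] := leP (dot u v) 0.
  by rewrite (le_trans h) // mulr_ge0 ?enorm_ge0.
rewrite -ler_sqr ?nnegrE ?mulr_ge0 ?enorm_ge0 ?(ltW h) //.
rewrite exprMn !enorm_sq !dotE.
have := sqr_ge0 (u 0 0 * v 0 1 - u 0 1 * v 0 0); nra.
Qed.

Lemma normr_dot u v : `|dot u v| <= enorm u * enorm v.
Proof.
rewrite ler_norml cauchy_schwarz andbT lerNl -dotNl -(enormN u).
exact: cauchy_schwarz.
Qed.

Lemma enormD u v : enorm (u + v) <= enorm u + enorm v.
Proof.
rewrite -ler_sqr ?nnegrE ?addr_ge0 ?enorm_ge0 //.
rewrite enorm_sq sqrrD !enorm_sq dotDl !dotDr (dotC v u).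
by have := cauchy_schwarz u v; lra.
Qed.

Lemma enormB u v : `|enorm u - enorm v| <= enorm (u - v).
Proof.
rewrite ler_norml; apply/andP; split.
  by have := enormD (v - u) u; rewrite subrK (enormC v); lra.
by have := enormD (u - v) v; rewrite subrK; lra.
Qed.


Lemma coord_le_norm u i : `|u 0 i| <= `|u|.
Proof.
rewrite [X in _ <= X]mx_normrE.
exact: (@le_bigmax _ _ _ 0 (fun ij => `|u ij.1 ij.2|) (0, i)).
Qed.

Lemma enorm_le_norm u : enorm u <= 2 * `|u|.
Proof.
rewrite -ler_sqr ?nnegrE ?mulr_ge0 ?enorm_ge0 // enorm_sq dotE -!expr2.
have h0 := coord_le_norm u 0; have h1 := coord_le_norm u 1.
rewrite -(real_normK (num_real (u 0 0))) -(real_normK (num_real (u 0 1))).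
have := normr_ge0 (u 0 0); have := normr_ge0 (u 0 1); nra.
Qed.

Lemma norm_le_enorm u : `|u| <= enorm u.
Proof.
rewrite [X in X <= _]mx_normrE; apply: bigmax_le; first exact: enorm_ge0.
move=> [i j] _ /=; rewrite ord1.
rewrite -ler_sqr ?nnegrE ?enorm_ge0 // enorm_sq dotE real_normK ?num_real //.
by have [->|->] := I2P j; nra.
Qed.

(** Bridges the Euclidean norm of the estimates and the sup norm behind the topology. No sign is
    assumed on [C], hence the factor [|C| + 1] in the proof. *)
Lemma lip_continuous (f : 'rV[R]_2 -> R) (C : R) :
  (forall u v, `|f u - f v| <= C * enorm (u - v)) -> continuous f.
Proof.
move=> fC u; apply/(@cvgrPdist_le _ _ _ (nbhs u)) => e e0; near=> v.
apply: (le_trans (fC u v)).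
apply: (@le_trans _ _ ((`|C| + 1) * enorm (u - v))).
  by rewrite ler_wpM2r ?enorm_ge0 // (le_trans (ler_norm _)) // lerDl.
have C0 : 0 < `|C| + 1 by rewrite ltr_wpDl.
rewrite -ler_pdivlMl // (le_trans (enorm_le_norm _)) // -ler_pdivlMl //.
near: v; have := @cvg_id _ (nbhs u).
by move=> /cvgrPdist_le; apply; rewrite !mulr_gt0 ?invr_gt0.
Unshelve. all: by end_near. Qed.

Lemma enorm_continuous : continuous (@enorm R).
Proof. by apply: (@lip_continuous _ 1) => u v; rewrite mul1r enormB. Qed.

End plane.

Section sublinear.
Variable R : realType.
Variable eta : R.
Hypothesis heta : 0 <= eta <= 1.
Implicit Types (u v w z t p nu : 'rV[R]_2) (b : 'rV[int]_2).

Local Notation e1 := (evec int 0).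
Local Notation e2 := (evec int 1).
Local Notation pe := (psi_e eta).

Lemma psi_eE b z :
  pe b z = enorm (toR R b) ^+ 2 * enorm z + eta * dot (toR R b) z ^+ 2 / enorm z.
Proof.
rewrite /psi_e /psi; case: eqP => [->|/eqP z0].
  by rewrite enorm0 dot0r; ring.
rewrite dotZr; have : enorm z != 0 by rewrite enorm_eq0.
by move=> ?; field.
Qed.

Lemma psi_e_unit b z : enorm z = 1 -> pe b z = psi eta b z.
Proof. by move=> h; rewrite psi_eE /psi h; field. Qed.

Lemma psi_eN b z : pe b (- z) = pe b z.
Proof. by rewrite !psi_eE enormN dotNr sqrrN. Qed.

Lemma psi_eNl b z : pe (- b) z = pe b z.
Proof.
rewrite !psi_eE; have -> : toR R (- b) = - toR R b.
  by apply/rowP => i; rewrite !mxE rmorphN.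
by rewrite enormN dotNl sqrrN.
Qed.

Lemma psi_e0 b : pe b 0 = 0.
Proof. by rewrite psi_eE enorm0 dot0r; ring. Qed.

Lemma psi_eZ b a z : 0 <= a -> pe b (a *: z) = a * pe b z.
Proof.
move=> a0; rewrite !psi_eE enormZ ger0_norm // dotZr.
have [->|an0] := eqVneq a 0; first by ring.
have [->|zn0] := eqVneq z 0; first by rewrite enorm0 dot0r; ring.
by field; rewrite enorm_eq0 zn0 an0.
Qed.

Lemma psi_e_ge b z : enorm (toR R b) ^+ 2 * enorm z <= pe b z.
Proof.
rewrite psi_eE lerDl divr_ge0 ?enorm_ge0 // mulr_ge0 ?sqr_ge0 //.
by case/andP: heta.
Qed.

Lemma psi_e_ge0 b z : 0 <= pe b z.
Proof. by rewrite (le_trans _ (psi_e_ge _ _)) // mulr_ge0 ?sqr_ge0 ?enorm_ge0. Qed.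

Lemma psi_e_le b z : pe b z <= 2 * enorm (toR R b) ^+ 2 * enorm z.
Proof.
rewrite psi_eE -[leRHS]mulrA mulr_natl mulr2n lerD2l.
have [->|zn0] := eqVneq z 0; first by rewrite enorm0 dot0r; lra.
have z0 : 0 < enorm z by rewrite enorm_gt0.
rewrite ler_pdivrMr // -mulrA -expr2 -exprMn.
have h : dot (toR R b) z ^+ 2 <= (enorm (toR R b) * enorm z) ^+ 2.
  rewrite -[X in X <= _]real_normK ?num_real // lerXn2r ?nnegrE //.
  - by rewrite mulr_ge0 ?enorm_ge0.
  - exact: normr_dot.
have := sqr_ge0 (dot (toR R b) z); case/andP: heta; nra.
Qed.

Definition psi_grad b nu : 'rV[R]_2 :=
  let B := toR R b in
  (dot B B) *: nu + eta *: ((2 * dot B nu) *: B - (dot B nu) ^+ 2 *: nu).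

Lemma psi_gradE b nu z : dot (psi_grad b nu) z =
  dot (toR R b) (toR R b) * dot nu z +
  eta * (2 * dot (toR R b) nu * dot (toR R b) z - dot (toR R b) nu ^+ 2 * dot nu z).
Proof. by rewrite /psi_grad dotDl !dotZl dotDl dotNl !dotZl. Qed.

(** Convexity of [psi_e eta b] in subgradient form; subadditivity and the calibration bounds for
    single basis vectors both come from it. *)
Lemma psi_grad_le b nu z : enorm nu = 1 -> dot (psi_grad b nu) z <= pe b z.
Proof.
move=> hnu; rewrite psi_gradE psi_eE enorm_sq.
have [->|zn0] := eqVneq z 0; first by rewrite enorm0 !dot0r; lra.
have z0 : 0 < enorm z by rewrite enorm_gt0.
rewrite -(ler_pM2r z0) [leRHS]mulrDl divfK ?gt_eqF //.
have cs := cauchy_schwarz nu z; have cb := normr_dot (toR R b) nu.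
rewrite hnu mul1r in cs; rewrite hnu mulr1 in cb.
set B := toR R b in cb *.
have hB : dot B nu ^+ 2 <= dot B B.
  by rewrite -enorm_sq -[X in X <= _]real_normK ?num_real // lerXn2r ?nnegrE ?enorm_ge0.
set c := dot nu z in cs *; set x := dot B nu in hB *; set y := dot B z.
set r := enorm z in z0 cs *; set q := dot B B in hB *.
case/andP: heta => h0 h1; rewrite -subr_ge0.
(* Multiplied by [r = enorm z], the gap splits into two nonnegative terms: [c <= r] by
   Cauchy-Schwarz, and [eta * x ^+ 2 <= q] because [eta <= 1]. *)
have -> : q * r * r + eta * y ^+ 2 - (q * c + eta * (2 * x * y - x ^+ 2 * c)) * r =
  (q - eta * x ^+ 2) * (r * (r - c)) + eta * (y - x * r) ^+ 2 by ring.
rewrite addr_ge0 // mulr_ge0 ?sqr_ge0 // ?mulr_ge0 ?subr_ge0 ?(ltW z0) //.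
by rewrite (le_trans _ hB) // ler_piMl ?sqr_ge0.
Qed.

Lemma psi_grad_self b z : psi_e eta b z = dot (psi_grad b ((enorm z)^-1 *: z)) z.
Proof.
rewrite psi_gradE psi_eE !dotZl !dotZr.
have [->|zn0] := eqVneq z 0; first by rewrite enorm0 !dot0r; ring.
have z0 : enorm z != 0 by rewrite enorm_eq0.
by rewrite -!enorm_sq; field.
Qed.

Lemma enorm_unit z : z != 0 -> enorm ((enorm z)^-1 *: z) = 1.
Proof.
move=> z0; rewrite enormZ ger0_norm ?invr_ge0 ?enorm_ge0 // mulVf //.
by rewrite enorm_eq0.
Qed.

Lemma psi_eD b u v : pe b (u + v) <= pe b u + pe b v.
Proof.
have [->|n0] := eqVneq (u + v) 0; first by rewrite psi_e0 addr_ge0 ?psi_e_ge0.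
rewrite psi_grad_self dotDr.
by rewrite lerD // psi_grad_le // enorm_unit.
Qed.

Lemma psi_e_lip b u v : `|pe b u - pe b v| <= 2 * enorm (toR R b) ^+ 2 * enorm (u - v).
Proof.
rewrite ler_norml; apply/andP; split.
  have := psi_eD b (v - u) u; have := psi_e_le b (v - u).
  by rewrite subrK enormC; lra.
have := psi_eD b (u - v) v; have := psi_e_le b (u - v).
by rewrite subrK; lra.
Qed.

Lemma psi_e_continuous b : continuous (pe b).
Proof. exact: lip_continuous (psi_e_lip b). Qed.

End sublinear.

(** * Calibration *)

Section calibration.
Variable R : realType.
Variable eta : R.
Hypothesis heta : 0 <= eta <= 1.
Implicit Types (u v w z t p nu : 'rV[R]_2) (b : 'rV[int]_2).

Local Notation e1 := (evec int 0).
Local Notation e2 := (evec int 1).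
Local Notation pe := (psi_e eta).

Definition splitting_energy t z : R :=
  pe e1 z + pe e2 z + pe (e1 + e2) (t - z).
Local Notation F := splitting_energy.

Lemma toR00 b : toR R b 0 0 = (b 0 0)%:~R. Proof. by rewrite mxE. Qed.
Lemma toR01 b : toR R b 0 1 = (b 0 1)%:~R. Proof. by rewrite mxE. Qed.

(** The squared components of [z] along [e1] and [e2] add up to [enorm z ^+ 2], so the two
    anisotropies compensate. *)
Lemma psi_e_sum z : pe e1 z + pe e2 z = (2 + eta) * enorm z.
Proof.
rewrite !psi_eE !enorm_sq !dotE !toR00 !toR01 !mxE /=.
have [->|zn0] := eqVneq z 0; first by rewrite enorm0 !mxE; ring.
have z0 : enorm z != 0 by rewrite enorm_eq0.
have := enorm_sq z; rewrite dotE => h.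
apply: (mulIf z0); rewrite mulrDl !mulrDl !mulfVK //.
have h2 : enorm z * enorm z = z 0 0 * z 0 0 + z 0 1 * z 0 1 by rewrite -expr2.
ring: h2.
Qed.

Lemma enorm_e12 : enorm (toR R (e1 + e2)) ^+ 2 = 2.
Proof. by rewrite enorm_sq dotE toR00 toR01 !mxE /=; ring. Qed.

Lemma splitting_energyZ a t z : 0 <= a -> F (a *: t) (a *: z) = a * F t z.
Proof.
by move=> a0; rewrite /F -scalerBr !psi_eZ //; ring.
Qed.

Lemma splitting_energy_ge0 t z : 0 <= F t z.
Proof. by rewrite !addr_ge0 ?psi_e_ge0. Qed.

(** Joint subadditivity in both arguments is what makes the minimum over [z] sublinear in [t]. *)
Lemma splitting_energyD t t' z z' : F (t + t') (z + z') <= F t z + F t' z'.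
Proof.
rewrite /F; have -> : t + t' - (z + z') = (t - z) + (t' - z').
  by apply/matrixP => i j; rewrite !mxE; ring.
have := psi_eD heta e1 z z'; have := psi_eD heta e2 z z'.
by have := psi_eD heta (e1 + e2) (t - z) (t' - z'); lra.
Qed.

Lemma splitting_energy_min t : exists z, forall z', F t z <= F t z'.
Proof.
have cF : continuous (F t).
  have -> : F t = (pe e1 \+ pe e2) \+ (fun z => pe (e1 + e2) (t - z)) by [].
  move=> z; apply: continuousD.
    by apply: continuousD; exact: psi_e_continuous.
  apply: (@lip_continuous _ _ (2 * enorm (toR R (e1 + e2)) ^+ 2)) => u v.
  rewrite -(enormN (u - v)) (_ : - (u - v) = (t - u) - (t - v)); last first.
    by apply/matrixP => i j; rewrite !mxE; ring.
  exact: psi_e_lip.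
(* Since [F t z >= enorm z], no point outside the disc of radius [F t 0] does better than 0, so a
   minimum over this compact disc is global. *)
pose r := F t 0.
have r0 : 0 <= r := splitting_energy_ge0 t 0.
pose K := [set z : 'rV[R]_2 | enorm z <= r].
have K0 : K 0 by rewrite /K /= enorm0.
have cK : compact K.
  apply: bounded_closed_compact.
    exists r; split; first exact: num_real.
    by move=> M rM z Kz; apply: (le_trans (norm_le_enorm z)); apply: (le_trans Kz); exact: ltW.
  rewrite (_ : K = (@enorm R) @^-1` [set x | x <= r]) //.
  by apply: preimage_closed; [move=> ? _; exact: enorm_continuous|exact: closed_le].
have [z zK zmin] := EVT_min_rV (ex_intro _ 0 K0) cK (continuous_subspaceT cF).
exists z => z'; have [h|h] := leP (enorm z') r.
  by apply: zmin; rewrite inE.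
rewrite (le_trans (zmin 0 _)) ?inE //.
rewrite (le_trans (ltW h)) // /F psi_e_sum.
have := psi_e_ge0 heta (e1 + e2) (t - z'); have := enorm_ge0 z'.
by case/andP: heta; nra.
Qed.

Definition perp u : 'rV[R]_2 := \row_j (if j == 0 then - u 0 1 else u 0 0).


(* Two-dimensional Hahn-Banach for the sublinear function [t |-> min_z F t z]. *)
Lemma splitting_energy_dual t z : enorm t = 1 -> (forall z', F t z <= F t z') ->
  exists2 p, dot p t = F t z & forall s u, dot p s <= F s u.
Proof.
move=> t1 zmin.
have Fl a v : a * F t z <= F (a *: t) v.
  have [a0|a0] := ltP 0 a; last first.
    rewrite (le_trans _ (splitting_energy_ge0 _ _)) //.
    by rewrite mulr_le0_ge0 // splitting_energy_ge0.
  have -> : v = a *: (a^-1 *: v) by rewrite scalerA divff ?scale1r // gt_eqF.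
  by rewrite splitting_energyZ ?(ltW a0) // ler_pM2l.
pose n := perp t.
(* Lower bounds for the value of the functional on [n], forced by the vectors [a *: t - n]. By [Fl]
   and joint subadditivity each lies below every upper bound forced by a vector [a' *: t + n], so
   their supremum [c] is an admissible value. *)
pose A := [set a * F t z - F (a *: t - n) u | a in [set: R] & u in [set: 'rV[R]_2]].
have Aub a' u' : ubound A (F (a' *: t + n) u' - a' * F t z).
  move=> _ [a _ [u _ <-]].
  have := splitting_energyD (a *: t - n) (a' *: t + n) u u'.
  rewrite (_ : a *: t - n + (a' *: t + n) = (a + a') *: t); last first.
    by rewrite scalerDl; apply/matrixP => i j; rewrite !mxE; ring.
  by have := Fl (a + a') (u + u'); rewrite mulrDl; lra.
have A0 : A !=set0 by exists (0 * F t z - F (0 *: t - n) 0), 0 => //; exists 0.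
pose c := sup A.
have c1 a' u' : c <= F (a' *: t + n) u' - a' * F t z by exact: ge_sup.
have c2 a u : a * F t z - F (a *: t - n) u <= c.
  apply: ub_le_sup; last by exists a => //; exists u.
  by exists (F (0 *: t + n) 0 - 0 * F t z); exact: Aub.
have tt : t 0 0 * t 0 0 = 1 - t 0 1 * t 0 1.
  by have := enorm_sq t; rewrite t1 dotE expr1n => ->; rewrite addrK.
exists (F t z *: t + c *: n).
  by rewrite dotE !mxE /=; ring: tt.
move=> s u.
pose a := dot s t; pose d := dot s n.
have sE : s = a *: t + d *: n.
  by apply: rV2P; rewrite !mxE /a /d !dotE !mxE /=; ring: tt.
have -> : dot (F t z *: t + c *: n) s = a * F t z + d * c.
  by rewrite /a /d !dotE !mxE /=; ring.
have [d0|d0|d0] := ltgtP d 0.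
- have nd : 0 < - d by rewrite oppr_gt0.
  have -> : F s u = - d * F ((a / - d) *: t - n) ((- d)^-1 *: u).
    rewrite -splitting_energyZ ?(ltW nd) // scalerBr !scalerA divff ?gt_eqF //.
    by rewrite scale1r (mulrC (- d)) divfK ?gt_eqF // scaleNr opprK -sE.
  have := c2 (a / - d) ((- d)^-1 *: u).
  by rewrite -(ler_pM2l nd) mulrBr mulrA (mulrC (- d)) divfK ?gt_eqF //; lra.
- have -> : F s u = d * F ((a / d) *: t + n) (d^-1 *: u).
    rewrite -splitting_energyZ ?(ltW d0) // scalerDr !scalerA divff ?gt_eqF //.
    by rewrite scale1r (mulrC d) divfK ?gt_eqF // -sE.
  have := c1 (a / d) (d^-1 *: u).
  by rewrite -(ler_pM2l d0) mulrBr mulrA [d * (a / d)]mulrC divfK ?gt_eqF //; lra.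
- by rewrite d0 mul0r addr0 sE d0 scale0r addr0.
Qed.


(** The constraint of the calibration at [e1 - e2], with a factor [eta] removed. There the energy of
    a unit [z] is 2 + eta (1 - 2 z_1 z_2), and 3 eta <= 2 + eta explains the constant 3. *)
Lemma calibration_cross nu z : enorm nu = 1 -> enorm z = 1 ->
  (nu 0 1 ^+ 2 - nu 0 0 ^+ 2) * dot nu z + 2 * (nu 0 0 * z 0 0 - nu 0 1 * z 0 1)
  + 2 * (z 0 0 * z 0 1) <= 3.
Proof.
move=> hn hz.
have nn : nu 0 0 ^+ 2 = 1 - nu 0 1 ^+ 2.
  by have := enorm_sq nu; rewrite hn dotE expr1n -!expr2 => ->; rewrite addrK.
have zz : z 0 0 ^+ 2 = 1 - z 0 1 ^+ 2.
  by have := enorm_sq z; rewrite hz dotE expr1n -!expr2 => ->; rewrite addrK.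
rewrite dotE; set x := nu 0 0 in nn *; set y := nu 0 1 in nn *.
set a := z 0 0 in zz *; set b := z 0 1 in zz *.
(* In terms of the angles phi of nu and omega of z, the left-hand side is
   - cos (3 phi - omega) / 2 + 3 cos (phi + omega) / 2 + sin (2 omega). *)
have c1 : x * a - y * b <= 1.
  by have := sqr_ge0 (x - a); have := sqr_ge0 (y + b); lra.
pose C := a * (x * (x ^+ 2 - 3 * y ^+ 2)) + b * (y * (3 * x ^+ 2 - y ^+ 2)).
have c2 : -1 <= C.
  have h : (x * (x ^+ 2 - 3 * y ^+ 2)) ^+ 2 + (y * (3 * x ^+ 2 - y ^+ 2)) ^+ 2 = 1.
    by ring: nn.
  rewrite /C; set p := x * _ in h *; set q := y * _ in h *.
  by have := sqr_ge0 (a + p); have := sqr_ge0 (b + q); lra.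
have c3 : 2 * (a * b) <= 1 by have := sqr_ge0 (a - b); nra.
have -> : (y ^+ 2 - x ^+ 2) * (x * a + y * b) + 2 * (x * a - y * b) + 2 * (a * b) =
  - C / 2 + (3 / 2) * (x * a - y * b) + 2 * (a * b).
  by rewrite /C; field: nn.
lra.
Qed.

(* A bound on the four shortest directions of the lattice propagates to the
   whole lattice. *)
Lemma lattice_bound (A B C x y : R) : 1 <= A -> 1 <= B -> `|2 * C| <= 1 ->
  `|x| <= A -> `|y| <= B -> `|x + y| <= A + B + 2 * C ->
  `|x - y| <= A + B - 2 * C -> forall m n : int,
  m%:~R * x + n%:~R * y <= A * m%:~R ^+ 2 + B * n%:~R ^+ 2 + 2 * C * m%:~R * n%:~R.
Proof.
have key (A' B' C' x' y' : R) (i j : nat) : 1 <= A' -> 1 <= B' -> `|2 * C'| <= 1 ->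
    `|x'| <= A' -> `|x' + y'| <= A' + B' + 2 * C' -> (j <= i)%N ->
    i%:R * x' + j%:R * y' <= A' * i%:R ^+ 2 + B' * j%:R ^+ 2 + 2 * C' * i%:R * j%:R.
  move=> hA hB hC hx hxy ji.
  case: i ji => [|i ji]; first by rewrite leqn0 => /eqP ->; lra.
  have ji' : (j%:R : R) <= i.+1%:R by rewrite ler_nat.
  have i1 : (1 : R) <= i.+1%:R by rewrite ler1n.
  move: (i.+1%:R : R) ji' i1 => m ji' i1.
  have jj : j%:R * (j%:R - 1) >= 0 :> R.
    case: (j) => [|k]; first by rewrite mul0r.
    by rewrite mulr_ge0 // subr_ge0 ler1n.
  have j0 : 0 <= j%:R :> R by [].
  move: (j%:R : R) j0 jj ji' => n j0 jj ji'.
  move: hx hxy hC; rewrite !ler_norml => /andP[_ hx] /andP[_ hxy] /andP[hC _].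
  (* From (m, n) = n (1, 1) + (m - n) (1, 0). The gap that remains is (m - 1)(A' m + 2 C' n) + B' n
     (n - 1), whose terms are [h3] and [h4]; integrality enters through n (n - 1) >= 0. *)
  have h1 : m * x' + n * y' <= n * (A' + B' + 2 * C') + (m - n) * A'.
    have := ler_wpM2l j0 hxy; have : 0 <= m - n by lra.
    by move=> /ler_wpM2l /(_ _ _ hx); lra.
  have h2 : 0 <= A' * m + 2 * C' * n.
    have : 1 * m <= A' * m by rewrite ler_wpM2r //; lra.
    have : -1 * n <= 2 * C' * n by rewrite ler_wpM2r.
    lra.
  have h3 : 0 <= (m - 1) * (A' * m + 2 * C' * n) by rewrite mulr_ge0 //; lra.
  have h4 : 0 <= B' * (n * (n - 1)) by rewrite mulr_ge0 //; lra.
  lra.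
move=> hA hB hC hx hy hp hm m n.
(* Extracting signs [s] and [s'] reduces to natural numbers, with [C] replaced by [s * s' * C]; when
   [i < j] the two coordinates are exchanged. *)
have sgn (k : int) : exists (j : nat) (s : R), [/\ s ^+ 2 = 1, s = 1 \/ s = -1 &
    k%:~R = s * j%:R].
  case: k => j; [exists j, 1|exists j.+1, (-1)]; split.
  - by rewrite expr1n.
  - by left.
  - by rewrite mul1r.
  - by rewrite sqrrN expr1n.
  - by right.
  - by rewrite NegzE mulN1r rmorphN.
have [i [s [s2 s1 ->]]] := sgn m; have [j [s' [s2' s1' ->]]] := sgn n.
have e1 : `|s * x| <= A by case: s1 => ->; rewrite ?mul1r ?mulN1r ?normrN.
have e2 : `|s' * y| <= B by case: s1' => ->; rewrite ?mul1r ?mulN1r ?normrN.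
have e3 : `|s * x + s' * y| <= A + B + 2 * (s * s' * C).
  case: s1 => ->; case: s1' => ->; rewrite ?mul1r ?mulN1r ?mulr1 ?opprK.
  - exact: hp.
  - by rewrite mulrN; exact: hm.
  - by rewrite addrC distrC mulrN.
  - by rewrite mul1r -opprD normrN.
have e4 : `|2 * (s * s' * C)| <= 1.
  by case: s1 => ->; case: s1' => ->; rewrite ?mul1r ?mulN1r ?opprK ?mul1r ?mulrN ?normrN.
have e5 : `|s' * y + s * x| <= B + A + 2 * (s' * s * C).
  by rewrite (addrC (s' * y)) (addrC B) (mulrC s' s).
have e6 : `|2 * (s' * s * C)| <= 1 by rewrite (mulrC s' s).
have [ij|/ltnW ij] := leqP j i.
  have := key _ _ _ _ _ i j hA hB e4 e1 e3 ij.
  have -> : A * (s * i%:R) ^+ 2 = A * i%:R ^+ 2 by rewrite exprMn s2 mul1r.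
  have -> : B * (s' * j%:R) ^+ 2 = B * j%:R ^+ 2 by rewrite exprMn s2' mul1r.
  lra.
have := key _ _ _ _ _ j i hB hA e6 e2 e5 ij.
have -> : A * (s * i%:R) ^+ 2 = A * i%:R ^+ 2 by rewrite exprMn s2 mul1r.
have -> : B * (s' * j%:R) ^+ 2 = B * j%:R ^+ 2 by rewrite exprMn s2' mul1r.
lra.
Qed.


Lemma psi_quadratic b t : enorm t = 1 -> psi eta b t =
  (1 + eta * t 0 0 ^+ 2) * (b 0 0)%:~R ^+ 2 + (1 + eta * t 0 1 ^+ 2) * (b 0 1)%:~R ^+ 2
  + 2 * (eta * (t 0 0 * t 0 1)) * (b 0 0)%:~R * (b 0 1)%:~R.
Proof. by rewrite /psi enorm_sq !dotE !toR00 !toR01 => _; ring. Qed.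

(** The sign of [dot z (t - z)] is complementary slackness: at the minimiser [p] attains the bound
    [pf] at [z] and the bound [pg] at [t - z]. As [enorm p <= 2 + eta], the first equality makes [p]
    a positive multiple of [z] when [z] is nonzero, and the second value is positive when [t - z] is
    nonzero. *)
Lemma calibration t : enorm t = 1 -> exists z, [/\ forall z', F t z <= F t z',
  [\/ z = 0, t - z = 0 | 0 < dot z (t - z)] &
  exists m1 m2 : 'rV[R]_2, dot (m1 + m2) t = F t z /\
    forall b tau, enorm tau = 1 ->
      (b 0 0)%:~R * dot m1 tau + (b 0 1)%:~R * dot m2 tau <= psi eta b tau].
Proof.
move=> t1; have [z zmin] := splitting_energy_min t.
have [p pt pF] := splitting_energy_dual t1 zmin.
case/andP: (heta) => h0 h1.
have pf s : dot p s <= (2 + eta) * enorm s.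
  by rewrite (le_trans (pF s s)) // /F subrr psi_e0 addr0 psi_e_sum.
have pg s : dot p s <= pe (e1 + e2) s.
  by rewrite (le_trans (pF s 0)) // /F !psi_e0 !add0r subr0.
have p2 : enorm p <= 2 + eta.
  have [->|p0] := eqVneq p 0; first by rewrite enorm0; lra.
  have ep : 0 < enorm p by rewrite enorm_gt0.
  by rewrite -(ler_pM2r ep) -expr2 enorm_sq pf.
exists z; split => //.
- have [->|z0] := eqVneq z 0; first by constructor 1.
  have [w0|w0] := eqVneq (t - z) 0; first by constructor 2.
  constructor 3.
  have ez : 0 < enorm z by rewrite enorm_gt0.
  have ew : 0 < enorm (t - z) by rewrite enorm_gt0.
  have E : dot p z + dot p (t - z) = (2 + eta) * enorm z + pe (e1 + e2) (t - z).
    by rewrite -dotDr addrC subrK pt /F psi_e_sum.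
  have Ez : dot p z = (2 + eta) * enorm z.
    by have := pf z; have := pg (t - z); lra.
  have Ew : dot p (t - z) = pe (e1 + e2) (t - z) by lra.
  (* Equality case of Cauchy-Schwarz: [dot q q] expands to [enorm p ^+ 2 - (2 + eta) ^+ 2], which is
     at most 0. *)
  pose q := p - ((2 + eta) / enorm z) *: z.
  have q0 : q = 0.
    apply/eqP; rewrite -enorm_eq0 -sqrf_eq0 enorm_sq /q dotDl !dotDr !dotNl !dotNr.
    rewrite !dotZl !dotZr (dotC z p) Ez -!enorm_sq.
    have -> : (2 + eta) / enorm z * ((2 + eta) * enorm z) = (2 + eta) ^+ 2.
      by field; rewrite gt_eqF.
    have -> : (2 + eta) / enorm z * ((2 + eta) / enorm z * enorm z ^+ 2) = (2 + eta) ^+ 2.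
      by field; rewrite gt_eqF.
    have : 0 <= dot q q by exact: dot_ge0.
    rewrite /q dotDl !dotDr !dotNl !dotNr !dotZl !dotZr (dotC z p) Ez -!enorm_sq.
    have -> : (2 + eta) / enorm z * ((2 + eta) * enorm z) = (2 + eta) ^+ 2.
      by field; rewrite gt_eqF.
    have -> : (2 + eta) / enorm z * ((2 + eta) / enorm z * enorm z ^+ 2) = (2 + eta) ^+ 2.
      by field; rewrite gt_eqF.
    have : enorm p ^+ 2 <= (2 + eta) ^+ 2.
      by rewrite lerXn2r ?nnegrE ?enorm_ge0 //; lra.
    by move=> a b; apply/eqP; lra.
  have pE : p = ((2 + eta) / enorm z) *: z by apply/eqP; rewrite -subr_eq0 -/q q0.
  have : 0 < dot p (t - z).
    by rewrite Ew (lt_le_trans _ (psi_e_ge heta _ _)) // enorm_e12 mulr_gt0.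
  by rewrite pE dotZl pmulr_rgt0 // divr_gt0 //; lra.
have [nu nu1 pnu] : exists2 nu, enorm nu = 1 & p = enorm p *: nu.
  have [p0|p0] := eqVneq p 0; first by exists t => //; rewrite p0 enorm0 scale0r.
  exists ((enorm p)^-1 *: p); first exact: enorm_unit.
  by rewrite scalerA divff ?scale1r // enorm_eq0.
(* The gradients of the two basis energies at [nu] add up to [(2 + eta) *: nu], so scaling both by
   [c] makes them add up to [p]. *)
pose c := enorm p / (2 + eta).
have c0 : 0 <= c by rewrite divr_ge0 ?enorm_ge0 //; lra.
have c1 : c <= 1 by rewrite ler_pdivrMr ?mul1r //; lra.
have nn : nu 0 0 ^+ 2 = 1 - nu 0 1 ^+ 2.
  by have := enorm_sq nu; rewrite nu1 dotE expr1n -!expr2 => ->; rewrite addrK.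
exists (c *: psi_grad eta e1 nu), (c *: psi_grad eta e2 nu).
have mp : c *: psi_grad eta e1 nu + c *: psi_grad eta e2 nu = p.
  have E : psi_grad eta e1 nu + psi_grad eta e2 nu = (2 + eta) *: nu.
    apply: rV2P; rewrite /psi_grad !dotE !mxE /=.
      by ring: nn.
    by ring: nn.
  rewrite -scalerDr E scalerA /c divfK -?pnu //.
  by rewrite gt_eqF //; lra.
split => [|b tau tau1]; first by rewrite mp.
rewrite psi_quadratic //; set A := 1 + _; set B := 1 + _; set C := eta * _.
have tt : tau 0 0 ^+ 2 = 1 - tau 0 1 ^+ 2.
  by have := enorm_sq tau; rewrite tau1 dotE expr1n -!expr2 => ->; rewrite addrK.
(* As [0 <= c <= 1], two-sided bounds for the unscaled gradients survive the scaling. *)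
have scal (X Y : R) : X <= Y -> - X <= Y -> `|c * X| <= Y.
  move=> XY nXY; rewrite normrM (ger0_norm c0).
  have : `|X| <= Y by rewrite ler_norml lerNl nXY XY.
  by apply: le_trans; rewrite ler_piMl.
have bnd b' : `|c * dot (psi_grad eta b' nu) tau| <= psi eta b' tau.
  apply: scal; rewrite -psi_e_unit //.
    exact: psi_grad_le.
  by rewrite -dotNr -psi_eN psi_grad_le.
apply: lattice_bound.
- by rewrite lerDl mulr_ge0 ?sqr_ge0.
- by rewrite lerDl mulr_ge0 ?sqr_ge0.
- rewrite ler_norml /C; have := sqr_ge0 (tau 0 0 - tau 0 1); have := sqr_ge0 (tau 0 0 + tau 0 1).
  by nra.
- rewrite dotZl (le_trans (bnd e1)) // psi_quadratic // !mxE /=.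
  by rewrite /A; lra.
- rewrite dotZl (le_trans (bnd e2)) // psi_quadratic // !mxE /=.
  by rewrite /B; lra.
(* At [e1 + e2] the scaled gradients recombine to [p], so the bound is the dual constraint [pg]. *)
- have ABC : psi eta (e1 + e2) tau = A + B + 2 * C.
    by rewrite psi_quadratic // !mxE /= /A /B /C; ring.
  rewrite -dotDl mp -ABC ler_norml -psi_e_unit // pg andbT.
  by rewrite lerNl -dotNr -psi_eN pg.
(* At [e1 - e2] the isotropic parts of the gradients cancel and only a multiple of [eta] is left. *)
- rewrite !dotZl -mulrBr.
  have E tau' : dot (psi_grad eta e1 nu) tau' - dot (psi_grad eta e2 nu) tau' =
     eta * ((nu 0 1 ^+ 2 - nu 0 0 ^+ 2) * dot nu tau' +
     2 * (nu 0 0 * tau' 0 0 - nu 0 1 * tau' 0 1)).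
    by rewrite !psi_gradE !dotE !mxE /=; ring.
  have ABC : A + B - 2 * C = 2 + eta * (1 - 2 * (tau 0 0 * tau 0 1)).
    by rewrite /A /B /C; ring: tt.
  rewrite ABC; apply: scal.
    rewrite E; have := calibration_cross nu1 tau1.
    by move=> /(ler_wpM2l h0); lra.
  have := E (- tau); have := calibration_cross nu1 (etrans (enormN tau) tau1).
  by rewrite !mxE mulrNN !dotNr => /(ler_wpM2l h0); lra.
Qed.

End calibration.

(** * Hausdorff measure of Borel sets and of segments *)

Section hausdorff_borel.
Variable R : realType.
Local Open Scope ereal_scope.
Implicit Types (A B X : set 'rV[R]_2).

Lemma enorm_le_diam A x y : A x -> A y -> (enorm (x - y))%:E <= diam A.
Proof. by move=> Ax Ay; apply: ereal_sup_ubound; right; exists (x, y). Qed.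

Lemma hausdorff_pre_antitone A (d e : R) : (d <= e)%R ->
  hausdorff_pre e A <= hausdorff_pre d A.
Proof.
move=> de; apply: ereal_inf_le_tmp => _ [U [dU AU] <-]; exists U => //.
by split => // i; rewrite (le_trans (dU i)) // lee_fin.
Qed.

Lemma hausdorff_pre_le1 A (d : R) : (0 < d)%R -> hausdorff_pre d A <= hausdorff1 A.
Proof. by move=> d0; apply: ereal_sup_ubound; exists d. Qed.

Definition separated A B := exists2 e : R, (0 < e)%R &
  forall a b, A a -> B b -> (e <= enorm (a - b))%R.

(** A set of diameter at most [d < e] cannot meet both [A] and [B], so a cover of the union splits
    into the sets [V] that meet [A] and the remaining sets [W], which cover [B]. *)
Lemma hausdorff_pre_separated A B (e d : R) : (d < e)%R ->
  (forall a b, A a -> B b -> (e <= enorm (a - b))%R) ->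
  hausdorff_pre d A + hausdorff_pre d B <= hausdorff_pre d (A `|` B).
Proof.
move=> de sAB; apply: le_ereal_inf_tmp => _ [U [dU ABU] <-].
pose m i := `[< (U i `&` A) !=set0 >].
pose V i := if m i then U i else set0.
pose W i := if m i then set0 else U i.
have -> : \sum_(i <oo) diam (U i) = \sum_(i <oo) (diam (V i) + diam (W i)).
  by apply: eq_eseriesr => i _; rewrite /V /W; case: (m i); rewrite diam0 ?adde0 ?add0e.
have d0 : 0 <= d%:E by exact: le_trans (diam_ge0 (U 0%N)) (dU 0%N).
rewrite nneseriesD; [|by move=> *; exact: diam_ge0|by move=> *; exact: diam_ge0].
apply: leeD; apply: ereal_inf_lbound.
  exists V => //; split => [i|a Aa]; first by rewrite /V; case: (m i) => //; rewrite diam0.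
  have [i _ Uia] := ABU a (or_introl Aa); exists i => //.
  by rewrite /V; have -> : m i by apply/asboolP; exists a.
exists W => //; split => [i|b Bb]; first by rewrite /W; case: (m i) => //; rewrite diam0.
have [i _ Uib] := ABU b (or_intror Bb); exists i => //.
rewrite /W; case: ifPn => // /asboolP[a [Uia Aa]]; exfalso.
have := le_trans (enorm_le_diam Uia Uib) (dU i).
by rewrite lee_fin leNgt (lt_le_trans de) // sAB.
Qed.

Lemma hausdorff1_separated A B : separated A B ->
  hausdorff1 A + hausdorff1 B <= hausdorff1 (A `|` B).
Proof.
move=> [e e0 sAB].
have [->|] := eqVneq (hausdorff1 (A `|` B)) +oo; first by rewrite leey.
rewrite -ltey => fin.
(* Two independent scales, so that the suprema defining the two Hausdorff measures can be taken one
   after the other. *)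
have key d1 d2 : (0 < d1)%R -> (0 < d2)%R ->
    hausdorff_pre d1 A + hausdorff_pre d2 B <= hausdorff1 (A `|` B).
  move=> d10 d20; pose d := Num.min (Num.min d1 d2) (e / 2)%R.
  have d0 : (0 < d)%R by rewrite !lt_min d10 d20 divr_gt0.
  have de : (d < e)%R by rewrite !gt_min ltr_pdivrMr // ltr_pMr // ltr1n orbT.
  apply: le_trans (hausdorff_pre_le1 _ d0).
  apply: le_trans (hausdorff_pre_separated de sAB).
  by apply: leeD; apply: hausdorff_pre_antitone; rewrite !ge_min lexx ?orbT.
have finB d2 : (0 < d2)%R -> hausdorff_pre d2 B \is a fin_num.
  move=> d20; rewrite ge0_fin_numE ?hausdorff_pre_ge0 //.
  by rewrite (le_lt_trans _ fin) // (le_trans _ (key 1%R d2 _ _)) // leeDr // hausdorff_pre_ge0.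
have h1 d2 : (0 < d2)%R -> hausdorff1 A + hausdorff_pre d2 B <= hausdorff1 (A `|` B).
  move=> d20; rewrite -leeBrDr ?finB //; apply: ge_ereal_sup => _ [d1 d10 <-].
  by rewrite leeBrDr ?finB // key.
have finA : hausdorff1 A \is a fin_num.
  rewrite ge0_fin_numE ?hausdorff1_ge0 // (le_lt_trans _ fin) //.
  by rewrite (le_trans _ (h1 1%R _)) // leeDl // hausdorff_pre_ge0.
rewrite -leeBrDl //; apply: ge_ereal_sup => _ [d2 d20 <-].
by rewrite leeBrDl // h1.
Qed.

Lemma hausdorff1_separated_sum (L : (set 'rV[R]_2)^nat) X :
  (forall k, L k `<=` X) ->
  (forall m, separated (\big[setU/set0]_(k < m) L k) (L m)) ->
  forall m, \sum_(k < m) hausdorff1 (L k) <= hausdorff1 X.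
Proof.
move=> LX sL m; have : \sum_(k < m) hausdorff1 (L k) <=
    hausdorff1 (\big[setU/set0]_(k < m) L k).
  elim: m => [|m ih]; first by rewrite !big_ord0 hausdorff1_0.
  rewrite !big_ord_recr /=; apply: le_trans (hausdorff1_separated (sL m)).
  exact: leeD.
move=> h; apply: (le_trans h); apply: hausdorff1_le.
by move=> x; rewrite -bigcup_mkord => -[k _ /LX].
Qed.

Section positive_set.
Variable u : 'rV[R]_2 -> R.
Hypothesis u_lip : forall x y, (`|u x - u y| <= enorm (x - y))%R.

Lemma separated_lip A B (a b : R) : (b < a)%R ->
  (forall x, A x -> a <= u x)%R -> (forall x, B x -> u x <= b)%R -> separated A B.
Proof.
move=> ba ha hb; exists (a - b)%R; first by rewrite subr_gt0.
move=> x y /ha ax /hb yb; apply: le_trans (u_lip x y).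
by apply: le_trans (ler_norm _); rewrite lerB.
Qed.

(* The Caratheodory criterion, for the superlevel set of a Lipschitz function:
   the layers [1/(k+2) < u <= 1/(k+1)] of equal parity are separated, so the
   series of their measures converges. *)
Lemma measurable_lip_pos : caratheodory_measurable (hausdorff1_outer R) [set x | 0 < u x]%R.
Proof.
apply: le_caratheodory_measurable => X; set G := [set x | _].
pose h := hausdorff1_outer R; rewrite -/h.
have [->|] := eqVneq (h X) +oo; first by rewrite leey.
rewrite -ltey => fin.
pose s (k : nat) : R := (k.+1%:R^-1)%R.
have s_lt i j : (i < j)%N -> (s j < s i)%R.
  by move=> ij; rewrite /s ltf_pV2 ?posrE // ltr_nat.
have s_le i j : (i <= j)%N -> (s j <= s i)%R.
  by move=> ij; rewrite /s lef_pV2 ?posrE // ler_nat.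
have s0 k : (0 < s k)%R by rewrite /s invr_gt0.
pose L k := X `&` [set x | s k.+1 < u x <= s k]%R.
have LX k : L k `<=` X by move=> x [].
have half p m : \sum_(k < m) h (L (k.*2 + p)%N) <= h X.
  apply: (@hausdorff1_separated_sum (fun k => L (k.*2 + p)%N)) => [k|{}m]; first exact: LX.
  case: m => [|m].
    by rewrite big_ord0; exists 1%R.
  apply: (@separated_lip _ _ (s (m.*2 + p).+1%N) (s (m.+1.*2 + p)%N)).
  - by apply: s_lt; rewrite doubleS.
  - move=> x; rewrite -(bigcup_mkord _ (fun k => L (k.*2 + p)%N)) => -[k /= km [_ /= /andP[/ltW ux _]]].
    by apply: le_trans ux; apply: s_le; rewrite ltnS leq_add2r leq_double.
  - by move=> x [_ /andP[]].
have sum2 m : \sum_(k < m.*2) h (L k) <= h X + h X.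
  have -> : \sum_(k < m.*2) h (L k) =
      \sum_(k < m) h (L (k.*2 + 0)%N) + \sum_(k < m) h (L (k.*2 + 1)%N).
    rewrite -big_split /=; elim: m => [|m ih]; first by rewrite !big_ord0.
    by rewrite doubleS !big_ord_recr /= ih addeA addn0 addn1.
  by apply: leeD; exact: half.
have sumL : \sum_(0 <= k <oo) h (L k) <= h X + h X.
  apply: lime_le; first by apply: is_cvg_nneseries => *; exact: outer_measure_ge0.
  apply: nearW => m; rewrite big_mkord; apply: le_trans (sum2 m).
  rewrite -!(big_mkord xpredT (fun k => h (L k))).
  have mono := @lee_sum_nneg_natr _ (fun k => h (L k)) xpredT 0.
  by apply: mono => [*|]; [exact: outer_measure_ge0|rewrite -addnn leq_addr].
have tail : (\sum_(N <= k <oo) h (L k)) @[N --> \oo] --> 0.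
  apply: (@nneseries_tail_cvg _ (fun k => h (L k)) xpredT); last by move=> *; exact: outer_measure_ge0.
  by rewrite (le_lt_trans sumL) // lte_add_pinfty.
pose Y n := X `&` [set x | s n < u x]%R.
have sepY n : h (Y n) + h (X `&` ~` G) <= h X.
  have : h (Y n) + h (X `&` ~` G) <= h (Y n `|` (X `&` ~` G)).
    apply: hausdorff1_separated; apply: (@separated_lip _ _ (s n) 0%R) => //.
      by move=> x [_ /ltW].
    by move=> x [_ /negP]; rewrite -leNgt.
  move=> hh; apply: (le_trans hh); apply: le_outer_measure.
  by move=> x [[]|[]].
have coverY n : h (X `&` G) <= h (Y n) + \sum_(n <= k <oo) h (L k).
  have E : X `&` G `<=` Y n `|` \bigcup_k L (k + n)%N.
    move=> x [Xx Gx]; have [ux|ux] := ltP (s n) (u x); first by left.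
    right.
    have [k uk] : exists k, (s k < u x)%R.
      have [k _ hk] := @near_infty_natSinv_lt _ (PosNum Gx).
      by exists k; apply: hk => /=.
    have ex : exists k, (s k < u x)%R by exists k.
    (* The least [j] with [s j < u x] exceeds [n], hence [x] lies in the layer [L j.-1] of the
       tail. *)
    case: (ex_minnP ex) => j uj jmin.
    have nj : (n < j)%N.
      by rewrite ltnNge; apply/negP => jn; move: (lt_le_trans uj ux); rewrite ltNge s_le.
    exists (j.-1 - n)%N => //; rewrite subnK; last by case: (j) nj.
    split => //=; rewrite prednK ?(leq_trans _ nj) // uj /= leNgt.
    by apply/negP => /jmin; case: (j) nj => // j' _; rewrite ltnn.
  apply: (le_trans (le_outer_measure h _ _ E)).
  apply: (le_trans (outer_measureU2 _ _ _)); apply: leeD2l.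
  apply: (le_trans (outer_measure_sigma_subadditive h _)).
  by rewrite -(@nneseries_addn _ (fun k => h (L k))) // => *; exact: outer_measure_ge0.
have bnd n : h (X `&` G) + h (X `&` ~` G) <= h X + \sum_(n <= k <oo) h (L k).
  apply: (@le_trans _ _ (h (Y n) + \sum_(n <= k <oo) h (L k) + h (X `&` ~` G))).
    by apply: leeD2r; exact: coverY.
  by rewrite addeAC; apply: leeD2r; exact: sepY.
have lim : (h X + \sum_(N <= k <oo) h (L k)) @[N --> \oo] --> h X.
  rewrite -[X in _ --> X]adde0; apply: cvgeD => //; last exact: cvg_cst.
  by rewrite fin_num_adde_defl.
rewrite -(cvg_lim _ lim) //; apply: lime_ge; first by apply/cvg_ex; eexists; exact: lim.
exact: nearW.
Qed.

End positive_set.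


(** [O] is the positivity set of the Euclidean distance to its complement, a 1-Lipschitz function.
    The whole plane is treated apart, since the infimum would run over the empty set. *)
Lemma open_measurable_plane (O : set 'rV[R]_2) : open O ->
  measurable (O : set (plane R)).
Proof.
move=> oO; have [OE|/set0P[y0 Oy0]] := eqVneq (~` O) set0.
  have -> : O = setT by rewrite -(setCK O) OE setC0.
  exact: measurableT.
pose D x := [set enorm (x - y) | y in ~` O].
have D0 x : D x !=set0 by exists (enorm (x - y0)), y0.
have lbD x : has_lbound (D x) by exists 0%R => _ [y _ <-]; exact: enorm_ge0.
pose u x := inf (D x).
have u_le x y : (u x - u y <= enorm (x - y))%R.
  rewrite lerBlDl -lerBlDr; apply: lb_le_inf => // _ [w Ow <-].
  rewrite lerBlDl (@le_trans _ _ (enorm (x - w))) //.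
    by apply: ge_inf => //; exists w.
  by rewrite -(subrKA y) enormD.
have u_lip x y : (`|u x - u y| <= enorm (x - y))%R.
  by rewrite ler_norml u_le andbT lerNl opprB enormC u_le.
suff -> : O = [set x | (0 < u x)%R] by exact: measurable_lip_pos.
apply/seteqP; split => x /=.
  move=> Ox; have /nbhs_ballP[e /= e0 He] : nbhs x O by exact: open_nbhs_nbhs.
  apply: (lt_le_trans e0); apply: lb_le_inf => // _ [w Ow <-].
  rewrite leNgt; apply/negP => h; apply: Ow; apply: He.
  rewrite -ball_normE /= (le_lt_trans _ h) // norm_le_enorm //.
move=> ux; apply: contrapT => Ox; move: ux; apply/negP; rewrite -leNgt.
by apply: ge_inf => //; exists x => //; rewrite subrr enorm0.
Qed.

Lemma borel_measurable_plane (A : set 'rV[R]_2) : borel A ->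
  measurable (A : set (plane R)).
Proof.
apply: smallest_sub A; first exact: sigma_algebra_measurable.
exact: open_measurable_plane.
Qed.

Lemma closed_measurable_plane (A : set 'rV[R]_2) : closed A ->
  measurable (A : set (plane R)).
Proof.
by move=> cA; rewrite -(setCK A); apply: measurableC; apply: open_measurable_plane; exact: closed_openC.
Qed.

Lemma continuous_measurable_plane (f : 'rV[R]_2 -> R) (D : set (plane R)) :
  continuous f -> measurable_fun D (f : plane R -> R).
Proof.
move=> /continuousP cf; apply: (@measurable_funS _ _ _ _ setT) => //.
apply: (measurability _ (measurable_realfun.RGenOpens.measurableE R)).
move=> _ [_ [a [b ->] <-]]; rewrite setTI; apply: open_measurable_plane.
exact/cf/interval_open.
Qed.

End hausdorff_borel.

Section hausdorff_subadditive.
Variable R : realType.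
Local Open Scope ereal_scope.

Lemma hausdorff_preU (d : R) (A B : set 'rV[R]_2) : (0 < d)%R ->
  hausdorff_pre d (A `|` B) <= hausdorff_pre d A + hausdorff_pre d B.
Proof.
move=> d0; rewrite -bigcup2E.
apply: (le_trans (hausdorff_pre_sigma_subadditive d (bigcup2 A B))).
rewrite (@nneseries_split _ _ 0 2); last by move=> *; exact: hausdorff_pre_ge0.
rewrite [X in _ + X]eseries0 ?adde0.
  by rewrite big_mkord !big_ord_recl big_ord0 adde0.
by move=> [|[|k]] //= _ _; exact: hausdorff_pre0.
Qed.

End hausdorff_subadditive.

(** * Length of segments and integration along them *)

Section segments.
Variable R : realType.
Implicit Types (p v : 'rV[R]_2) (J : set R).

(** Parametrises the whole line, not a half-line: [s] may be negative. *)
Definition ray p v (s : R) : 'rV[R]_2 := p + s *: v.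

Definition seg p v J : set (plane R) := ray p v @` J.

(** The parameter of the orthogonal projection of [x] onto the line, a left inverse of [ray p v]. It
    turns subsets of the line into preimages of parameter sets. *)
Definition proj p v (x : 'rV[R]_2) : R := dot (x - p) v / dot v v.

Lemma dot_gt0 v : v != 0 -> 0 < dot v v.
Proof. by rewrite -enorm_sq -enorm_gt0 => ?; rewrite exprn_gt0. Qed.

Lemma rayK p v : v != 0 -> cancel (ray p v) (proj p v).
Proof.
move=> v0 s; rewrite /proj /ray addrC addKr dotZl mulfK //.
by rewrite gt_eqF // dot_gt0.
Qed.

Lemma segE p v J : v != 0 -> seg p v J = proj p v @^-1` J `&` seg p v setT.
Proof.
move=> v0; apply/seteqP; split => x.
  by move=> [s Js <-]; split; [rewrite /= rayK|exists s].
by move=> [Jx [s _ sx]]; exists s => //; rewrite -sx /= rayK // in Jx.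
Qed.

Lemma ray_enorm p v s s' : enorm (ray p v s - ray p v s') = `|s - s'| * enorm v.
Proof. by rewrite -enormZ scalerBl; congr enorm; rewrite /ray opprD addrACA subrr add0r. Qed.

Lemma proj_lip p v x y : v != 0 -> `|proj p v x - proj p v y| <= (enorm v)^-1 * enorm (x - y).
Proof.
move=> v0; rewrite /proj -mulrBl -[X in _ - X]mul1r -[X in X - _]mul1r -!mulrBr mul1r.
have -> : dot (x - p) v - dot (y - p) v = dot (x - y) v.
  by rewrite !dotE !mxE; ring.
rewrite normrM [X in _ * X]ger0_norm ?invr_ge0 ?dot_ge0 //.
rewrite ler_pdivrMr ?dot_gt0 // (le_trans (normr_dot _ _)) // -enorm_sq.
have := v0; rewrite -enorm_gt0 => ev.
by rewrite mulrC le_eqVlt; apply/orP; left; apply/eqP; field; rewrite gt_eqF.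
Qed.

Lemma proj_continuous p v : v != 0 -> continuous (proj p v).
Proof. by move=> v0; apply: lip_continuous => x y; exact: proj_lip. Qed.

Lemma ray_continuous p v : continuous (ray p v).
Proof.
have C0 : 0 < enorm v + 1 by rewrite ltr_wpDl // enorm_ge0.
move=> s; apply/(@cvgrPdist_le _ _ _ (nbhs s)) => e e0; near=> s'.
rewrite (le_trans (norm_le_enorm _)) // ray_enorm.
rewrite (@le_trans _ _ (`|s - s'| * (enorm v + 1))) //.
  by rewrite ler_wpM2l // lerDl.
rewrite -ler_pdivlMr //; near: s'.
apply/nbhs_ballP; exists (e / (enorm v + 1)); first exact: divr_gt0.
by move=> x; rewrite -ball_normE /= => /ltW.
Unshelve. all: by end_near.
Qed.

Lemma measurable_proj p v : v != 0 ->
  measurable_fun setT (proj p v : plane R -> R).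
Proof. by move=> v0; apply: continuous_measurable_plane; exact: proj_continuous. Qed.

Lemma measurable_line p v : v != 0 -> measurable (seg p v setT).
Proof.
move=> v0; apply: closed_measurable_plane.
have -> : seg p v setT = [set x | enorm (x - ray p v (proj p v x)) = 0].
  apply/seteqP; split => x /=.
    by move=> [s _ <-]; rewrite rayK // subrr enorm0.
  move=> /eqP; rewrite enorm_eq0 subr_eq0 => /eqP ->.
  by exists (proj p v x).
pose u x := enorm (x - ray p v (proj p v x)).
have cu : continuous u.
  apply: (@lip_continuous _ _ 2) => x y; rewrite (le_trans (enormB _ _)) //.
  set a := ray p v _; set b := ray p v _.
  have -> : x - a - (y - b) = (x - y) - (a - b).
    by clearbody a b; apply/matrixP => i j; rewrite !mxE; ring.
  rewrite (le_trans (enormD _ _)) // enormN ray_enorm.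
  have ev : 0 < enorm v by rewrite enorm_gt0.
  by have := proj_lip p x y v0; rewrite mulrC ler_pdivlMr //; lra.
rewrite (_ : [set _ | _] = u @^-1` [set 0]) //.
by apply: preimage_closed; [move=> ? _; exact: cu|exact: closed_eq].
Qed.

Lemma measurable_seg p v J : v != 0 -> measurable J -> measurable (seg p v J).
Proof.
move=> v0 mJ; rewrite segE //; apply: measurableI; last exact: measurable_line.
by rewrite -[X in measurable X]setTI; exact: measurable_proj.
Qed.


Section hausdorff_segment.
Variables (p v : 'rV[R]_2).
Hypothesis v0 : v != 0.
Local Open Scope ereal_scope.

Let ev : (0 < enorm v)%R. Proof. by rewrite enorm_gt0. Qed.

Lemma diam_seg_le a b : (a <= b)%R ->
  diam (seg p v `]a, b]) <= (enorm v * (b - a))%:E.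
Proof.
move=> ab; apply: ge_ereal_sup => _ [->|[[x y] /= [[s sab <-] [s' s'ab <-]] <-]].
  by rewrite lee_fin mulr_ge0 ?enorm_ge0 // subr_ge0.
rewrite lee_fin ray_enorm mulrC ler_pM2l // ler_norml.
by move: sab s'ab; rewrite /= !in_itv /= => /andP[? ?] /andP[? ?]; apply/andP; split; lra.
Qed.

Lemma hausdorff_pre_seg_le (d a b : R) : (0 < d)%R -> (a <= b)%R ->
  hausdorff_pre d (seg p v `]a, b]) <= (enorm v * (b - a))%:E.
Proof.
move=> d0.
have small a' b' : (a' <= b')%R -> (b' - a' <= d / enorm v)%R ->
    hausdorff_pre d (seg p v `]a', b']) <= (enorm v * (b' - a'))%:E.
  move=> ab; rewrite ler_pdivlMr // mulrC => h.
  pose U n := if n is 0%N then seg p v `]a', b'] else set0.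
  apply: (@le_trans _ _ (\sum_(i <oo) diam (U i))).
    apply: ereal_inf_lbound; exists U => //; split => [[|i]|x xs] /=.
    - by rewrite (le_trans (diam_seg_le ab)) // lee_fin.
    - by rewrite diam0 lee_fin ltW.
    - by exists 0%N.
  rewrite nneseries_recl //; last by move=> *; exact: diam_ge0.
  by rewrite eseries_cond eseries0 ?adde0 ?diam_seg_le // => -[|i] //= _ _; exact: diam0.
(* Induction on the number of parameter steps of size [d / enorm v], each giving a piece of diameter
   at most [d]. *)
have step n a' : (a' <= b)%R -> (b - a' <= n%:R * (d / enorm v))%R ->
    hausdorff_pre d (seg p v `]a', b]) <= (enorm v * (b - a'))%:E.
  elim: n a' => [|n ih] a' ab' h.
    apply: small => //; rewrite mul0r in h.
    by rewrite (le_trans h) // divr_ge0 ?ltW.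
  pose c := (a' + d / enorm v)%R.
  have dv : (0 < d / enorm v)%R by rewrite divr_gt0.
  have [cb|bc] := leP c b; last by apply: small => //; rewrite /c in bc; lra.
  have -> : seg p v `]a', b] = seg p v `]a', c] `|` seg p v `]c, b].
    rewrite /seg -image_setU; congr (_ @` _).
    by rewrite -itv_bndbnd_setU // bnd_simp // /c lerDl ltW.
  apply: (le_trans (hausdorff_preU _ _ d0)).
  have -> : (enorm v * (b - a'))%:E = (enorm v * (c - a'))%:E + (enorm v * (b - c))%:E.
    by rewrite -EFinD -mulrDr; congr (_ * _)%:E; ring.
  apply: leeD.
    by apply: small; rewrite /c; lra.
  by apply: ih => //; move: h; rewrite -natr1 mulrDl /c; lra.
move=> ab; have [n hn] : exists n, (b - a <= n%:R * (d / enorm v))%R.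
  exists (Num.bound ((b - a) / (d / enorm v))).
  rewrite -ler_pdivrMr ?divr_gt0 // ltW // archi_boundP //.
  by rewrite divr_ge0 ?subr_ge0 // divr_ge0 ?ltW.
exact: step hn.
Qed.

(** Pulled back to the parameter, a covering set sits in an interval of Lebesgue measure at most its
    diameter over [enorm v]; countable subadditivity of Lebesgue measure concludes. *)
Lemma hausdorff_pre_seg_ge (d a b : R) : (0 < d)%R -> (a <= b)%R ->
  (enorm v * (b - a))%:E <= hausdorff_pre d (seg p v `]a, b]).
Proof.
move=> d0 ab; apply: le_ereal_inf_tmp => _ [U [dU SU] <-].
pose P i : set R := [set s | s \in `]a, b] /\ U i (ray p v s)].
(* The pulled back set [P i] need not be measurable, so its closed interval hull is used instead. *)
pose I i : set R := if `[< P i !=set0 >] then `[inf (P i), sup (P i)]%classic else set0.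
have bP i : has_ubound (P i) /\ has_lbound (P i).
  by split; [exists b|exists a] => s [] /=; rewrite in_itv /= => /andP[? ?] _ //; exact: ltW.
have mI i : measurable (I i) by rewrite /I; case: ifP.
have cov : `]a, b]%classic `<=` \bigcup_i I i.
  move=> s sab; have [i _ Ui] := SU _ (ex_intro2 _ _ s sab erefl).
  have Ps : P i s by [].
  exists i => //; rewrite /I; have -> : `[< P i !=set0 >] by apply/asboolP; exists s.
  rewrite /= in_itv /=; have [uP lP] := bP i.
  by rewrite ge_inf // ub_le_sup.
have lI i : (enorm v)%:E * lebesgue_measure (I i) <= diam (U i).
  rewrite /I; case: ifPn => [/asboolP [s0 Ps0]|_]; last by rewrite measure0 mule0 diam_ge0.
  have [uP lP] := bP i.
  have infsup : (inf (P i) <= sup (P i))%R.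
    by rewrite (@le_trans _ _ s0) // ?ge_inf // ub_le_sup.
  have fd : diam (U i) \is a fin_num.
    by rewrite ge0_fin_numE ?diam_ge0 // (le_lt_trans (dU i)) // ltry.
  rewrite lebesgue_measure_itv /= lte_fin.
  case: ltP => _; last by rewrite mule0 diam_ge0.
  rewrite -EFinB -EFinM -(fineK fd) lee_fin mulrC -ler_pdivlMr // lerBlDr.
  apply: ge_sup; first by exists s0.
  move=> s Ps; rewrite -lerBlDl; apply: lb_le_inf; first by exists s0.
  move=> s' Ps'; rewrite lerBlDr -lerBlDl ler_pdivlMr // -lee_fin fineK //.
  apply: le_trans (enorm_le_diam Ps.2 Ps'.2).
  by rewrite lee_fin ray_enorm ler_pM2r // ler_norm.
have key : lebesgue_measure `]a, b]%classic <= \sum_(i <oo) lebesgue_measure (I i).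
  apply: measure_sigma_subadditive => //.
rewrite lebesgue_measure_itv /= lte_fin in key.
apply: (@le_trans _ _ ((enorm v)%:E * \sum_(i <oo) lebesgue_measure (I i))).
  rewrite EFinM lee_pmul2l // ?lte_fin //.
  move: key; case: ltP => [h|h]; first by rewrite EFinB.
  by move=> _; rewrite (@le_trans _ _ 0) // ?lee_fin ?subr_le0 // nneseries_ge0.
rewrite -nneseriesZl //.
by apply: lee_nneseries => // i _; rewrite mule_ge0 // lee_fin ltW.
Qed.

Lemma hausdorff1_seg_oc a b : (a <= b)%R ->
  hausdorff1 (seg p v `]a, b]) = (enorm v * (b - a))%:E.
Proof.
move=> ab; apply/eqP; rewrite eq_le; apply/andP; split.
  by apply: ge_ereal_sup => _ [d d0 <-]; exact: hausdorff_pre_seg_le.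
apply: le_trans (hausdorff_pre_le1 _ ltr01).
exact: hausdorff_pre_seg_ge.
Qed.


Let L := seg p v setT.
Let mL : measurable L. Proof. exact: measurable_line. Qed.
Let mpi : measurable_fun setT (proj p v : plane R -> measurableTypeR R) := measurable_proj p v0.
Let m : {measure set (measurableTypeR R) -> \bar R} :=
  @measure_function_pushforward__canonical__measure_function_Measure _ _ _ _ _
    (mrestr (H1 R) mL) _ mpi.

Let evnn : (0 <= enorm v)%R. Proof. exact: ltW. Qed.
Let k : {nonneg R} := NngNum evnn.

(** Divided by [enorm v], the image of [H1] on the line under [proj] agrees with Lebesgue measure on
    half-open intervals, which determine it. *)
Let pushforward_lebesgue (A : set R) : measurable A ->
  m A = (enorm v)%:E * lebesgue_measure A.
Proof.
move=> mA.
have evi : (0 <= (enorm v)^-1)%R by rewrite invr_ge0.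
pose m' : {measure set (measurableTypeR R) -> \bar R} := mscale (NngNum evi) m.
rewrite (@lebesgue_measure_unique R m') //.
  by rewrite /m' /= /mscale /= muleA -EFinM divff ?mul1e // gt_eqF.
move=> _ [[a b] _ <-]; rewrite /m' /= /mscale /= /m /pushforward /mrestr.
rewrite [X in _ * X](_ : _ = hausdorff1 (seg p v `]a, b])); last first.
  by rewrite (segE p `]a, b] v0).
rewrite lebesgue_measure_itv /= lte_fin; case: ltP => [ab|ba].
  rewrite hausdorff1_seg_oc ?(ltW ab) // -EFinB -EFinM mulrA mulVf ?mul1r //.
  by rewrite gt_eqF.
by rewrite set_itv_ge ?bnd_simp -?leNgt // /seg image_set0 hausdorff1_0 mule0.
Qed.

Lemma H1_seg (J : set R) : measurable J ->
  H1 R (seg p v J) = (enorm v)%:E * lebesgue_measure J.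
Proof.
by move=> mJ; rewrite -pushforward_lebesgue // /m /pushforward /mrestr (segE p J v0).
Qed.

Let integral_seg_mrestr (J : set R) (f : plane R -> \bar R) : measurable J ->
  (forall x, 0 <= f x) -> measurable_fun setT f ->
  \int[H1 R]_(x in seg p v J) f x =
  \int[mrestr (H1 R) mL]_(x in proj p v @^-1` J) f x.
Proof.
move=> mJ f0 mf.
have mpJ : measurable (proj p v @^-1` J : set (plane R)).
  by rewrite -[X in measurable X]setTI; exact: mpi.
have mN : measurable (~` L) by exact: measurableC.
have N0 : mrestr (H1 R) mL (~` L) = 0 by rewrite /mrestr setICl measure0.
have mfJ : measurable_fun (proj p v @^-1` J : set (plane R)) f by exact: measurable_funTS.
have := @ge0_negligible_integral _ _ _ (mrestr (H1 R) mL) _ _ f mN mpJ mfJ (fun x _ => f0 x) N0.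
rewrite setDE setCK -(segE p J v0) => ->.
apply: eq_measure_integral => A mA AJ; rewrite /= /mrestr setIidl //.
by apply: (subset_trans AJ) => x [s _ <-]; exists s.
Qed.

(** [f] is only measurable along the line. It is replaced by its composition with [ray p v] and
    [proj p v], which agrees with it on the segment and is measurable on the plane, so the change of
    variables for pushforwards applies. *)
Lemma ge0_integral_seg (J : set R) (f : plane R -> \bar R) : measurable J ->
  (forall x, 0 <= f x) -> measurable_fun setT (fun s : R => f (ray p v s)) ->
  \int[H1 R]_(x in seg p v J) f x =
  (enorm v)%:E * \int[lebesgue_measure]_(s in J) f (ray p v s).
Proof.
move=> mJ f0 mf; pose g s := f (ray p v s).
have E : {in seg p v J, forall x, f x = (g \o proj p v) x}.
  by move=> x /[1!inE] -[s Js <-]; rewrite /g /= rayK.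
have mg : measurable_fun setT (g \o proj p v : plane R -> \bar R).
  exact: measurableT_comp mf mpi.
rewrite (eq_integral _ _ E) (integral_seg_mrestr mJ _ mg); last first.
  by move=> x; exact: f0.
have mgJ : measurable_fun J g by exact: measurable_funTS.
have <- := @ge0_integral_pushforward _ _ _ _ _ _ mpi (mrestr (H1 R) mL) J g mJ mgJ (fun y _ => f0 _).
have <- := @ge0_integral_mscale _ _ _ lebesgue_measure J mJ k g mgJ (fun y _ => f0 _).
apply: (@eq_measure_integral _ (measurableTypeR R) R J (mscale k lebesgue_measure) m g) => A mA _.
exact: pushforward_lebesgue.
Qed.

End hausdorff_segment.

Section segment_integrals.
Variables (p v : 'rV[R]_2).
Hypothesis v0 : v != 0.
Local Open Scope ereal_scope.

Lemma measurable_fun_seg (J : set R) (f : plane R -> R) : measurable J ->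
  measurable_fun setT (fun s : R => f (ray p v s)) ->
  measurable_fun (seg p v J) f.
Proof.
move=> mJ mf; have mS := measurable_seg p v0 mJ.
have mpi := measurable_proj p v0.
have mg : measurable_fun (seg p v J) ((fun s => f (ray p v s)) \o proj p v).
  by apply: measurable_funTS; exact: measurableT_comp mf mpi.
by apply: (eq_measurable_fun _ _ mg) => x /[1!inE] -[s Js <-]; rewrite /= rayK.
Qed.

Lemma integrable_seg (J : set R) (f : plane R -> R) : measurable J ->
  measurable_fun setT (fun s : R => f (ray p v s)) ->
  (@lebesgue_measure R).-integrable J (fun s => (f (ray p v s))%:E) ->
  (H1 R).-integrable (seg p v J) (EFin \o f).
Proof.
move=> mJ mf /integrableP[_ fJ]; apply/integrableP; split.
  by apply/measurable_EFinP; exact: measurable_fun_seg.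
rewrite (ge0_integral_seg v0) //.
- by rewrite lte_mul_pinfty // lee_fin enorm_ge0.
- by apply: measurableT_comp => //; exact/measurable_EFinP.
Qed.

Lemma Rintegral_seg (J : set R) (f : plane R -> R) : measurable J ->
  measurable_fun setT (fun s : R => f (ray p v s)) ->
  (@lebesgue_measure R).-integrable J (fun s => (f (ray p v s))%:E) ->
  (\int[H1 R]_(x in seg p v J) f x =
  enorm v * \int[lebesgue_measure]_(s in J) f (ray p v s))%R.
Proof.
move=> mJ mf fJ; rewrite /Rintegral.
have mf' : measurable_fun setT (fun s : R => (f (ray p v s))%:E) by exact/measurable_EFinP.
rewrite integralE [in RHS]integralE.
have mfp : measurable_fun setT ((EFin \o f)^\+ \o ray p v).
  by rewrite -funepos_comp; exact: measurable_funepos.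
have mfn : measurable_fun setT ((EFin \o f)^\- \o ray p v).
  by rewrite -funeneg_comp; exact: measurable_funeneg.
have -> := @ge0_integral_seg p v v0 J (EFin \o f)^\+ mJ _ mfp; last by [].
have -> := @ge0_integral_seg p v v0 J (EFin \o f)^\- mJ _ mfn; last by [].
pose g : R -> \bar R := fun s => (f (ray p v s))%:E.
have -> : \int[lebesgue_measure]_(s in J) (EFin \o f)^\+ (ray p v s) =
    \int[lebesgue_measure]_(s in J) g^\+ s.
  by apply: eq_integral => s _; rewrite -[LHS]/(((EFin \o f)^\+ \o ray p v) s) -funepos_comp.
have -> : \int[lebesgue_measure]_(s in J) (EFin \o f)^\- (ray p v s) =
    \int[lebesgue_measure]_(s in J) g^\- s.
  by apply: eq_integral => s _; rewrite -[LHS]/(((EFin \o f)^\- \o ray p v) s) -funeneg_comp.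
have fp : \int[lebesgue_measure]_(s in J) g^\+ s \is a fin_num.
  exact: integrable_pos_fin_num fJ.
have fn : \int[lebesgue_measure]_(s in J) g^\- s \is a fin_num.
  exact: integrable_neg_fin_num fJ.
rewrite -/g; move: fp fn; set P := \int[_]_(_ in _) _; set N := \int[_]_(_ in _) _.
by move=> /fineK <- /fineK <-; rewrite -!EFinM -!EFinB /= mulrBr.
Qed.

End segment_integrals.

End segments.

(** * Smooth functions and cutoffs *)

Section chain_rule.
Variable R : realType.
Implicit Types (phi : 'rV[R]_2 -> R) (p v x : 'rV[R]_2).

Lemma ray_sub x v s : ray x v s - x = s *: v.
Proof. by rewrite /ray addrC addKr. Qed.

Lemma is_derive_ray phi x v s : derivable phi (ray x v s) v ->
  is_derive s 1 (phi \o ray x v : R -> R) ('D_v phi (ray x v s)).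
Proof.
move=> d; have E : (fun h : R => h^-1 *: (((phi \o ray x v) \o shift s) (h *: (1 : R)) - (phi \o ray x v) s)) =
    (fun h : R => h^-1 *: ((phi \o shift (ray x v s)) (h *: v) - phi (ray x v s))).
  apply/funext => h; congr (_ *: (phi _ - _)).
  by rewrite /= /ray [h *: 1]mulr1 scalerDl addrCA addrC.
by apply: DeriveDef; [rewrite /derivable E|rewrite /derive E].
Qed.

(** The intermediate point is located only by [|c'| <= |c|], which covers both signs of [c] at
    once. *)
Lemma coordinate_mvt phi x (j : 'I_2) (c : R) : (forall y, derivable phi y (evec R j)) ->
  exists2 c', `|c'| <= `|c| &
    phi (ray x (evec R j) c) - phi x = c * 'D_(evec R j) phi (ray x (evec R j) c').
Proof.
move=> d; pose g := phi \o ray x (evec R j).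
have dg s : is_derive s (1 : R) (g : R -> R) ('D_(evec R j) phi (ray x (evec R j) s)).
  exact: is_derive_ray.
have g0 : phi x = g 0 by rewrite /g /= /ray scale0r addr0.
have cg a b : {within `[a, b], continuous (g : R -> R)}.
  by apply: derivable_within_continuous => y _; apply: ex_derive.
rewrite g0 -/(g c); have [c0|c0] := leP 0 c.
  have [c' /[!in_itv] /= /andP[c1 c2] ->] := MVT_segment c0 (fun y _ => dg y) (cg _ _).
  by exists c'; rewrite ?subr0 1?mulrC // ger0_norm // ger0_norm.
have [c' /[!in_itv] /= /andP[c1 c2] E] := MVT_segment (ltW c0) (fun y _ => dg y) (cg _ _).
exists c'; first by rewrite ler0_norm // ltr0_norm // lerN2.
by apply: oppr_inj; rewrite opprB E sub0r mulrN mulrC.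
Qed.

Lemma lincomb_close (a b x0 x1 y0 y1 q : R) : 0 <= q ->
  `|y0 - x0| <= q -> `|y1 - x1| <= q ->
  `|x0 * a + x1 * b - (a * y0 + b * y1)| <= (`|a| + `|b| + 1) * q.
Proof.
move=> q0 h0 h1.
have -> : x0 * a + x1 * b - (a * y0 + b * y1) = - (a * (y0 - x0)) - b * (y1 - x1).
  by ring.
rewrite (le_trans (ler_normB _ _)) // normrN !normrM !mulrDl mul1r.
rewrite -[leLHS]addr0 lerD // lerD //; exact: ler_wpM2l.
Qed.

Lemma enorm_evec (j : 'I_2) : enorm (evec R j) = 1.
Proof.
rewrite /enorm dotE !mxE; have [->|->] := I2P j;
by rewrite /= ?mulr0 ?mulr1 ?addr0 ?add0r sqrtr1.
Qed.

Definition grad phi x : 'rV[R]_2 := \row_j 'D_(evec R j) phi x.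

(** [smooth] provides coordinate derivatives only. The increment along [v] is therefore split into
    two axis-parallel ones, each handled by the mean value theorem, and continuity of the partial
    derivatives gives the limit. *)
Lemma C1_is_derive_ray phi p v (s : R) :
  (forall j y, derivable phi y (evec R j)) ->
  (forall j, continuous (fun y => 'D_(evec R j) phi y)) ->
  is_derive s 1 (phi \o ray p v : R -> R) (dot (grad phi (ray p v s)) v).
Proof.
move=> d cd; set g := phi \o ray p v; set x := ray p v s.
have H : h^-1 *: ((g \o shift s) (h *: (1 : R)) - g s) @[h --> 0^'] --> dot (grad phi x) v.
  apply/cvgrPdist_le => e e0.
  pose M := `|v 0 0| + `|v 0 1| + 1.
  have M0 : 0 < M by rewrite ltr_wpDl // addr_ge0.
  have near_x j : exists2 r, 0 < r & forall y, enorm (y - x) < r ->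
      `|'D_(evec R j) phi y - 'D_(evec R j) phi x| <= e / M.
    have eM : 0 < e / M by rewrite divr_gt0.
    have /cvgrPdist_le /(_ _ eM) /nbhs_ballP [r /= r0 Hr] := cd j x.
    exists r => // y yr; rewrite distrC; apply: Hr.
    by rewrite -ball_normE /= distrC (le_lt_trans (norm_le_enorm _)).
  have [r0 r00 H0] := near_x 0; have [r1 r10 H1] := near_x 1.
  pose r := Num.min r0 r1.
  have r_gt0 : 0 < r by rewrite lt_min r00 r10.
  near=> h.
  have h0 : h != 0 by near: h; exact: nbhs_dnbhs_neq.
  have hr : `|h| < r / M.
    near: h; apply: nbhs_dnbhs; apply/nbhs_ballP; exists (r / M) => /=.
      by rewrite divr_gt0.
    by move=> y; rewrite -ball_normE /= sub0r normrN.
  (* The path has its corner at [ray x (evec R 1) (h * v 0 1)]: coordinate 1 is moved before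
     coordinate 0. *)
  have xE : (g \o shift s) (h *: (1 : R)) =
      phi (ray (ray x (evec R 1) (h * v 0 1)) (evec R 0) (h * v 0 0)).
    congr (phi _); apply: rV2P; rewrite /x /ray !mxE /= ?mulr1 ?mulr0 ?addr0;
    by rewrite [h *: 1]mulr1; ring.
  have [c0 c0h E0] := coordinate_mvt (ray x (evec R 1) (h * v 0 1)) (h * v 0 0) (d 0).
  have [c1 c1h E1] := coordinate_mvt x (h * v 0 1) (d 1).
  have -> : h^-1 *: ((g \o shift s) (h *: (1 : R)) - g s) =
      v 0 0 * 'D_(evec R 0) phi (ray (ray x (evec R 1) (h * v 0 1)) (evec R 0) c0)
      + v 0 1 * 'D_(evec R 1) phi (ray x (evec R 1) c1).
    have := congr2 +%R E0 E1; rewrite addrA subrK xE -/(g s) => ->.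
    by rewrite -!mulrA -mulrDr [LHS]mulrA mulVf ?mul1r.
  rewrite dotE /grad !mxE.
  set y0 := ray (ray _ _ _) _ c0; set y1 := ray x _ c1.
  have b0 : enorm (y0 - x) < r.
    have -> : y0 - x = (h * v 0 1) *: evec R 1 + c0 *: evec R 0.
      by rewrite -(subrKA (ray x (evec R 1) (h * v 0 1))) !ray_sub addrC.
    rewrite (le_lt_trans (enormD _ _)) // !enormZ.
    rewrite !enorm_evec !mulr1; rewrite normrM in c0h; rewrite normrM.
    move: hr; rewrite ltr_pdivlMr // /M => hr; rewrite (le_lt_trans _ hr) //.
    by rewrite !mulrDr mulr1 [leLHS]addrC -[leLHS]addr0 lerD // lerD2r.
  have b1 : enorm (y1 - x) < r.
    rewrite ray_sub enormZ.
    rewrite enorm_evec mulr1; rewrite normrM in c1h.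
    move: hr; rewrite ltr_pdivlMr // /M => hr; rewrite (le_lt_trans _ hr) //.
    by rewrite !mulrDr mulr1 (le_trans c1h) // -[leLHS]addr0 lerD // lerDr mulr_ge0.
  have {}H0 := H0 _ (lt_le_trans b0 (_ : r <= r0)).
  have {}H1 := H1 _ (lt_le_trans b1 (_ : r <= r1)).
  have {}H0 := H0 (_ : r <= r0); rewrite ge_min lexx in H0; have {}H0 := H0 isT.
  have {}H1 := H1 (_ : r <= r1); rewrite ge_min lexx orbT in H1; have {}H1 := H1 isT.
  have -> : e = M * (e / M) by rewrite mulrC divfK // gt_eqF.
  by apply: lincomb_close => //; rewrite divr_ge0 // ltW.
by apply: DeriveDef; [apply/cvg_ex; eexists; exact: H|exact: cvg_lim H].
Unshelve. all: by end_near. Qed.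

End chain_rule.

Section flat_function.
Variable R : realType.

(** The usual flat function exp(-1/y), with a power of 1/y in front so that the family is closed
    under derivation up to linear combinations. *)
Definition flat (n : nat) (y : R) : R := if 0 < y then y ^- n * expR (- y^-1) else 0.

(** The inequality s <= exp(s) at s = 1 / ((m + 1) y), raised to the power m + 1 and inverted. *)
Lemma expRN_inv_le (m : nat) (y : R) : 0 < y -> expR (- y^-1) <= (m.+1%:R * y) ^+ m.+1.
Proof.
move=> y0; have m0 : 0 < m.+1%:R :> R by [].
have my : 0 < m.+1%:R * y by rewrite mulr_gt0.
have -> : - y^-1 = - (m.+1%:R * (m.+1%:R * y)^-1).
  by congr (- _); field; rewrite !gt_eqF.
have e0 : 0 < (m.+1%:R * y)^-1 by rewrite invr_gt0.
rewrite expRN expRM_natl -[leRHS]invrK lef_pV2 ?posrE ?exprn_gt0 ?expR_gt0 ?invr_gt0 ?exprn_gt0 //.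
rewrite -exprVn lerXn2r ?nnegrE ?expR_ge0 ?(ltW e0) //.
by rewrite (le_trans _ (expR_ge1Dx _)) // lerDr.
Qed.

Lemma flat_is_derive n (y : R) :
  is_derive y 1 (flat n) (flat n.+2 y - n%:R * flat n.+1 y).
Proof.
have [y0|y0|->] := ltgtP y 0.
- have E : \near y, cst 0 y = flat n y.
    near=> z; rewrite /flat ltNge; have -> // : z <= 0.
    by rewrite ltW //; near: z; exact: lt_nbhsl.
  have -> : flat n.+2 y - n%:R * flat n.+1 y = 0.
    by rewrite /flat ltNge (ltW y0) /= mulr0 subr0.
  by apply: (near_eq_is_derive E).
- have E : \near y, y ^- n * expR (- y^-1) = flat n y.
    near=> z; rewrite /flat; have -> // : 0 < z.
    by near: z; exact: lt_nbhsr.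
  have yn0 : y != 0 by rewrite gt_eqF.
  have d1 : is_derive y 1 (fun z : R => z ^- n * expR (- z^-1)) 
     (flat n.+2 y - n%:R * flat n.+1 y).
    rewrite /flat y0.
    have di : is_derive y 1 (fun z : R => - z^-1) (y ^- 2).
      have := @is_deriveN R _ _ _ _ _ _ (is_deriveV yn0 (is_derive_id y 1)).
      by move=> h; apply: (is_derive_eq h); rewrite scaleNr opprK [_ *: 1]mulr1.
    have de := @is_derive1_comp R expR (fun z => - z^-1) y _ _ (is_derive_expR (- y^-1)) di.
    have dp : is_derive y 1 (fun z : R => z ^- n) (- n%:R * y ^- n.+1).
      case: (n) => [|k].
        have -> : (fun z : R => z ^- 0) = cst 1 by apply/funext => z; rewrite expr0 invr1.
        by apply: (is_derive_eq (is_derive_cst _ _ _)); rewrite oppr0 mul0r.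
      have yk : y ^+ k.+1 != 0 by rewrite expf_neq0.
      have hx : is_derive y 1 (fun z : R => z ^+ k.+1) (k.+1%:R * y ^+ k).
        have := is_deriveX k.+1 (is_derive_id y (1 : R)).
        rewrite exprfctE => hx; apply: (is_derive_eq hx).
        by rewrite [_ *: 1]mulr1.
      have h := @is_deriveV R (fun z => z ^+ k.+1) y _ 1 yk hx.
      apply: (is_derive_eq h).
      rewrite -[_ *: _]/(- (y ^+ k.+1) ^- 2 * (k.+1%:R * y ^+ k)) !(exprS y).
      have yk0 : y ^+ k != 0 by rewrite expf_neq0.
      by field; rewrite yk0 yn0.
    have := is_deriveM dp de.
    move=> h; apply: (is_derive_eq h).
    rewrite /= -![_ *: _]/(_ * _) !exprS.
    by field; rewrite yn0 expf_neq0.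
  by apply: (near_eq_is_derive E).
- have -> : flat n.+2 0 - n%:R * flat n.+1 0 = 0.
    by rewrite /flat ltxx mulr0 subr0.
  have H : h^-1 *: ((flat n \o shift 0) (h *: (1 : R)) - flat n 0) @[h --> 0^'] --> (0 : R).
    apply/cvgrPdist_le => e e0.
    (* At 0 the difference quotient is h^(-n-1) exp(-1/h) for h > 0. Bounding the exponential by C
       h^(n+2) leaves C h, which tends to 0. *)
    pose C : R := (n.+2%:R) ^+ n.+2.
    have C0 : 0 < C by rewrite exprn_gt0.
    near=> h.
    have h0 : h != 0 by near: h; exact: nbhs_dnbhs_neq.
    have hC : `|h| <= e / C.
      near: h; apply: nbhs_dnbhs; apply/nbhs_ballP; exists (e / C) => /=.
        by rewrite divr_gt0.
      by move=> z; rewrite -ball_normE /= sub0r normrN => /ltW.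
    rewrite sub0r normrN /= addr0 [h *: 1]mulr1 {2}/flat ltxx subr0 normrM /flat.
    case: ltP => hp; last by rewrite normr0 mulr0 ltW.
    rewrite gtr0_norm ?invr_gt0 // ger0_norm; last first.
      by rewrite mulr_ge0 ?expR_ge0 // invr_ge0 exprn_ge0 // ltW.
    have := expRN_inv_le n.+1 hp; rewrite exprMn -/C => hE.
    rewrite gtr0_norm // in hC.
    apply: (@le_trans _ _ (C * h)); last by rewrite mulrC -ler_pdivlMr.
    have hn : 0 < h ^- n.+1 by rewrite invr_gt0 exprn_gt0.
    rewrite mulrA -invfM -exprS mulrC ler_pdivrMr ?exprn_gt0 //.
    by rewrite -mulrA -exprS.
  by apply: DeriveDef; [apply/cvg_ex; eexists; exact: H|exact: cvg_lim H].
Unshelve. all: by end_near. Qed.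

End flat_function.

Section smooth_functions.
Variable R : realType.
Implicit Types (f g : 'rV[R]_2 -> R) (x v : 'rV[R]_2).

(* A class of functions which contains the cutoffs below and is stable under
   directional derivatives by construction. *)
Inductive elementary : ('rV[R]_2 -> R) -> Prop :=
| elementary_cst c : elementary (cst c)
| elementary_coord i : elementary (fun x => x 0 i)
| elementaryD f g : elementary f -> elementary g -> elementary (f + g)
| elementaryM f g : elementary f -> elementary g -> elementary (f * g)
| elementaryV f : (forall x, f x != 0) -> elementary f ->
    elementary (fun x => (f x)^-1)
| elementary_flat n f : elementary f -> elementary (flat n \o f).

Lemma derive_comp_real (h : R -> R) f x v (a : R) : differentiable f x ->
  is_derive (f x) 1 h a -> differentiable (h \o f) x /\ 'D_v (h \o f) x = a * 'D_v f x.
Proof.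
move=> df [dh ah].
have dh' : differentiable h (f x) by apply/derivable1_diffP.
split; first exact: differentiable_comp.
rewrite !deriveE //; last exact: differentiable_comp.
rewrite diff_comp //= -ah deriveE //.
have -> : 'd f x v = ('d f x v) *: (1 : R) by rewrite [_ *: 1]mulr1.
by rewrite linearZ /= [_ *: 1]mulr1 mulrC.
Qed.

Lemma elementary_differentiable f : elementary f ->
  (forall x, differentiable f x) /\ forall v, elementary (fun x => 'D_v f x).
Proof.
elim=> {f} [c|i|f g _ [df ef] _ [dg eg]|f g hf [df ef] hg [dg eg]|f f0 hf [df ef]|n f hf [df ef]].
- split=> [x|v]; first exact: differentiable_cst.
  rewrite (_ : (fun _ => _) = cst 0); first exact: elementary_cst.
  by apply/funext => x; rewrite derive_cst.
- split=> [x|v]; first exact: differentiable_coord.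
  rewrite (_ : (fun _ => _) = cst (v 0 i)); first exact: elementary_cst.
  apply/funext => x; rewrite /derive.
  apply: cvg_lim => //; apply: cvg_near_cst.
  near=> h.
  have h0 : h != 0 by near: h; exact: nbhs_dnbhs_neq.
  by rewrite /= !mxE addrK -[_ *: _]/(_ * _) mulrA mulVf // mul1r.
- split=> [x|v]; first exact: differentiableD.
  rewrite (_ : (fun _ => _) = (fun x => 'D_v f x) + (fun x => 'D_v g x)).
    exact: elementaryD.
  by apply/funext => x; rewrite deriveD //; exact: diff_derivable.
- split=> [x|v]; first exact: differentiableM.
  rewrite (_ : (fun _ => _) = f * (fun x => 'D_v g x) + g * (fun x => 'D_v f x)).
    by apply: elementaryD; apply: elementaryM.
  by apply/funext => x; rewrite deriveM //; exact: diff_derivable.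
- split=> [x|v]; first exact: differentiableV.
  rewrite (_ : (fun _ => _) = cst (-1) * ((fun x => (f x)^-1) * (fun x => (f x)^-1)) * (fun x => 'D_v f x)).
    apply: elementaryM => //; apply: elementaryM; first exact: elementary_cst.
    by apply: elementaryM; exact: elementaryV.
  apply/funext => x; rewrite deriveV //; last exact: diff_derivable.
  by rewrite -[_ *: _]/(_ * _) !fctE mulN1r expr2 invfM.
- split=> [x|v]; first by have [] := derive_comp_real 0 (df x) (flat_is_derive n (f x)).
  rewrite (_ : (fun _ => _) = ((flat n.+2 \o f) + cst (- n%:R) * (flat n.+1 \o f)) * (fun x => 'D_v f x)).
    apply: elementaryM => //; apply: elementaryD; first exact: elementary_flat.
    apply: elementaryM; first exact: elementary_cst.
    exact: elementary_flat.
  apply/funext => x; have [_ ->] := derive_comp_real v (df x) (flat_is_derive n (f x)).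
  by rewrite !fctE mulNr.
Unshelve. all: by end_near. Qed.

Lemma elementary_smooth f : elementary f -> smooth f.
Proof.
move=> ef s; suff /elementary_differentiable[d _] : elementary (iter_partial s f).
  by split=> [x|j x]; [exact: differentiable_continuous|exact: diff_derivable].
elim: s => //= j s /elementary_differentiable[_ e]; exact: e.
Qed.

Definition sq_enorm x : R := dot x x.

Lemma elementary_sq_enorm : elementary sq_enorm.
Proof.
rewrite (_ : sq_enorm = (fun x => x 0 0) * (fun x => x 0 0) + (fun x => x 0 1) * (fun x => x 0 1)).
  by apply: elementaryD; apply: elementaryM; exact: elementary_coord.
by apply/funext => x; rewrite /sq_enorm dotE !fctE.
Qed.

Lemma flat0_gt0 (y : R) : (0 < flat 0 y) = (0 < y).
Proof.
rewrite /flat; case: (ltP 0 y) => _; last by rewrite ltxx.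
by rewrite expr0 invr1 mul1r expR_gt0.
Qed.

Lemma flat0_ge0 (y : R) : 0 <= flat 0 y.
Proof.
rewrite /flat; case: ifP => // _.
by rewrite expr0 invr1 mul1r expR_ge0.
Qed.

(* Equal to 1 for |x|^2 <= a and to 0 for |x|^2 >= b. *)
Definition cutoff (a b : R) x : R :=
  flat 0 (b - sq_enorm x) / (flat 0 (b - sq_enorm x) + flat 0 (sq_enorm x - a)).

Lemma elementary_cutoff a b : a < b -> elementary (cutoff a b).
Proof.
move=> ab; pose p := flat 0 \o (cst b + cst (-1) * sq_enorm).
pose q := flat 0 \o (sq_enorm + cst (- a)).
have ep : elementary p.
  apply: elementary_flat; apply: elementaryD; first exact: elementary_cst.
  by apply: elementaryM; [exact: elementary_cst|exact: elementary_sq_enorm].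
have eq : elementary q.
  apply: elementary_flat; apply: elementaryD; first exact: elementary_sq_enorm.
  exact: elementary_cst.
have pE x : p x = flat 0 (b - sq_enorm x) by rewrite /p /= !fctE mulN1r.
rewrite (_ : cutoff a b = p * (fun x => ((p + q) x)^-1)).
  apply: elementaryM => //; apply: elementaryV; last exact: elementaryD.
  move=> x; rewrite gt_eqF // fctE pE.
  (* The denominator never vanishes: as [a < b], every point has [sq_enorm x < b] or
     [a < sq_enorm x]. *)
  have [h|h] := ltP (sq_enorm x) b.
    by rewrite ltr_pwDl ?flat0_gt0 ?subr_gt0 // flat0_ge0.
  by rewrite ltr_wpDl ?flat0_ge0 // flat0_gt0 fctE subr_gt0 (lt_le_trans ab).
by apply/funext => x; rewrite !fctE pE /q /= !fctE.
Qed.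

Lemma cutoff1 a b x : a < b -> sq_enorm x <= a -> cutoff a b x = 1.
Proof.
move=> ab xa; rewrite /cutoff.
have -> : flat 0 (sq_enorm x - a) = 0 by rewrite /flat ltNge subr_le0 xa.
rewrite addr0 divff //.
by rewrite gt_eqF // flat0_gt0 subr_gt0 (le_lt_trans xa).
Qed.

Lemma cutoff0 a b x : b <= sq_enorm x -> cutoff a b x = 0.
Proof. by move=> bx; rewrite /cutoff {1}/flat ltNge subr_le0 bx mul0r. Qed.

(** Such a function has constant gradient [evec R j] inside the ball of radius [rho], so testing
    with it there reads off one column of the measure. The cutoff ends at the midpoint of [rho] and
    [2^-1]. *)
Lemma test_fun_cutoff_coord (rho : R) (j : 'I_2) : 0 <= rho < 2^-1 -> exists2 phi : 'rV[R]_2 -> R,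
  test_fun (@half_ball R) phi & forall x, enorm x <= rho -> phi x = x 0 j.
Proof.
move=> /andP[rho0 rho1]; pose r := (rho + 2^-1) / 2.
have r0 : 0 < r by rewrite /r; lra.
have r1 : r < 2^-1 by rewrite /r; lra.
have rr : rho < r by rewrite /r; lra.
have ab : rho ^+ 2 < r ^+ 2 by rewrite ltrXn2r ?nnegrE // ltW.
exists (cutoff (rho ^+ 2) (r ^+ 2) * (fun x => x 0 j)); last first.
  move=> x xr; rewrite fctE cutoff1 ?mul1r // /sq_enorm -enorm_sq.
  by rewrite lerXn2r ?nnegrE ?enorm_ge0.
set phi := _ * _.
have sub : supp phi `<=` [set x | enorm x <= r].
  have cl : closed [set x : 'rV[R]_2 | enorm x <= r].
    rewrite (_ : [set _ | _] = (@enorm R) @^-1` [set y | y <= r]) //.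
    by apply: preimage_closed; [move=> ? _; exact: enorm_continuous|exact: closed_le].
  rewrite [X in _ `<=` X]((closure_id _).1 cl).
  apply: closure_subset => x /=; apply: contra_neqP => /negP; rewrite -ltNge => h.
  rewrite /phi fctE cutoff0 ?mul0r // /sq_enorm -enorm_sq.
  by rewrite lerXn2r ?nnegrE ?enorm_ge0 ?(ltW r0) ?(ltW h).
split.
- apply: elementary_smooth; apply: elementaryM; last exact: elementary_coord.
  exact: elementary_cutoff.
- apply: bounded_closed_compact; last exact: closed_closure.
  exists r; split; first exact: num_real.
  move=> M rM x /sub /= xr; apply: (le_trans (norm_le_enorm x)); apply: (le_trans xr).
  exact: ltW.
- by move=> x /sub /= xr; rewrite /half_ball /eball /= subr0 (le_lt_trans xr).
Qed.

End smooth_functions.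

(** * Continuous functions along segments, tangents *)

Section continuous_operations.
Variables (R : realType) (T : topologicalType).
Implicit Types f g : T -> R.

Lemma continuous_addf f g : continuous f -> continuous g ->
  continuous (fun x => f x + g x).
Proof. by move=> cf cg x; apply: (@continuousD _ _ _ f g x); [exact: cf|exact: cg]. Qed.

Lemma continuous_mulf f g : continuous f -> continuous g ->
  continuous (fun x => f x * g x).
Proof. by move=> cf cg x; apply: (@continuousM _ _ f g x); [exact: cf|exact: cg]. Qed.

End continuous_operations.

Section continuous_on_segments.
Variable R : realType.
Implicit Types (p v x : 'rV[R]_2) (f : 'rV[R]_2 -> R).

Lemma measurable_fun_ray f p v : continuous f ->
  measurable_fun setT (fun s : R => f (ray p v s)).
Proof.
move=> cf; apply: continuous_measurable_fun => s.
apply: (@continuous_comp _ _ _ (ray p v) f); first exact: ray_continuous.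
exact: cf.
Qed.

Lemma continuous_ray f p v : continuous f -> continuous (fun s : R => f (ray p v s)).
Proof.
move=> cf s; apply: (@continuous_comp _ _ _ (ray p v) f); first exact: ray_continuous.
exact: cf.
Qed.

Lemma lebesgue_integrable01 (g : R -> R) : continuous g ->
  (@lebesgue_measure R).-integrable `[0, 1] (EFin \o g).
Proof.
move=> cg; apply: continuous_compact_integrable; first exact: segment_compact.
exact: continuous_subspaceT.
Qed.

Lemma lebesgue_integrable01o (g : R -> R) : continuous g ->
  (@lebesgue_measure R).-integrable `]0, 1[ (EFin \o g).
Proof.
move=> cg; apply: (integrableS _ _ _ (lebesgue_integrable01 cg)) => //.
exact: subset_itv_oo_cc.
Qed.

Lemma integrable_seg01 f p v : v != 0 -> continuous f ->
  (H1 R).-integrable (seg p v `]0, 1[) (EFin \o f).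
Proof.
move=> v0 cf; apply: integrable_seg => //; first exact: measurable_fun_ray.
exact: lebesgue_integrable01o (continuous_ray cf).
Qed.

Lemma Rintegral_seg01 f p v : v != 0 -> continuous f ->
  \int[H1 R]_(x in seg p v `]0, 1[) f x =
  enorm v * \int[lebesgue_measure]_(s in `]0, 1[) f (ray p v s).
Proof.
move=> v0 cf; apply: Rintegral_seg => //; first exact: measurable_fun_ray.
exact: lebesgue_integrable01o (continuous_ray cf).
Qed.

Lemma H1_seg01 p v : v != 0 -> H1 R (seg p v `]0, 1[) = (enorm v)%:E.
Proof.
move=> v0; rewrite H1_seg // lebesgue_measure_itv /= lte_fin ltr01.
by rewrite oppr0 addr0 mule1.
Qed.

Lemma H1_set1 x : H1 R [set x] = 0%E.
Proof.
have e0 : evec R 0 != 0 by rewrite -enorm_eq0 enorm_evec oner_eq0.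
have -> : [set x] = seg x (evec R 0) [set 0].
  by rewrite /seg image_set1 /ray scale0r addr0.
by rewrite H1_seg // lebesgue_measure_set1 mule0.
Qed.

(** By the fundamental theorem of calculus a segment has its divergence concentrated at the two
    endpoints; the divergence conditions below reduce to this. *)
Lemma integral_grad_seg (phi : 'rV[R]_2 -> R) p v : v != 0 ->
  (forall j y, derivable phi y (evec R j)) ->
  (forall j, continuous (fun y => 'D_(evec R j) phi y)) ->
  \int[H1 R]_(x in seg p v `]0, 1[) dot (grad phi x) ((enorm v)^-1 *: v) =
  phi (p + v) - phi p.
Proof.
move=> v0 d cd; pose f x := dot (grad phi x) ((enorm v)^-1 *: v).
have cf : continuous f.
  rewrite (_ : f = fun x => 'D_(evec R 0) phi x * ((enorm v)^-1 *: v) 0 0 +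
      'D_(evec R 1) phi x * ((enorm v)^-1 *: v) 0 1).
    apply: continuous_addf; apply: continuous_mulf;
    by [exact: cd|move=> ?; exact: cst_continuous].
  by apply/funext => x; rewrite /f dotE /grad !mxE.
rewrite (Rintegral_seg01 p v0 cf).
pose g s := dot (grad phi (ray p v s)) v.
have cg : continuous g.
  have -> : g = fun s => f (ray p v s) * enorm v.
    apply/funext => s; rewrite /g /f dotZr mulrAC mulVf ?mul1r //.
    by rewrite enorm_eq0.
  by apply: continuous_mulf; [exact: continuous_ray|move=> ?; exact: cst_continuous].
have dG s : is_derive s (1 : R) (phi \o ray p v : R -> R) (g s).
  exact: C1_is_derive_ray.
have I01 := lebesgue_integrable01 cg.
have -> : \int[lebesgue_measure]_(s in `]0, 1[) f (ray p v s) =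
    (enorm v)^-1 * \int[lebesgue_measure]_(s in `[0, 1]) g s.
  rewrite -Rintegral_itv_bndo_bndc; last first.
    apply: (integrableS _ _ _ I01) => // s /=.
    by rewrite !in_itv /= => /andP[-> /ltW ->].
  rewrite -Rintegral_itv_obnd_cbnd; last exact: lebesgue_integrable01o.
  rewrite -RintegralZl //; last exact: lebesgue_integrable01o.
  by apply: eq_Rintegral => s _; rewrite /f /g dotZr.
rewrite mulrA divff ?mul1r ?enorm_eq0 // /Rintegral.
have -> := @continuous_FTC2 R g (phi \o ray p v) 0 1 ltr01 _ _ _.
- by rewrite -EFinB /= /ray scale0r scale1r addr0.
- exact: continuous_subspaceT.
- have dc s : {for s, continuous (phi \o ray p v : R -> R)}.
    by apply: differentiable_continuous; apply/derivable1_diffP; apply: ex_derive.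
  split => [s _||]; first by apply: ex_derive.
    by apply: cvg_at_right_filter; exact: dc.
  by apply: cvg_at_left_filter; exact: dc.
- by move=> s _; rewrite derive1E derive_val.
Qed.

End continuous_on_segments.

Section tangents.
Variable R : realType.
Implicit Types (x t y : 'rV[R]_2) (phi : 'rV[R]_2 -> R) (gam : set (plane R)).

Lemma compact_supp_bounded phi : compact (supp phi) ->
  exists2 M : R, 0 < M & forall y, phi y != 0 -> enorm y < M.
Proof.
move=> /compact_bounded/ex_strict_bound_gt0[M M0 HM].
exists (2 * M); first by rewrite mulr_gt0.
move=> y y0; rewrite (le_lt_trans (enorm_le_norm y)) // ltr_pM2l //.
by apply: HM; exact: subset_closure.
Qed.

Lemma line_seg t : line t = seg 0 t setT.
Proof. by apply/seteqP; split => x [s _ <-]; exists s => //; rewrite /ray add0r. Qed.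

Lemma seg_scale x t (r : R) : r != 0 -> seg x (r *: t) setT = seg x t setT.
Proof.
move=> r0; apply/seteqP; split => y [s _ <-].
  by exists (s * r) => //; rewrite /ray scalerA.
by exists (s / r) => //; rewrite /ray scalerA divfK.
Qed.

(** Once the rescaled support of the test function fits into the ball of radius [d], the blow-up
    integral equals the line integral exactly, so the convergence is eventual constancy. *)
Lemma approx_tangent_local gam x t (d : R) : enorm t = 1 -> 0 < d ->
  (forall y, enorm (y - x) < d -> (gam y <-> seg x t setT y)) ->
  approx_tangent gam x t.
Proof.
move=> t1 d0 loc phi cphi sphi.
have t0 : t != 0 by rewrite -enorm_eq0 t1 oner_eq0.
have [M M0 HM] := compact_supp_bounded sphi.
have ch : continuous (fun s : R => phi (ray 0 t s)) by exact: continuous_ray.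
have Ih : (@lebesgue_measure R).-integrable setT (fun s => (phi (ray 0 t s))%:E).
  have -> : (fun s : R => (phi (ray 0 t s))%:E) = (fun s => (phi (ray 0 t s))%:E) \_ `[- M, M].
    apply/funext => s; rewrite patchE; case: ifPn => // /negP; rewrite inE /= in_itv /= => /negP sM.
    apply: contraNeq sM => /eqP h.
    have /HM : phi (ray 0 t s) != 0 by apply: contra_notN h => /eqP ->.
    by rewrite /ray add0r enormZ t1 mulr1 => /ltW; rewrite ler_norml.
  rewrite -integrable_mkcond //; apply: continuous_compact_integrable; first exact: segment_compact.
  exact: continuous_subspaceT.
apply: cvg_near_cst; near=> r.
have r0 : 0 < r by [].
have rn0 : r != 0 by rewrite gt_eqF.
have rM : r * M < d.
  by rewrite -ltr_pdivlMr //; near: r; apply: nbhs_right_lt; rewrite divr_gt0.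
pose f y := phi (r^-1 *: (y - x)).
have f0 y : f y != 0 -> enorm (y - x) < d.
  move/HM; rewrite enormZ gtr0_norm ?invr_gt0 // mulrC ltr_pdivrMr // => h.
  by rewrite (lt_trans h) // mulrC.
have -> : \int[H1 R]_(y in gam) phi (r^-1 *: (y - x)) = \int[H1 R]_(y in seg x t setT) f y.
  rewrite Rintegral_mkcond [RHS]Rintegral_mkcond; apply: eq_Rintegral => y _.
  rewrite !patchE -/(f y); have [->|fy] := eqVneq (f y) 0; first by rewrite !if_same.
  have [h1 h2] := loc y (f0 y fy).
  by congr (if _ then _ else _); apply/idP/idP; rewrite !inE.
have rt0 : r *: t != 0 by rewrite scaler_eq0 negb_or rn0.
rewrite -(seg_scale x t rn0).
have E s : f (ray x (r *: t) s) = phi (ray 0 t s).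
  by rewrite /f ray_sub !scalerA mulrAC mulVf // mul1r /ray add0r.
have Ef : (fun s => (f (ray x (r *: t) s))%:E) = (fun s => (phi (ray 0 t s))%:E).
  by apply/funext => s; rewrite E.
rewrite Rintegral_seg //; last 2 first.
- rewrite (_ : (fun _ => _) = (fun s => phi (ray 0 t s))); last by apply/funext => s; rewrite E.
  exact: continuous_measurable_fun.
- by rewrite Ef.
rewrite line_seg Rintegral_seg //; last exact: continuous_measurable_fun.
rewrite t1 mul1r enormZ t1 mulr1 gtr0_norm // mulrA mulVf // mul1r.
by apply: eq_Rintegral => s _; rewrite E.
Unshelve. all: by end_near. Qed.

End tangents.

(** * Lower bound *)

Section bounded_multipliers.
Context d (T : measurableType d) (R : realType) (mu : {measure set T -> \bar R}).
Implicit Types (A D : set T) (f g h : T -> R).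

Lemma integrable_bounded_mul D g h (K : R) : measurable D -> measurable_fun D g ->
  (forall x, D x -> `|g x| <= K) -> mu.-integrable D (EFin \o h) ->
  mu.-integrable D (EFin \o (fun x => g x * h x)).
Proof.
move=> mD mg gK ih.
have mh : measurable_fun D h.
  by apply/measurable_EFinP; case/integrableP: ih.
apply: (@le_integrable _ _ _ mu D mD _ (fun x => (K%:E * (h x)%:E)%E)).
- by apply/measurable_EFinP; exact: measurable_funM.
- move=> x Dx; rewrite /= lee_fin !normrM ler_wpM2r //.
  by rewrite (le_trans (gK x Dx)) // ler_norm.
- exact: integrableZl.
Qed.

Lemma integrable_EFinD D f g : measurable D -> mu.-integrable D (EFin \o f) ->
  mu.-integrable D (EFin \o g) -> mu.-integrable D (EFin \o (fun x => f x + g x)).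
Proof. by move=> mD hf hg; apply: (integrableD mD hf hg). Qed.

Lemma integrable_EFinB D f g : measurable D -> mu.-integrable D (EFin \o f) ->
  mu.-integrable D (EFin \o g) -> mu.-integrable D (EFin \o (fun x => f x - g x)).
Proof. by move=> mD hf hg; apply: (integrableB mD hf hg). Qed.

Lemma integrable_EFinZ D f (k : R) : measurable D -> mu.-integrable D (EFin \o f) ->
  mu.-integrable D (EFin \o (fun x => k * f x)).
Proof. by move=> mD hf; apply: (integrableZl mD k hf). Qed.

Lemma Rintegral_indicM A (C : set T) h : measurable A -> measurable C ->
  \int[mu]_(x in A) (\1_C x * h x) = \int[mu]_(x in A `&` C) h x.
Proof.
move=> mA mC; rewrite Rintegral_mkcondr; apply: eq_Rintegral => x _.
by rewrite patchE indicE; case: (x \in C); rewrite ?mul1r ?mul0r.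
Qed.

(* The staircase with N steps per unit approximates the multiplier g within
   1/N, and each of its steps integrates to 0. *)
Lemma Rintegral_mul_eq0 A g h (K : R) : measurable A -> measurable_fun A g ->
  (forall x, A x -> `|g x| <= K) -> mu.-integrable A (EFin \o h) ->
  (forall r, measurable [set x | r <= g x]) ->
  (forall r, \int[mu]_(x in A `&` [set x | r <= g x]) h x = 0) ->
  \int[mu]_(x in A) h x = 0 ->
  \int[mu]_(x in A) (g x * h x) = 0.
Proof.
move=> mA mg gK ih mC hC hA.
have igh := integrable_bounded_mul mA mg gK ih.
pose B := \int[mu]_(x in A) `|h x|.
have iabs : mu.-integrable A (EFin \o (fun x => `|h x|)).
  by have := integrable_abse ih.
have key (N : nat) : `|\int[mu]_(x in A) (g x * h x)| <= N.+1%:R^-1 * B.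
  pose e : R := N.+1%:R^-1.
  have e0 : 0 < e by rewrite invr_gt0.
  pose C (k : nat) : set T := [set x | - K + k.+1%:R * e <= g x].
  (* [S n] rounds [g] down to the grid of step [e] starting at [- K], capped at the level
     [- K + n%:R * e]; [Sapprox] treats values above and below the cap. *)
  pose S (n : nat) x : R := - K + \sum_(k < n) e * \1_(C k) x.
  have Sint n : mu.-integrable A (EFin \o (fun x => S n x * h x)) /\
      \int[mu]_(x in A) (S n x * h x) = 0.
    elim: n => [|n [iS zS]].
      rewrite (_ : (fun x => S 0%N x * h x) = (fun x => (- K) * h x)); last first.
        by apply/funext => x; rewrite /S big_ord0 addr0.
      split; first exact: integrable_EFinZ.
      by rewrite RintegralZl // hA mulr0.
    have iC : mu.-integrable A (EFin \o (fun x => \1_(C n) x * h x)).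
      apply: (@integrable_bounded_mul _ _ _ 1) => //.
        by apply: measurable_indic; exact: mC.
      by move=> x _; rewrite indicE; case: (x \in _); rewrite ?normr1 ?normr0.
    have ieC := integrable_EFinZ e mA iC.
    have -> : (fun x => S n.+1 x * h x) = (fun x => S n x * h x + e * (\1_(C n) x * h x)).
      by apply/funext => x; rewrite /S big_ord_recr /= addrA mulrDl mulrA.
    split; first exact: integrable_EFinD.
    rewrite RintegralD // zS add0r RintegralZl // Rintegral_indicM ?hC ?mulr0 //.
    exact: mC.
  have Sapprox n x : A x -> (n%:R * e <= g x + K -> S n x = - K + n%:R * e) /\
      (g x + K < n%:R * e -> S n x <= g x <= S n x + e).
    move=> Ax; have gx : 0 <= g x + K.
      by have := gK x Ax; rewrite ler_norml => /andP[]; lra.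
    elim: n => [|n [ih1 ih2]].
      rewrite /S big_ord0 mul0r; split=> // h1.
      by move: (lt_le_trans h1 gx); rewrite ltxx.
    have SE : S n.+1 x = S n x + e * \1_(C n) x by rewrite /S big_ord_recr /= addrA.
    rewrite SE indicE; split => hn.
      have -> : x \in C n by rewrite inE /C /=; lra.
      rewrite ih1 ?mulr1; last by move: hn; rewrite -natr1 mulrDl mul1r; lra.
      by rewrite -natr1 mulrDl mul1r addrA.
    have -> : (x \in C n) = false by apply/negP; rewrite inE /C /=; lra.
    rewrite mulr0 addr0; have [hn'|hn'] := leP (n%:R * e) (g x + K).
      by rewrite ih1 //; move: hn; rewrite -natr1 mulrDl mul1r => hn; apply/andP; split; lra.
    exact: ih2.
  (* Values of [g] range over an interval of length [2 K], so this many steps put the cap above all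
     of them. *)
  have [n hn] : exists n : nat, K + K < n%:R * e.
    exists (Num.bound (`|K + K| / e)).
    rewrite -ltr_pdivrMr //; apply: (le_lt_trans _ (archi_boundP _)).
      by rewrite ler_pM2r ?invr_gt0 // ler_norm.
    by rewrite divr_ge0 // ltW.
  have [iS zS] := Sint n.
  have E : \int[mu]_(x in A) (g x * h x) = \int[mu]_(x in A) ((g x - S n x) * h x).
    under [RHS]eq_Rintegral do rewrite mulrBl.
    by rewrite RintegralB // zS subr0.
  have id : mu.-integrable A (EFin \o (fun x => (g x - S n x) * h x)).
    rewrite (_ : (fun x => _) = (fun x => g x * h x - S n x * h x)); last first.
      by apply/funext => x; rewrite mulrBl.
    exact: integrable_EFinB.
  rewrite E (le_trans (le_normr_Rintegral mA id)) // /B -RintegralZl //.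
  apply: le_Rintegral => //.
  - by have := integrable_abse id.
  - exact: integrable_EFinZ.
  - move=> x Ax; rewrite normrM ler_wpM2r //.
    have gx := gK x Ax; have [_ hS] := Sapprox n x Ax.
    have /hS /andP[h1 h2] : g x + K < n%:R * e.
      by apply: le_lt_trans hn; move: gx; rewrite ler_norml => /andP[]; lra.
    by rewrite ger0_norm -/e; lra.
apply/eqP; rewrite -normr_le0; apply/ler_addgt0Pr => e e0; rewrite add0r.
have B0 : 0 <= B by apply: Rintegral_ge0.
pose N := Num.bound (B / e).
apply: (le_trans (key N)); rewrite mulrC ler_pdivrMr // mulrC -ler_pdivrMr //.
rewrite ltW // (lt_trans (archi_boundP _)) ?ltr_nat //.
by rewrite divr_ge0 // ltW.
Qed.

End bounded_multipliers.

Section borel_sets.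
Variable R : realType.
Implicit Types A B : set 'rV[R]_2.
Let Bt := g_sigma_algebraType (@open 'rV[R]_2).

Lemma borel_open A : open A -> borel A.
Proof. exact: sub_sigma_algebra. Qed.

Lemma borelI A B : borel A -> borel B -> borel (A `&` B).
Proof. by move=> bA bB; apply: (@measurableI _ Bt). Qed.

Lemma borelD A B : borel A -> borel B -> borel (A `\` B).
Proof. by move=> bA bB; apply: (@measurableD _ Bt). Qed.

Lemma borel_closed A : closed A -> borel A.
Proof.
by move=> /closed_openC/borel_open h; rewrite -(setCK A); apply: (@measurableC _ Bt).
Qed.

Lemma borel_superlevel (f : 'rV[R]_2 -> R) (r : R) : continuous f ->
  borel [set x | r <= f x].
Proof.
move=> cf; apply: borel_closed.
rewrite (_ : [set _ | _] = f @^-1` [set y | r <= y]) //.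
by apply: preimage_closed; [move=> ? _; exact: cf|exact: closed_ge].
Qed.

Lemma open_eball (c : 'rV[R]_2) (r : R) : open (eball c r).
Proof.
rewrite (_ : eball c r = (fun x => enorm (x - c)) @^-1` [set y | y < r]) //.
apply: open_comp; last exact: open_lt.
move=> x _; apply: (@lip_continuous _ _ 1) => u v.
have -> : u - v = (u - c) - (v - c) by rewrite opprB subrKA.
by rewrite mul1r enormB.
Qed.

End borel_sets.

Section line_in_ball.
Variable R : realType.
Implicit Types (t x : 'rV[R]_2).

Lemma line_half_ball t : enorm t = 1 ->
  line t `&` @half_ball R = seg (- (2^-1) *: t) t `]0, 1[.
Proof.
move=> t1; apply/seteqP; split => x.
  move=> [[s _ <-]]; rewrite /half_ball /eball /= subr0 enormZ t1 mulr1.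
  rewrite ltr_norml => /andP[h1 h2].
  exists (s + 2^-1); first by rewrite /= in_itv /=; apply/andP; split; lra.
  by rewrite /ray -scalerDl addrCA addNr addr0.
move=> [s /=]; rewrite in_itv /= => /andP[s0 s1] <-; split.
  by exists (- 2^-1 + s) => //; rewrite /ray scalerDl.
rewrite /half_ball /eball /= subr0 /ray -scalerDl enormZ t1 mulr1 ltr_norml.
by apply/andP; split; lra.
Qed.

Lemma derive_coord (v x : 'rV[R]_2) (i : 'I_2) :
  'D_v (fun x : 'rV[R]_2 => x 0 i : R) x = v 0 i.
Proof.
rewrite /derive; apply: cvg_lim => //; apply: cvg_near_cst.
near=> h; have h0 : h != 0 by near: h; exact: nbhs_dnbhs_neq.
by rewrite /= !mxE addrK -[_ *: _]/(_ * _) mulrA mulVf // mul1r.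
Unshelve. all: by end_near. Qed.

(** The norm attains its maximum on the compact closure, which lies in the open ball, so the maximum
    is strictly below 1/2 and leaves room for a cutoff. *)
Lemma closure_eball_radius (c : 'rV[R]_2) (r : R) : 0 < r ->
  closure (eball c r) `<=` @half_ball R ->
  exists2 rho : R, 0 <= rho < 2^-1 & forall x, eball c r x -> enorm x <= rho.
Proof.
move=> r0 sub.
have cK : compact (closure (eball c r)).
  apply: bounded_closed_compact; last exact: closed_closure.
  exists 1; split; first exact: num_real.
  move=> M M1 x /sub; rewrite /half_ball /eball /= subr0 => h.
  rewrite (le_trans (norm_le_enorm x)) // (le_trans (ltW h)) //.
  by rewrite (le_trans _ (ltW M1)) // invf_le1 // ler1n.
have K0 : closure (eball c r) !=set0.
  by exists c; apply: subset_closure; rewrite /eball /= subrr enorm0.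
have [x xK xmax] := EVT_max_rV K0 cK (continuous_subspaceT (@enorm_continuous R)).
exists (enorm x).
  by rewrite enorm_ge0 /=; move: xK; rewrite inE => /sub; rewrite /half_ball /eball /= subr0.
by move=> y yB; apply: xmax; rewrite inE; exact: subset_closure.
Qed.

Lemma continuous_half_ball_bounded (f : 'rV[R]_2 -> R) : continuous f ->
  exists K : R, forall x, @half_ball R x -> `|f x| <= K.
Proof.
move=> cf; pose A := [set x : 'rV[R]_2 | enorm x <= 2^-1].
have cA : compact A.
  apply: bounded_closed_compact.
    exists 1; split; first exact: num_real.
    move=> M M1 x xA; apply: (le_trans (norm_le_enorm x)); apply: (le_trans xA).
    by rewrite (le_trans _ (ltW M1)) // invf_le1 // ler1n.
  rewrite (_ : A = (@enorm R) @^-1` [set y | y <= 2^-1]) //.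
  by apply: preimage_closed; [move=> ? _; exact: enorm_continuous|exact: closed_le].
have A0 : A !=set0 by exists 0; rewrite /A /= enorm0.
have [|x xA xmax] := @EVT_max_rV R 2 (fun x => `|f x|) A A0 cA.
  apply: continuous_subspaceT => x; apply: (@continuous_comp _ _ _ f (fun y : R => `|y|)).
    exact: cf.
  exact: norm_continuous.
exists `|f x| => y; rewrite /half_ball /eball /= subr0 => /ltW yA.
by apply: xmax; rewrite inE.
Qed.

End line_in_ball.

(** * Total mass of an admissible measure *)

Section mass.
Variable R : realType.
Variables (b : 'rV[int]_2) (t : 'rV[R]_2) (gam : set (plane R)).
Variables (theta : plane R -> 'rV[int]_2) (tau : plane R -> 'rV[R]_2).
Hypothesis t1 : enorm t = 1.
Hypothesis gM : Mdf (@half_ball R) gam theta tau.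
Hypothesis gS : straight_near_boundary b t gam theta tau.

Local Notation L := (line t `&` @half_ball R).
Local Notation H := (@half_ball R : set (plane R)).
Let D i j (x : plane R) : R := density theta tau x i j.
Let D0 i j : R := toR R b 0 i * t 0 j.

Lemma densityE th ta (x : plane R) i j : density th ta x i j = toR R (th x) 0 i * ta x 0 j.
Proof. by rewrite /density !mxE big_ord1 !mxE. Qed.

Let mgam : measurable gam. Proof. by case: gM => -[[]]. Qed.

Let gamH : gam `<=` H. Proof. by case: gM => -[]. Qed.

Let t0 : t != 0. Proof. by rewrite -enorm_eq0 t1 oner_eq0. Qed.

Let mL : measurable (L : set (plane R)).
Proof. by rewrite line_half_ball //; apply: measurable_seg. Qed.

Let mH : measurable H.
Proof. by apply: open_measurable_plane; exact: open_eball. Qed.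

Let mtheta i : measurable_fun gam (fun x => toR R (theta x) 0 i).
Proof. by apply/measurable_EFinP; case: gM => _ _ /(_ i) /integrableP[]. Qed.

Let mtau j : measurable_fun gam (fun x => tau x 0 j).
Proof. by case: gM => _ [/(_ j)]. Qed.

Let itheta i : (H1 R).-integrable gam (EFin \o (fun x => toR R (theta x) 0 i)).
Proof. by case: gM => _ _ /(_ i). Qed.

Let tau1 x : gam x -> enorm (tau x) = 1.
Proof. by case: gM => _ [_ /(_ x)]. Qed.

Lemma integrable_density i j : (H1 R).-integrable gam (EFin \o D i j).
Proof.
rewrite (_ : D i j = (fun x => tau x 0 j * toR R (theta x) 0 i)).
  apply: (integrable_bounded_mul (K := 1)) => // x /tau1 h.
  by rewrite (le_trans (coord_le_norm _ _)) // (le_trans (norm_le_enorm _)) ?h.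
by apply/funext => x; rewrite /D densityE mulrC.
Qed.

(** The density of the difference between the given measure and the straight one, both extended by
    0: agreement near the boundary becomes the vanishing of integrals of a single function. *)
Let h i j (x : plane R) : R := (D i j \_ gam) x - (cst (D0 i j) \_ L) x.

Let icst i j : (H1 R).-integrable L (EFin \o (cst (D0 i j) : plane R -> R)).
Proof.
rewrite line_half_ball //.
apply: (@integrable_seg01 R (cst (D0 i j))) => // x; exact: cst_continuous.
Qed.

Let igam i j : (H1 R).-integrable setT (EFin \o (D i j \_ gam)).
Proof.
have := (integrable_mkcond (EFin \o D i j) mgam).1 (integrable_density i j).
by rewrite -restrict_EFin.
Qed.

Let iL i j : (H1 R).-integrable setT (EFin \o (cst (D0 i j) \_ L : plane R -> R)).
Proof.
have := (integrable_mkcond (EFin \o (cst (D0 i j) : plane R -> R)) mL).1 (icst i j).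
by rewrite -restrict_EFin.
Qed.

Let ih i j : (H1 R).-integrable setT (EFin \o h i j).
Proof. exact: integrable_EFinB. Qed.

Let ihS i j A : measurable A -> (H1 R).-integrable A (EFin \o h i j).
Proof. by move=> mA; exact: (integrableS _ _ _ (ih i j)). Qed.

Let int_h i j (A : set (plane R)) : measurable A ->
  \int[H1 R]_(x in A) h i j x =
  \int[H1 R]_(x in gam `&` A) D i j x - \int[H1 R]_(x in L `&` A) D0 i j.
Proof.
move=> mA; rewrite RintegralB //.
- by rewrite -!Rintegral_mkcondl.
- exact: (integrableS _ _ _ (igam i j)).
- exact: (integrableS _ _ _ (iL i j)).
Qed.

Let int_mul_h i j (g : 'rV[R]_2 -> R) : continuous g ->
  \int[H1 R]_(x in H) (g x * h i j x) =
  \int[H1 R]_(x in gam) (g x * D i j x) - \int[H1 R]_(x in L) (g x * D0 i j).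
Proof.
move=> cg; have [K gK] := continuous_half_ball_bounded cg.
have mg A : measurable_fun A (g : plane R -> R) by exact: continuous_measurable_plane.
have i1 : (H1 R).-integrable H (EFin \o (fun x => g x * (D i j \_ gam) x)).
  by apply: (integrable_bounded_mul (K := K)) => //; exact: (integrableS _ _ _ (igam i j)).
have i2 : (H1 R).-integrable H (EFin \o (fun x => g x * (cst (D0 i j) \_ L) x)).
  by apply: (integrable_bounded_mul (K := K)) => //; exact: (integrableS _ _ _ (iL i j)).
under eq_Rintegral do rewrite /h mulrBr.
rewrite RintegralB //; congr (_ - _).
  rewrite -[in RHS](setIidl gamH) Rintegral_mkcondl; apply: eq_Rintegral => x _.
  by rewrite !patchE; case: ifP; rewrite ?mulr0.
have LH : L `<=` H by move=> x [].
rewrite -[in RHS](setIidl LH) Rintegral_mkcondl; apply: eq_Rintegral => x _.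
by rewrite !patchE; case: ifP; rewrite ?mulr0.
Qed.

(** The diameter itself is divergence-free in the open ball, because its two endpoints lie on the
    sphere, where [phi] vanishes. *)
Let div_L phi i : test_fun (@half_ball R) phi ->
  \sum_(j < 2) \int[H1 R]_(x in L) ('D_(evec R j) phi x * D0 i j) = 0.
Proof.
move=> [sphi _ supphi].
have d j y : derivable phi y (evec R j) := (sphi [::]).2 j y.
have cd j : continuous (fun y => 'D_(evec R j) phi y) := (sphi [:: j]).1.
have ij j : (H1 R).-integrable L (EFin \o (fun x : plane R => 'D_(evec R j) phi x * D0 i j)).
  rewrite line_half_ball //; apply: integrable_seg01 => //.
  by apply: continuous_mulf => //; move=> x; exact: cst_continuous.
have phi0 x : ~ @half_ball R x -> phi x = 0.
  move=> xH; apply: contra_notP xH => /eqP phix; apply: supphi.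
  exact: subset_closure.
rewrite sum2E -RintegralD //.
have -> : \int[H1 R]_(x in L) ('D_(evec R 0) phi x * D0 i 0 + 'D_(evec R 1) phi x * D0 i 1) =
    \int[H1 R]_(x in L) (toR R b 0 i * dot (grad phi x) ((enorm t)^-1 *: t)).
  apply: eq_Rintegral => x _; rewrite t1 invr1 scale1r dotE /grad /D0 !mxE.
  by ring.
have ig : (H1 R).-integrable L (EFin \o (fun x => dot (grad phi x) ((enorm t)^-1 *: t))).
  rewrite line_half_ball //; apply: integrable_seg01 => //.
  rewrite (_ : (fun x => _) = (fun x => 'D_(evec R 0) phi x * t 0 0 + 'D_(evec R 1) phi x * t 0 1)).
    apply: continuous_addf; apply: continuous_mulf => //; move=> x; exact: cst_continuous.
  by apply/funext => x; rewrite t1 invr1 scale1r dotE /grad !mxE.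
rewrite RintegralZl // line_half_ball // integral_grad_seg //.
have e2 : enorm (- 2^-1 *: t) = 2^-1 by rewrite enormZ t1 mulr1 normrN ger0_norm.
rewrite !phi0 ?subrr ?mulr0 //; rewrite /half_ball /eball /= subr0.
  by rewrite e2 ltxx.
have -> : - 2^-1 *: t + t = 2^-1 *: t.
  by rewrite -{2}[t]scale1r -scalerDl; congr (_ *: t); field.
by rewrite enormZ t1 mulr1 ger0_norm // ltxx.
Qed.

(* Testing with a cutoff of the coordinate function [x_j]. *)
Lemma total_mass i j : \int[H1 R]_(x in gam) D i j x = D0 i j.
Proof.
have [c [r [r0 clB gE]]] := gS.
have [rho rho01 Brho] := closure_eball_radius r0 clB.
have [phi tphi phiE] := test_fun_cutoff_coord j rho01.
pose B : set (plane R) := eball c r; pose A := H `\` B.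
have BH : B `<=` H by move=> x xB; apply: clB; exact: subset_closure.
have mB : measurable B by apply: open_measurable_plane; exact: open_eball.
have mA : measurable A by exact: measurableD.
have bA : borel A by apply: borelD; apply: borel_open; exact: open_eball.
(* The hypothesis concerns Borel sets only; [Rintegral_mul_eq0] extends it below to the continuous
   multipliers ['D_(evec R k) phi], whose superlevel sets are Borel. *)
have hA k C : borel C -> C `<=` A -> \int[H1 R]_(x in C) h i k x = 0.
  move=> bC CA; rewrite int_h; last exact: borel_measurable_plane.
  have := gE C bC CA; move=> /matrixP /(_ i k); rewrite !mxE => ->.
  apply/eqP; rewrite subr_eq0; apply/eqP; apply: eq_Rintegral => x _.
  by rewrite densityE.
have cD k : continuous (fun y => 'D_(evec R k) phi y).
  by case: tphi => sphi _ _; exact: (sphi [:: k]).1.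
have HBA : H = B `|` A by rewrite /A setDUK.
have dBA : [disjoint B & A] by apply/disj_setPS => x [? []].
have div : \sum_(k < 2) \int[H1 R]_(x in H) ('D_(evec R k) phi x * h i k x) = 0.
  under eq_bigr do rewrite int_mul_h //.
  rewrite sumrB div_L // subr0.
  by case: gM => _ _ _ /(_ phi tphi i).
have split k : \int[H1 R]_(x in H) ('D_(evec R k) phi x * h i k x) =
    \int[H1 R]_(x in B) ('D_(evec R k) phi x * h i k x).
  have [K gK] := continuous_half_ball_bounded (cD k).
  have iH : (H1 R).-integrable H (EFin \o (fun x => 'D_(evec R k) phi x * h i k x)).
    have mD := @continuous_measurable_plane R _ H (cD k).
    exact: (integrable_bounded_mul mH mD gK (ihS i k mH)).
  have mDA := @continuous_measurable_plane R _ A (cD k).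
  have zA : \int[H1 R]_(x in A) ('D_(evec R k) phi x * h i k x) = 0.
    apply: (Rintegral_mul_eq0 mA mDA _ (ihS i k mA)).
    - by move=> x [xH _]; exact: gK.
    - by move=> s; apply: borel_measurable_plane; exact: borel_superlevel.
    - move=> s; apply: hA; last by move=> x [].
      by apply: borelI => //; exact: borel_superlevel.
    - exact: hA.
  have := @Rintegral_setU _ _ _ (H1 R) B A _ mB mA _ dBA.
  by rewrite -HBA => /(_ _ iH) ->; rewrite zA addr0.
(* On [B] the test function is the coordinate [x 0 j], so in the divergence identity only the term
   [k = j] survives there, with factor 1. *)
have onB k x : B x -> 'D_(evec R k) phi x = (k == j)%:R.
  move=> Bx; have E : \near x, phi x = x 0 j.
    have : nbhs x (eball c r) by apply: open_nbhs_nbhs; split => //; exact: open_eball.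
    apply: filterS => y yB; apply: phiE; exact: Brho.
  rewrite (near_eq_derive _ E) ?derive_coord ?mxE //.
  by rewrite eq_sym.
have hB : \int[H1 R]_(x in B) h i j x = 0.
  rewrite -div (bigD1 j) //= big1 ?addr0.
    rewrite split; apply: eq_Rintegral => x /[1!inE] Bx.
    by rewrite onB // eqxx mul1r.
  move=> k kj; rewrite split (_ : \int[H1 R]_(x in B) _ = \int[H1 R]_(x in B) (0 * h i k x)).
    by rewrite RintegralZl ?mul0r //; exact: ihS.
  by apply: eq_Rintegral => x /[1!inE] Bx; rewrite onB // (negbTE kj).
have : \int[H1 R]_(x in H) h i j x = 0.
  by rewrite {1}HBA Rintegral_setU -?HBA ?hB ?add0r //; [exact: hA|exact: ihS].
rewrite int_h // (setIidl gamH) => /eqP; rewrite subr_eq0 => /eqP ->.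
have LH : L `<=` H by move=> x [].
(* The diameter of the ball of radius 1/2 has length 1. *)
rewrite (setIidl LH) Rintegral_cst // line_half_ball //.
by rewrite [X in fine X]H1_seg01 // t1 mulr1.
Qed.

(** The calibrating integrand [q] is linear in the density, so its integral is known from
    [total_mass], while pointwise it lies below the energy density. *)
Lemma calibrated_lower_bound (eta : R) (m1 m2 : 'rV[R]_2) : 0 <= eta ->
  (forall (b' : 'rV[int]_2) (tau' : 'rV[R]_2), enorm tau' = 1 ->
    (b' 0 0)%:~R * dot m1 tau' + (b' 0 1)%:~R * dot m2 tau' <= psi eta b' tau') ->
  (((b 0 0)%:~R * dot m1 t + (b 0 1)%:~R * dot m2 t)%:E <=
    \int[H1 R]_(x in gam) (psi eta (theta x) (tau x))%:E)%E.
Proof.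
move=> eta0 cal.
pose q (x : plane R) := m1 0 0 * D 0 0 x + m1 0 1 * D 0 1 x + (m2 0 0 * D 1 0 x + m2 0 1 * D 1 1 x).
have iq : (H1 R).-integrable gam (EFin \o q).
  by do 2 (apply: integrable_EFinD => //); apply: integrable_EFinZ => //; exact: integrable_density.
have -> : (b 0 0)%:~R * dot m1 t + (b 0 1)%:~R * dot m2 t = \int[H1 R]_(x in gam) q x.
  have iZ m i j : (H1 R).-integrable gam (EFin \o (fun x => m * D i j x)).
    by apply: integrable_EFinZ => //; exact: integrable_density.
  rewrite /q RintegralD //; [|exact: integrable_EFinD..].
  rewrite !RintegralD // !RintegralZl //; try exact: integrable_density.
  by rewrite !total_mass !dotE /D0 !mxE; ring.
rewrite /Rintegral fineK; last exact: integrable_fin_num.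
have mq : measurable_fun gam q by apply/measurable_EFinP; case/integrableP: iq.
(* The energy is quadratic in [theta], which is merely integrable, so its integral may be infinite.
   The comparison is made between nonnegative extended integrands, through the positive part of
   [q]. *)
apply: (@le_trans _ _ (\int[H1 R]_(x in gam) ((EFin \o q)^\+ x))%E).
  rewrite [X in (X <= _)%E]integralE -[X in (_ <= X)%E]adde0.
  by apply: leeD2l; rewrite oppe_le0; exact: integral_ge0.
have ms : measurable_fun gam (fun x => toR R (theta x) 0 0 * tau x 0 0 + toR R (theta x) 0 1 * tau x 0 1).
  by apply: measurable_funD; apply: measurable_funM.
have mpsi : measurable_fun gam (fun x => psi eta (theta x) (tau x)).
  rewrite (_ : (fun x => _) = (fun x => (toR R (theta x) 0 0 * toR R (theta x) 0 0 +
     toR R (theta x) 0 1 * toR R (theta x) 0 1) + eta * ((toR R (theta x) 0 0 * tau x 0 0 +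
     toR R (theta x) 0 1 * tau x 0 1) * (toR R (theta x) 0 0 * tau x 0 0 +
     toR R (theta x) 0 1 * tau x 0 1)))); last first.
    by apply/funext => x; rewrite /psi enorm_sq !dotE expr2.
  apply: measurable_funD.
    by apply: measurable_funD; apply: measurable_funM.
  apply: measurable_funM; first exact: measurable_cst.
  by apply: measurable_funM.
apply: ge0_le_integral.
- exact: mgam.
- by move=> x _; exact: funepos_ge0.
- by apply: measurable_funepos; exact/measurable_EFinP.
- exact/measurable_EFinP.
- move=> x gx; rewrite funeposE /= ge_max !lee_fin; apply/andP; split.
    have := cal (theta x) (tau x) (tau1 gx); congr (_ <= _).
    by rewrite /q /D !densityE !dotE !mxE; ring.
  by rewrite /psi addr_ge0 ?sqr_ge0 // mulr_ge0 ?sqr_ge0.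
Qed.

End mass.

(** * Networks of segments *)

Section networks.
Lemma integrable_setU d (R : realType) (T : measurableType d) (mu : {measure set T -> \bar R})
    (A B : set T) (f : T -> \bar R) :
  measurable A -> measurable B -> [disjoint A & B] ->
  mu.-integrable A f -> mu.-integrable B f -> mu.-integrable (A `|` B) f.
Proof.
move=> mA mB dAB iA iB.
have mf : measurable_fun (A `|` B) f.
  by apply/measurable_funU => //; split; [exact: measurable_int iA|exact: measurable_int iB].
apply/integrableP; split => //.
rewrite ge0_integral_setU //; last exact: measurableT_comp.
by rewrite lte_add_pinfty //; [case/integrableP: iA|case/integrableP: iB].
Qed.

Lemma memSl (T : eqType) (s : T) S x : x \in S -> x \in s :: S.
Proof. by move=> h; rewrite inE h orbT. Qed.

Variable R : realType.

Definition piece := ('rV[int]_2 * ('rV[R]_2 * 'rV[R]_2))%type.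
Implicit Types (s : piece) (S : seq piece) (x y : 'rV[R]_2).

Definition mult s := s.1.
Definition orig s := s.2.1.
Definition disp s := s.2.2.
Definition dir s := (enorm (disp s))^-1 *: disp s.
(** Open segments carry the measure, so that each piece is a line near each of its points; the
    closed versions [cset] serve to keep pieces apart. *)
Definition pset s : set (plane R) := seg (orig s) (disp s) `]0, 1[.
Definition cset s : set (plane R) := seg (orig s) (disp s) `[0, 1].

Fixpoint net_set S : set (plane R) :=
  if S is s :: S' then pset s `|` net_set S' else set0.

(* Points of several pieces form a null set for the networks of interest; there
   the first piece prevails. *)
Fixpoint net_theta S (x : plane R) : 'rV[int]_2 :=
  if S is s :: S' then if x \in pset s then mult s else net_theta S' x else 0.

Fixpoint net_tau S (x : plane R) : 'rV[R]_2 :=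
  if S is s :: S' then if x \in pset s then dir s else net_tau S' x else 0.

(** Makes the overlap of two pieces [H1]-null while still allowing crossings and common
    endpoints. *)
Definition meet_once s s' :=
  forall x y, cset s x -> cset s' x -> cset s y -> cset s' y -> x = y.

Fixpoint good S : Prop :=
  if S is s :: S' then
    [/\ disp s != 0, pset s `<=` @half_ball R,
        forall s', s' \in S' -> meet_once s s' & good S']
  else True.

Fixpoint clnet S : set (plane R) :=
  if S is s :: S' then cset s `|` clnet S' else set0.

(** The exceptional set for tangency. It is built from closed pieces, so that endpoints of one piece
    lying on another are included. *)
Fixpoint bad S : set (plane R) :=
  if S is s :: S' then (cset s `&` clnet S') `|` bad S' else set0.

Lemma pset_cset s : pset s `<=` cset s.
Proof. by apply: image_subset; exact: subset_itv_oo_cc. Qed.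

Lemma net_clnet S : net_set S `<=` clnet S.
Proof. by elim: S => //= s S ih x [/pset_cset|/ih]; [left|right]. Qed.

Lemma closed_cset s : closed (cset s : set 'rV[R]_2).
Proof.
have cK : compact (cset s : set 'rV[R]_2).
  apply: continuous_compact; last exact: segment_compact.
  by apply: continuous_subspaceT; exact: ray_continuous.
apply: compact_closed cK; exact: norm_hausdorff.
Qed.

Lemma closed_clnet S : closed (clnet S : set 'rV[R]_2).
Proof.
elim: S => [|s S ih] /=; first exact: closed0.
by apply: closedU => //; exact: closed_cset.
Qed.

Lemma dir_unit s : disp s != 0 -> enorm (dir s) = 1.
Proof. exact: enorm_unit. Qed.

Lemma measurable_pset s : disp s != 0 -> measurable (pset s).
Proof. by move=> s0; apply: measurable_seg. Qed.

Lemma measurable_net S : good S -> measurable (net_set S).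
Proof.
elim: S => [|s S ih] /=; first by move=> _; exact: measurable0.
by move=> [s0 _ _ /ih mS]; apply: measurableU => //; exact: measurable_pset.
Qed.

Lemma measurable_clnet S : measurable (clnet S).
Proof. by apply: closed_measurable_plane; exact: closed_clnet. Qed.

Lemma measurable_bad S : measurable (bad S).
Proof.
elim: S => [|s S ih] /=; first exact: measurable0.
apply: measurableU => //; apply: measurableI; last exact: measurable_clnet.
by apply: closed_measurable_plane; exact: closed_cset.
Qed.

Lemma H1_U0 (A B : set (plane R)) : H1 R A = 0%E -> H1 R B = 0%E -> H1 R (A `|` B) = 0%E.
Proof.
move=> A0 B0; apply/eqP; rewrite eq_le measure_ge0 andbT.
apply: (le_trans (outer_measureU2 (hausdorff1_outer R) A B)).
by rewrite [hausdorff1_outer R A]A0 [hausdorff1_outer R B]B0 adde0.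
Qed.

Lemma H1_sub0 (A B : set (plane R)) : A `<=` B -> H1 R B = 0%E -> H1 R A = 0%E.
Proof.
move=> AB B0; apply/eqP; rewrite eq_le measure_ge0 andbT -B0.
exact: (le_outer_measure (hausdorff1_outer R)).
Qed.

Lemma H1_subsingleton (A : set (plane R)) : (forall x y, A x -> A y -> x = y) -> H1 R A = 0%E.
Proof.
move=> Axy; have [->|/set0P[x Ax]] := eqVneq A set0; first by rewrite measure0.
by apply: (H1_sub0 _ (H1_set1 x)) => y Ay; apply: Axy.
Qed.

Lemma H1_cset_clnet s S : (forall s', s' \in S -> meet_once s s') ->
  H1 R (cset s `&` clnet S) = 0%E.
Proof.
elim: S => [|s' S ih] /= h; first by rewrite setI0; exact: hausdorff1_0.
rewrite setIUr; apply: H1_U0.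
  apply: H1_subsingleton => x y [? ?] [? ?].
  by apply: (h s'); rewrite ?mem_head.
by apply: ih => s'' s''S; apply: h; rewrite inE s''S orbT.
Qed.

Lemma H1_bad S : good S -> H1 R (bad S) = 0%E.
Proof.
elim: S => [|s S ih] /=; first by move=> _; exact: hausdorff1_0.
by move=> [_ _ h /ih bS]; apply: H1_U0 => //; exact: H1_cset_clnet.
Qed.

Lemma H1_net_lty S : good S -> (H1 R (net_set S) < +oo)%E.
Proof.
elim: S => [|s S ih] /=; first by move=> _; rewrite [X in (X < _)%E]hausdorff1_0 ltry.
move=> [s0 _ _ /ih fS]; apply: (le_lt_trans (outer_measureU2 (hausdorff1_outer R) _ _)).
rewrite lte_add_pinfty //.
by rewrite [X in (X < _)%E](H1_seg01 (orig s) s0) ltry.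
Qed.

(** Pieces overlap in null sets, so the precedence given to earlier pieces does not affect integrals
    and they add up over the pieces. *)
Lemma net_integral S (G : plane R -> 'rV[int]_2 -> 'rV[R]_2 -> R) : good S ->
  (forall s, s \in S -> (H1 R).-integrable (pset s) (EFin \o (fun x => G x (mult s) (dir s)))) ->
  (H1 R).-integrable (net_set S) (EFin \o (fun x => G x (net_theta S x) (net_tau S x))) /\
  \int[H1 R]_(x in net_set S) G x (net_theta S x) (net_tau S x) =
  \sum_(s <- S) \int[H1 R]_(x in pset s) G x (mult s) (dir s).
Proof.
elim: S => [|s S ih].
  by move=> _ _; rewrite big_nil [net_set _]/= Rintegral_set0; split => //; exact: (integrable_set0 (H1 R)).
move=> [s0 _ once gS] iG; rewrite big_cons [net_set _]/=.
have {}ih := ih gS (fun s' s'S => iG s' (memSl s s'S)).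
have [iS <-] := ih.
have mP := measurable_pset s0; have mN := measurable_net gS.
pose g x : R := G x (if x \in pset s then mult s else net_theta S x)
  (if x \in pset s then dir s else net_tau S x).
have iP : (H1 R).-integrable (pset s) (EFin \o g).
  apply: (eq_integrable mP _ _ _ (iG s (mem_head s S))) => x xP.
  by rewrite /= /g xP.
have mD : measurable (net_set S `\` pset s) by exact: measurableD.
have iN' : (H1 R).-integrable (net_set S `\` pset s)
    (EFin \o (fun x => G x (net_theta S x) (net_tau S x))).
  by apply: (integrableS mN mD _ iS); exact: subDsetl.
have gE : {in net_set S `\` pset s, forall x, G x (net_theta S x) (net_tau S x) = g x}.
  by move=> x /[!inE] -[_ xP]; rewrite /g memNset.
have iN : (H1 R).-integrable (net_set S `\` pset s) (EFin \o g).
  by apply: (eq_integrable mD _ _ _ iN') => x xD; rewrite /= gE.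
have PN : pset s `|` net_set S = pset s `|` (net_set S `\` pset s).
  by rewrite setUDr setDv setD0.
have dPN : [disjoint pset s & net_set S `\` pset s] by apply/disj_setPS => x [? []].
rewrite PN; split.
  exact: integrable_setU.
rewrite Rintegral_setU //; last exact: integrable_setU.
congr (_ + _).
  by apply: eq_Rintegral => x xP; rewrite /= xP.
transitivity (\int[H1 R]_(x in net_set S `\` pset s) G x (net_theta S x) (net_tau S x)).
  by apply: eq_Rintegral => x xD; rewrite (gE x xD).
rewrite /Rintegral; congr fine.
have N0 : H1 R (net_set S `&` pset s) = 0%E.
  apply: (H1_sub0 _ (H1_cset_clnet once)) => x [xN xP]; split; first exact: pset_cset.
  exact: net_clnet.
have mI : measurable (net_set S `&` pset s) by exact: measurableI.
by rewrite (negligible_integral mI mN iS N0) setDIr setDv set0U.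
Qed.

End networks.

(** * Networks as competitors for the envelope *)

Section network_measure.
Variable R : realType.
Implicit Types (s : piece R) (S : seq (piece R)) (x y : 'rV[R]_2).

Lemma net_piece S x : net_set S x ->
  exists s, [/\ s \in S, pset s x, net_theta S x = mult s & net_tau S x = dir s].
Proof.
elim: S => //= s S ih sSx; case: ifPn => [/set_mem xs|xs].
  by exists s; rewrite mem_head.
case: sSx => [/mem_set xs'|/ih[s' [s'S xs' -> ->]]]; first by rewrite xs' in xs.
by exists s'; rewrite inE s'S orbT.
Qed.

Lemma good_disp S s : good S -> s \in S -> disp s != 0.
Proof.
elim: S => // s' S ih [s'0 _ _ gS]; rewrite inE => /orP[/eqP-> //|]; exact: ih.
Qed.

Lemma pset_local s x : disp s != 0 -> pset s x ->
  exists2 d : R, 0 < d & forall y, enorm (y - x) < d -> (pset s y <-> seg x (dir s) setT y).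
Proof.
move=> s0 [r /= /[!in_itv]/= /andP[r0 r1] xE].
(* The radius below is the distance from [x] to the nearer endpoint. *)
have v0 : 0 < enorm (disp s) by rewrite enorm_gt0.
exists (Num.min r (1 - r) * enorm (disp s)).
  by rewrite mulr_gt0 // lt_min r0 subr_gt0.
move=> y yx; split.
  move=> [q _ <-]; exists ((q - r) * enorm (disp s)) => //.
  rewrite -xE /ray /dir scalerA mulfK ?gt_eqF // scalerBl.
  by rewrite -addrA; congr (_ + _); rewrite addrCA subrr addr0.
move=> [q _ yE]; exists (r + q / enorm (disp s)); last first.
  by rewrite -yE -xE /ray /dir scalerDl scalerA addrA.
have : `|q| < Num.min r (1 - r) * enorm (disp s).
  move: yx; rewrite -yE /ray addrC addKr enormZ dir_unit ?mulr1 //.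
rewrite -ltr_pdivrMr // => h; have : `|q / enorm (disp s)| < Num.min r (1 - r).
  by rewrite normrM (ger0_norm (x := (enorm _)^-1)) // invr_ge0 ltW.
rewrite lt_min !ltr_norml /= in_itv /= => /andP[/andP[h1 h2] /andP[h3 h4]].
by lra.
Qed.

Lemma closed_far (A : set 'rV[R]_2) x : closed A -> ~ A x ->
  exists2 d : R, 0 < d & forall y, enorm (y - x) < d -> ~ A y.
Proof.
move=> /closed_openC oA Ax.
have /nbhs_ballP[e /= e0 he] : nbhs x (~` A) by apply: open_nbhs_nbhs; split.
exists e => // y yx; apply: he; rewrite -ball_normE /= distrC.
by apply: le_lt_trans yx; exact: norm_le_enorm.
Qed.

(** Away from [bad S], the closed union of the other pieces keeps a positive distance from [x], so
    only one open segment is seen nearby. *)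
Lemma net_local S x : good S -> net_set S x -> ~ bad S x ->
  exists2 d : R, 0 < d &
    forall y, enorm (y - x) < d -> (net_set S y <-> seg x (net_tau S x) setT y).
Proof.
elim: S => // s S ih /= [s0 _ _ gS] xS /not_orP[xb1 xb2].
case: ifPn => [/set_mem xs|xs].
  have [d1 d10 h1] := pset_local s0 xs.
  have [|d2 d20 h2] := closed_far (closed_clnet (S := S)) (x := x).
    by move=> xS'; apply: xb1; split => //; exact: pset_cset.
  exists (Num.min d1 d2); first by rewrite lt_min d10.
  move=> y; rewrite lt_min => /andP[/h1 y1 /h2 y2]; rewrite -y1.
  by split; [case=> // /net_clnet|left].
have {}xS : net_set S x by case: xS => // /mem_set xs'; rewrite xs' in xs.
have [d1 d10 h1] := ih gS xS xb2.
have [|d2 d20 h2] := closed_far (closed_cset (s := s)) (x := x).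
  by move=> xs'; apply: xb1; split => //; exact: net_clnet.
exists (Num.min d1 d2); first by rewrite lt_min d10.
move=> y; rewrite lt_min => /andP[/h1 y1 /h2 y2]; rewrite -y1.
by split; [case=> // /pset_cset|right].
Qed.

Lemma net_rectifiable S : good S -> rectifiable1 (net_set S).
Proof.
move=> gS; split; [exact: measurable_net|exact: H1_net_lty|].
(* One Lipschitz line per piece; beyond the length of [S] the default piece gives a constant map. *)
exists (fun k => ray (orig (nth (0, (0, 0)) S k)) (disp (nth (0, (0, 0)) S k))); split.
  move=> k; set p := orig _; set v := disp _.
  rewrite /lipschitz_on; near=> M; move=> -[a b] _; change (`|(p + a *: v) - (p + b *: v)| <= M * `|a - b|).
  rewrite opprD addrACA subrr add0r -scalerBl normrZ mulrC.
  by rewrite ler_wpM2r //; near: M; exact: nbhs_pinfty_ge.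
rewrite (_ : _ `\` _ = set0); first exact: hausdorff1_0.
apply/seteqP; split => // x [/net_piece[s [sS [r _ xE] _ _]]] []; exists (index s S) => //.
by exists r => //; rewrite nth_index.
Unshelve. all: by end_near.
Qed.

Lemma net_half_ball S : good S -> net_set S `<=` @half_ball R.
Proof.
elim: S => [_ x []|s S ih].
by move=> [_ h _ gS] x [/h|/(ih gS)].
Qed.

Lemma net_piecewise_integrable S (G : 'rV[int]_2 -> 'rV[R]_2 -> R) : good S ->
  (H1 R).-integrable (net_set S) (EFin \o (fun x => G (net_theta S x) (net_tau S x))).
Proof.
move=> gS; apply: (net_integral (G := fun=> G) gS _).1 => s sS.
by apply: (integrable_seg01 (f := fun=> G (mult s) (dir s))); [exact: good_disp sS|exact: cst_continuous].
Qed.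

Lemma net_energy S eta : good S ->
  (\int[H1 R]_(x in net_set S) (psi eta (net_theta S x) (net_tau S x))%:E =
   (\sum_(s <- S) psi_e eta (mult s) (disp s))%:E)%E.
Proof.
move=> gS; have iS := net_piecewise_integrable (psi eta) gS.
have [|_ E] := net_integral (G := fun=> psi eta) gS.
  move=> s sS.
  by apply: (integrable_seg01 (f := fun=> psi eta (mult s) (dir s))); [exact: good_disp sS|exact: cst_continuous].
rewrite -[LHS]fineK; last exact: (integrable_fin_num (measurable_net gS) iS).
congr EFin; rewrite [LHS]E; apply: eq_big_seq => s sS.
have s0 := good_disp gS sS.
transitivity (psi eta (mult s) (dir s) * fine (H1 R (pset s))).
  exact: (Rintegral_cst (H1 R) (measurable_pset s0)).
rewrite H1_seg01 //=.
by rewrite /psi_e (negbTE s0) mulrC.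
Qed.

(** The hypothesis is the balance of multiplicities at the nodes in weak form: by
    [integral_grad_seg], each piece contributes its multiplicity times the difference of [phi] at
    its endpoints. *)
Lemma net_divergence_free S : good S ->
  (forall phi : 'rV[R]_2 -> R, (forall x, ~ half_ball x -> phi x = 0) -> forall i,
    \sum_(s <- S) toR R (mult s) 0 i * (phi (orig s + disp s) - phi (orig s)) = 0) ->
  divergence_free (@half_ball R) (net_set S) (net_theta S) (net_tau S).
Proof.
move=> gS bS phi [sphi _ subphi] i.
have cphi j : continuous (fun x => 'D_(evec R j) phi x) by exact: (sphi [:: j]).1.
have dphi j x : derivable phi x (evec R j) by exact: (sphi [::]).2.
have phi0 x : ~ half_ball x -> phi x = 0.
  move=> hx; apply/eqP/negPn/negP => px; apply: hx; apply: subphi.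
  exact: subset_closure.
pose G j x b (v : 'rV[R]_2) := 'D_(evec R j) phi x * (toR R b 0 i * v 0 j).
have cG j b v : continuous (fun x => G j x b v).
  by apply: continuous_mulf => //; exact: cst_continuous.
have iG j s : s \in S -> (H1 R).-integrable (pset s) (EFin \o (fun x => G j x (mult s) (dir s))).
  by move=> sS; apply: integrable_seg01; [exact: good_disp sS|exact: cG].
transitivity (\sum_(j < 2) \sum_(s <- S) \int[H1 R]_(x in pset s) G j x (mult s) (dir s)).
  apply: eq_bigr => j _; rewrite -(net_integral gS (iG j)).2.
  by apply: eq_Rintegral => x _; rewrite densityE.
rewrite exchange_big /= -[RHS](bS phi phi0 i); apply: eq_big_seq => s sS.
have s0 := good_disp gS sS; rewrite sum2E.
rewrite -RintegralD; [|exact: measurable_pset|exact: iG|exact: iG].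
have cdot : continuous (fun x => dot (grad phi x) (dir s)).
  rewrite (_ : (fun x => _) = (fun x => 'D_(evec R 0) phi x * dir s 0 0 +
      'D_(evec R 1) phi x * dir s 0 1)); last first.
    by apply/funext => x; rewrite dotE /grad !mxE.
  by apply: continuous_addf; apply: continuous_mulf => //; exact: cst_continuous.
rewrite -(integral_grad_seg (orig s) s0 dphi cphi).
rewrite -RintegralZl; [|exact: measurable_pset|exact: integrable_seg01].
by apply: eq_Rintegral => x _; rewrite /G dotE /grad !mxE /dir; ring.
Qed.

Lemma net_Mdf S : good S ->
  (forall phi : 'rV[R]_2 -> R, (forall x, ~ half_ball x -> phi x = 0) -> forall i,
    \sum_(s <- S) toR R (mult s) 0 i * (phi (orig s + disp s) - phi (orig s)) = 0) ->
  Mdf (@half_ball R) (net_set S) (net_theta S) (net_tau S).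
Proof.
move=> gS bS; split.
- by split; [exact: net_rectifiable|exact: net_half_ball].
- split.
  + move=> j; have := net_piecewise_integrable (fun _ v => v 0 j) gS.
    by move=> /measurable_int/measurable_EFinP.
  + by move=> x /net_piece[s [sS _ _ ->]]; apply: dir_unit; exact: good_disp sS.
  + exists (bad S); split; [exact: measurable_bad|exact: H1_bad|].
    move=> x /= nx; apply: contrapT => bx; apply: nx => xS.
    have [d d0 dS] := net_local gS xS bx.
    apply: approx_tangent_local dS => //.
    have [s [sS _ _ ->]] := net_piece xS.
    by apply: dir_unit; exact: good_disp sS.
- by move=> i; exact: (net_piecewise_integrable (fun b _ => toR R b 0 i)).
- exact: net_divergence_free.
Qed.

Lemma envelope_le_net S eta b t : good S ->
  (forall phi : 'rV[R]_2 -> R, (forall x, ~ half_ball x -> phi x = 0) -> forall i,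
    \sum_(s <- S) toR R (mult s) 0 i * (phi (orig s + disp s) - phi (orig s)) = 0) ->
  straight_near_boundary b t (net_set S) (net_theta S) (net_tau S) ->
  (envelope (psi eta) b t <= (\sum_(s <- S) psi_e eta (mult s) (disp s))%:E)%E.
Proof.
move=> gS bS sS; rewrite -net_energy //; apply: ereal_inf_lbound.
exists (net_set S), (net_theta S), (net_tau S).
split; [|exact: sS|exact: erefl].
exact: net_Mdf.
Qed.

End network_measure.

(** * General position *)

Section general_position.
Variable R : realType.
Implicit Types (s : piece R) (S : seq (piece R)) (u v x y : 'rV[R]_2).

Definition cross u v : R := u 0 0 * v 0 1 - u 0 1 * v 0 0.

(** Avoids the full line carrying [s], which is stronger than avoiding the segment and is what
    excludes collinear overlaps. *)
Definition off s x := cross (disp s) (x - orig s) != 0.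

Lemma cross_le u v : `|cross u v| <= enorm u * enorm v.
Proof.
rewrite -[X in _ <= X]ger0_norm ?mulr_ge0 ?enorm_ge0 // -ler_sqr ?nnegrE //.
rewrite !real_normK ?num_real // exprMn !enorm_sq !dotE /cross -subr_ge0.
set a := u 0 0; set b := u 0 1; set c := v 0 0; set d := v 0 1.
have -> : (a * a + b * b) * (c * c + d * d) - (a * d - b * c) ^+ 2 = (a * c + b * d) ^+ 2 by ring.
exact: sqr_ge0.
Qed.

Lemma meet_onceC s s' : meet_once s s' -> meet_once s' s.
Proof. by move=> h x y sx s'x sy s'y; exact: h. Qed.

(** Two distinct common points would make the segments collinear, placing both endpoints of [s'] on
    the line of [s]. *)
Lemma off_meet_once s s' : off s (orig s') || off s (orig s' + disp s') -> meet_once s s'.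
Proof.
move=> offs x y [a _ xE] [a' _ xE'] [b _ yE] [b' _ yE'].
have [eab|ab] := eqVneq a' b'; first by rewrite -xE' -yE' eab.
move: offs; rewrite /off /cross; apply: contraTeq => _.
have ab0 : a' - b' != 0 by rewrite subr_eq0.
have E i : orig s' 0 i - orig s 0 i = a * disp s 0 i - a' * disp s' 0 i.
  by have /matrixP/(_ 0 i) := etrans xE (esym xE'); rewrite !mxE => h; lra.
have E' i : orig s' 0 i - orig s 0 i = b * disp s 0 i - b' * disp s' 0 i.
  by have /matrixP/(_ 0 i) := etrans yE (esym yE'); rewrite !mxE => h; lra.
have F i : (a' - b') * disp s' 0 i = (a - b) * disp s 0 i.
  by move: (E i) (E' i) => h1 h2; lra.
have C0 : disp s 0 0 * disp s' 0 1 - disp s 0 1 * disp s' 0 0 = 0.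
  apply: (mulfI ab0); rewrite mulr0 mulrBr.
  by rewrite !(mulrCA (a' - b')) !F; ring.
rewrite !mxE; have -> : orig s' 0 1 + disp s' 0 1 - orig s 0 1 = orig s' 0 1 - orig s 0 1 + disp s' 0 1 by ring.
have -> : orig s' 0 0 + disp s' 0 0 - orig s 0 0 = orig s' 0 0 - orig s 0 0 + disp s' 0 0 by ring.
have D0 : disp s 0 0 * (orig s' 0 1 - orig s 0 1) - disp s 0 1 * (orig s' 0 0 - orig s 0 0) = 0.
  rewrite !E -[RHS](mulr0 (- a')) -C0; ring.
apply/norP; rewrite !negbK D0 eqxx; split=> //; apply/eqP; lra.
Qed.

(** The induction produces a whole ball of good points, so that there is room to leave the next line
    without falling onto the earlier ones. *)
Lemma avoid_lines S x (e : R) : 0 < e -> (forall s, s \in S -> disp s != 0) ->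
  exists y, exists2 d : R, 0 < d &
    forall y', enorm (y' - y) < d -> enorm (y' - x) < e /\ forall s, s \in S -> off s y'.
Proof.
move=> e0; elim: S => [_|s S ih nz]; first by exists x, e.
have [|y [d d0 hd]] := ih; first by move=> s' s'S; apply: nz; rewrite inE s'S orbT.
have s0 : disp s != 0 by apply: nz; rewrite mem_head.
have v0 : 0 < enorm (disp s) by rewrite enorm_gt0.
have [y' yy' offy'] : exists2 y', enorm (y' - y) < d & off s y'.
  have [offy|] := boolP (off s y); first by exists y; rewrite // subrr enorm0.
  rewrite negbK => /eqP offy.
  pose n : 'rV[R]_2 := \row_j (if j == 0 then - disp s 0 1 else disp s 0 0).
  (* A shift by half the available radius, normal to the line through [y]. *)
  pose r : R := d / 2 / enorm (disp s).
  have r0 : 0 < r by rewrite !divr_gt0.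
  have nE : enorm n = enorm (disp s).
    by rewrite /enorm; congr Num.sqrt; rewrite !dotE !mxE /=; ring.
  exists (y + r *: n).
    rewrite addrC addKr enormZ nE gtr0_norm // /r divfK ?gt_eqF //; lra.
  rewrite /off /cross; apply/eqP => h.
  have : r * dot (disp s) (disp s) = 0.
    rewrite -[RHS]h -[LHS]addr0 -offy /cross dotE !mxE /=; ring.
  by apply/eqP; rewrite mulf_eq0 -enorm_sq expf_eq0 /= !gt_eqF.
pose c := `|cross (disp s) (y' - orig s)|.
have c0 : 0 < c by rewrite normr_gt0.
exists y', (Num.min (d - enorm (y' - y)) (c / enorm (disp s))).
  by rewrite lt_min subr_gt0 yy' divr_gt0.
move=> w; rewrite lt_min => /andP[w1 w2].
have [|wx offw] := hd w.
  rewrite -(subrKA y') (le_lt_trans (enormD _ _)) //; lra.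
split=> // s'; rewrite inE => /orP[/eqP->|]; last exact: offw.
apply/negP => /eqP h; move: w2; apply/negP; rewrite -leNgt ler_pdivrMr //.
rewrite mulrC /c; apply: le_trans (cross_le _ _).
have -> : cross (disp s) (w - y') = cross (disp s) (w - orig s) - cross (disp s) (y' - orig s).
  by rewrite /cross !mxE; ring.
by rewrite h sub0r normrN.
Qed.

Lemma general_position S x (e : R) : 0 < e -> (forall s, s \in S -> disp s != 0) ->
  exists2 y, enorm (y - x) < e & forall s, s \in S -> off s y.
Proof.
move=> e0 S0; have [y [d d0 hd]] := avoid_lines x e0 S0.
by exists y; [apply: (hd y _).1|apply: (hd y _).2]; rewrite subrr enorm0.
Qed.

End general_position.

(** * Triangular networks in general position *)

Section inner_network.
Variables (R : realType) (eta : R).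
Hypothesis heta : 0 <= eta <= 1.
Variables (t z : 'rV[R]_2) (rho rho' : R) (b1 b2 : 'rV[int]_2).
Hypotheses (t1 : enorm t = 1) (zw : 0 <= dot z (t - z)).
Hypotheses (rho0 : 0 < rho) (rho12 : rho < rho').
Hypotheses (b1n : enorm (toR R b1) ^+ 2 <= 1) (b2n : enorm (toR R b2) ^+ 2 <= 1)
  (b12n : enorm (toR R (b1 + b2)) ^+ 2 <= 2).
Implicit Types (s : piece R) (S : seq (piece R)).
Local Notation P := (- rho *: t).
Local Notation Q := (rho *: t).
Local Notation pe := (psi_e eta).

Definition axis : piece R := (0, (0, t)).

(** An endpoint off the axis prevents an inner piece from overlapping the straight ends; [rho']
    bounds the region occupied after perturbation. *)
Definition inner s := [/\ disp s != 0, enorm (orig s) < rho', enorm (orig s + disp s) < rho' &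
  off axis (orig s) || off axis (orig s + disp s)].

Fixpoint once S : Prop :=
  if S is s :: S' then (forall s', s' \in S' -> meet_once s s') /\ once S' else True.

Lemma once4 s1 s2 s3 s4 S : meet_once s1 s2 -> meet_once s1 s3 -> meet_once s1 s4 ->
  meet_once s2 s3 -> meet_once s2 s4 -> meet_once s3 s4 ->
  (forall s, s \in S -> [/\ meet_once s1 s, meet_once s2 s, meet_once s3 s & meet_once s4 s]) ->
  once S -> once [:: s1, s2, s3, s4 & S].
Proof.
move=> h12 h13 h14 h23 h24 h34 hS oS.
split; [|split; [|split; [|split; last exact: oS]]] => s; rewrite ?inE.
- by move=> /or4P[/eqP->|/eqP->|/eqP->|/hS[]].
- by move=> /or3P[/eqP->|/eqP->|/hS[]].
- by move=> /orP[/eqP->|/hS[]].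
- by move=> /hS[].
Qed.

Definition cost S := \sum_(s <- S) pe (mult s) (disp s).

Definition flux S (phi : 'rV[R]_2 -> R) i :=
  \sum_(s <- S) toR R (mult s) 0 i * (phi (orig s + disp s) - phi (orig s)).

(* b1 + b2 runs from P to the apex y, then b1 directly and b2 through x to Q: the
   detour keeps the two last branches from overlapping. *)
Definition loop y x : seq (piece R) :=
  [:: (b2, (x, Q - x)); (b2, (y, x - y)); (b1, (y, Q - y)); (b1 + b2, (P, y - P))].

Lemma flux_loop y x phi i :
  flux (loop y x) phi i = toR R (b1 + b2) 0 i * (phi Q - phi P).
Proof.
rewrite /flux /loop !big_cons big_nil /mult /orig /disp /=.
rewrite ![_ + (_ - _)]addrC !subrK !mxE rmorphD /=; ring.
Qed.

(** The form of Thales that is used: the squared norm is rho^2 (1 - 4 z.(t - z)). *)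
Lemma apex_radius : enorm (P + (2 * rho) *: (t - z)) <= rho.
Proof.
rewrite -ler_sqr ?nnegrE ?enorm_ge0 ?(ltW rho0) // enorm_sq.
have := enorm_sq t; rewrite t1 expr1n.
move: zw; rewrite !dotE !mxE => h1 h2.
have := mulr_ge0 (sqr_ge0 rho) h1.
have := congr1 (fun u => rho ^+ 2 * u) h2 => /=; nra.
Qed.

(** Without perturbation [b2] runs twice along [rho *: z], which costs the same as once along
    [(2 * rho) *: z]. With Lipschitz constants 2 for [b1], [b2] and 4 for [b1 + b2], the
    displacement of [y] contributes 4 + 2 + 1 + 1 = 8 and that of [x] contributes 2 + 2 = 4. *)
Lemma cost_loop y x :
  cost (loop y x) <= 2 * rho * (pe b1 z + pe b2 z + pe (b1 + b2) (t - z)) +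
    8 * enorm (y - (P + (2 * rho) *: (t - z))) + 4 * enorm (x - 2^-1 *: (y + Q)).
Proof.
set d1 := y - _; set d2 := x - _.
rewrite /cost /loop !big_cons big_nil /mult /disp /=.
have lip b u v k : enorm (toR R b) ^+ 2 <= k -> pe b (u + v) <= pe b u + 2 * k * enorm v.
  move=> bk; have := psi_e_lip heta b (u + v) u; rewrite [u + v]addrC addrK [v + u]addrC => /ler_normlW h.
  have := ler_wpM2r (enorm_ge0 v) bk; lra.
have rho2 : 0 <= rho * 2 by rewrite mulr_ge0 // ltW.
have Ey : y = P + (2 * rho) *: (t - z) + d1 by rewrite addrC subrK.
have Ex : x = 2^-1 *: (y + Q) + d2 by rewrite addrC subrK.
have E1 : Q - x = rho *: z + ((- 2^-1) *: d1 - d2).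
  by rewrite Ex Ey; apply/rowP => i; rewrite !mxE; field.
have E2 : x - y = rho *: z + ((- 2^-1) *: d1 + d2).
  by rewrite Ex Ey; apply/rowP => i; rewrite !mxE; field.
have E3 : Q - y = (2 * rho) *: z - d1.
  by rewrite Ey; apply/rowP => i; rewrite !mxE; ring.
have E4 : y - P = (2 * rho) *: (t - z) + d1.
  by rewrite Ey; apply/rowP => i; rewrite !mxE; ring.
have r2 : 0 <= 2 * rho by rewrite mulr_ge0 // ltW.
have := lip b2 (rho *: z) ((- 2^-1) *: d1 - d2) 1 b2n.
have := lip b2 (rho *: z) ((- 2^-1) *: d1 + d2) 1 b2n.
have := lip b1 ((2 * rho) *: z) (- d1) 1 b1n.
have := lip (b1 + b2) ((2 * rho) *: (t - z)) d1 2 b12n.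
have half : enorm ((- 2^-1) *: d1) = 2^-1 * enorm d1.
  by rewrite enormZ normrN ger0_norm // invr_ge0.
have := enormD ((- 2^-1) *: d1) (- d2).
have := enormD ((- 2^-1) *: d1) d2.
rewrite E1 E2 E3 E4 !enormN half !psi_eZ ?(ltW rho0) //; lra.
Qed.

(** Loops are added one at a time, each in general position with respect to those already placed,
    with an excess cost of at most [e] per loop. *)
Lemma inner_network (e : R) (n : nat) : 0 < e ->
  exists S, [/\ forall s, s \in S -> inner s, once S,
    forall phi i, flux S phi i = n%:R * (toR R (b1 + b2) 0 i * (phi Q - phi P)) &
    cost S <= n%:R * (2 * rho * (pe b1 z + pe b2 z + pe (b1 + b2) (t - z)) + e)].
Proof.
move=> e0; elim: n => [|n [S [Sin Sonce Sflux Scost]]].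
  exists [::]; split=> //; first by move=> phi i; rewrite /flux big_nil mul0r.
  by rewrite /cost big_nil mul0r.
have t0 : t != 0 by rewrite -enorm_eq0 t1 oner_eq0.
have S0 s : s \in S -> disp s != 0 by case/Sin.
(* The perturbations [k] of [y] and [k / 2] of [x] cost at most 8 k + 4 (k / 2) = 10 k, below [e];
   the bound by [rho' - rho] keeps both points in the larger ball. *)
have [k [k0 kr ke]] : exists k, [/\ 0 < k, k <= rho' - rho & k <= e / 12].
  exists (Num.min (e / 12) (rho' - rho)).
  by rewrite lt_min divr_gt0 ?subr_gt0 // !ge_min !lexx orbT.
have [|y yA yoff] := @general_position _ (axis :: S) (P + (2 * rho) *: (t - z)) k k0.
  by move=> s; rewrite inE => /orP[/eqP->|/S0].
have oy : off axis y by apply: yoff; rewrite mem_head.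
have oE x : off axis x = (cross t x != 0) by rewrite /off /cross !mxE !subr0.
have oP : ~~ off axis P by rewrite oE negbK /cross !mxE; apply/eqP; ring.
have oQ : ~~ off axis Q by rewrite oE negbK /cross !mxE; apply/eqP; ring.
have ne x x' : off axis x -> ~~ off axis x' -> x' - x != 0.
  by move=> ox; apply: contra; rewrite subr_eq0 => /eqP->.
have yP : y - P != 0 by rewrite -oppr_eq0 opprB ne.
have yQ : Q - y != 0 by rewrite ne.
have k20 : 0 < k / 2 by rewrite divr_gt0.
(* The point [x] is chosen after [y], because it must avoid the two lines from [y] to [P] and to
   [Q]; this opens up the detour of [b2]. *)
have [|x xA xoff] := @general_position _
    [:: axis, (0, (P, y - P)) : piece R, (0, (y, Q - y)) : piece R & S] (2^-1 *: (y + Q)) _ k20.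
  by move=> s; rewrite !inE => /or4P[/eqP->|/eqP->|/eqP->|/S0].
have ox : off axis x by apply: xoff; rewrite mem_head.
have xPy : off (0, (P, y - P)) x by apply: xoff; rewrite !inE eqxx orbT.
have xyQ : off (0, (y, Q - y)) x by apply: xoff; rewrite !inE eqxx !orbT.
have yoffS s : s \in S -> off s y by move=> sS; apply: yoff; rewrite !inE sS orbT.
have xoffS s : s \in S -> off s x by move=> sS; apply: xoff; rewrite !inE sS !orbT.
have xQ : Q - x != 0 by rewrite ne.
have xy : x - y != 0.
  apply: contraTN xyQ; rewrite subr_eq0 => /eqP->.
  by rewrite /off negbK /cross !mxE; apply/eqP; ring.
have eQ : enorm Q = rho by rewrite enormZ t1 mulr1 gtr0_norm.
have eP : enorm P = rho by rewrite scaleNr enormN.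
have yk : enorm y < k + rho.
  rewrite -(subrK (P + (2 * rho) *: (t - z)) y) (le_lt_trans (enormD _ _)) //.
  exact: ltr_leD apex_radius.
have ey : enorm y < rho' by lra.
have ex : enorm x < rho'.
  rewrite -(subrK (2^-1 *: (y + Q)) x) (le_lt_trans (enormD _ _)) //.
  have := enormD y Q; rewrite eQ enormZ (ger0_norm (x := 2^-1)) ?invr_ge0 //; lra.
exists (loop y x ++ S); split.
- move=> s; rewrite mem_cat => /orP[|/Sin //]; rewrite /loop !inE.
  move=> /or4P[] /eqP->; split; rewrite /orig /disp /= ?[_ + (_ - _)]addrC ?subrK ?oy ?ox ?orbT //; lra.
- have off_l s s' : off s (orig s') -> meet_once s' s.
    by move=> h; apply/meet_onceC/off_meet_once; rewrite h.
  have off_r s s' u : orig s' + disp s' = u -> off s u -> meet_once s' s.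
    by move=> <- h; apply/meet_onceC/off_meet_once; rewrite h orbT.
  have yx : y + (x - y) = x by rewrite addrC subrK.
  have Py : P + (y - P) = y by rewrite addrC subrK.
  have xQx : x + (Q - x) = Q by rewrite addrC subrK.
  have yQy : y + (Q - y) = Q by rewrite addrC subrK.
  (* Within the loop, [x] is off the lines yQ and Py, and [Q] is off the lines yx and Py. One of
     these facts separates each of the six pairs. *)
  apply: once4 => //.
  + apply: (off_r _ _ Q); first exact: xQx.
     move: xyQ; rewrite /off /orig /disp /cross /=.
    apply: contra => /eqP h; apply/eqP; move: h; rewrite !mxE; lra.
  + by apply: off_l; exact: xyQ.
  + by apply: off_l; exact: xPy.
  + by apply: (off_r _ _ x); [exact: yx|exact: xyQ].
  + by apply: (off_r _ _ x); [exact: yx|exact: xPy].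
  + apply: (off_r _ _ Q); first exact: yQy.
     move: oy; rewrite /off /axis /orig /disp /cross /=.
    apply: contra => /eqP h; apply/eqP.
    have rho2 : 2 * rho != 0 by rewrite mulf_neq0 ?gt_eqF.
    by apply: (mulfI rho2); rewrite mulr0 -[RHS]oppr0 -h !mxE; ring.
  + move=> s sS; split.
    * exact/off_l/xoffS.
    * exact/off_l/yoffS.
    * exact/off_l/yoffS.
    * by apply: (off_r _ _ y); [exact: Py|exact: yoffS].
- move=> phi i; rewrite /flux big_cat /= -/(flux _ _ _) -/(flux S phi i).
  rewrite flux_loop Sflux -natr1; ring.
- rewrite /cost big_cat /= -/(cost _) -/(cost S) -natr1.
  have := cost_loop y x; lra.
Qed.

End inner_network.

(** * Upper bound *)

Section upper_bound.
Variables (R : realType) (eta : R).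
Hypothesis heta : 0 <= eta <= 1.
Variables (t z : 'rV[R]_2) (b1 b2 : 'rV[int]_2) (n : nat).
Hypotheses (t1 : enorm t = 1) (zw : 0 <= dot z (t - z)).
Hypotheses (b1n : enorm (toR R b1) ^+ 2 <= 1) (b2n : enorm (toR R b2) ^+ 2 <= 1)
  (b12n : enorm (toR R (b1 + b2)) ^+ 2 <= 2).
Local Notation pe := (psi_e eta).
Local Notation b := (n%:Z *: (b1 + b2)).
Implicit Types (s : piece R) (S : seq (piece R)) (x y : 'rV[R]_2).

Lemma good_once S : (forall s, s \in S -> disp s != 0) ->
  (forall s, s \in S -> pset s `<=` @half_ball R) -> once S -> good S.
Proof.
elim: S => // s S ih S0 SH [oS SS]; split; [|exact: SH (mem_head _ _)|exact: oS|].
  by apply: S0; exact: mem_head.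
by apply: ih => // s' s'S; [apply: S0|apply: SH]; rewrite inE s'S orbT.
Qed.

Lemma pset_enorm s (r : R) x : enorm (orig s) < r -> enorm (orig s + disp s) < r ->
  pset s x -> enorm x < r.
Proof.
move=> h1 h2 [a /=]; rewrite in_itv /= => /andP[a0 a1] <-.
have -> : ray (orig s) (disp s) a = (1 - a) *: orig s + a *: (orig s + disp s).
  by rewrite /ray scalerDr addrA -scalerDl subrK scale1r.
apply: (le_lt_trans (enormD _ _)); rewrite !enormZ !ger0_norm ?subr_ge0 ?ltW //.
have a10 : 0 < 1 - a by rewrite subr_gt0.
by move: h1 h2; rewrite -(ltr_pM2l a10) -(ltr_pM2l a0 (enorm (orig s + disp s))); lra.
Qed.

Section at_radius.
Variable rho : R.
Hypotheses (rho0 : 0 < rho) (rho12 : rho < 2^-1).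
Local Notation rho' := ((rho + 2^-1) / 2).

(** The straight ends, used with [c = - 2^-1] and [c = rho]. They carry all of [b] at a cost
    quadratic in [n], harmless because their length vanishes as [rho] tends to 1/2. *)
Definition stub (c : R) : piece R := (b, (c *: t, (2^-1 - rho) *: t)).

Let t0 : t != 0. Proof. by rewrite -enorm_eq0 t1 oner_eq0. Qed.

Lemma stub_ray c a : ray (orig (stub c)) (disp (stub c)) a = (c + a * (2^-1 - rho)) *: t.
Proof. by rewrite /ray /orig /disp /= scalerA -scalerDl. Qed.

Lemma stub_disp c : disp (stub c) != 0.
Proof. by rewrite scaler_eq0 negb_or t0 subr_eq0 gt_eqF. Qed.

Lemma stub_dir c : dir (stub c) = t.
Proof.
have r0 : 0 < 2^-1 - rho by rewrite subr_gt0.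
by rewrite /dir /disp /= enormZ t1 mulr1 gtr0_norm // scalerA mulVf ?gt_eqF // scale1r.
Qed.

Lemma stub_half_ball c : - 2^-1 <= c <= rho -> pset (stub c) `<=` @half_ball R.
Proof.
move=> /andP[c1 c2] x [a /=]; rewrite in_itv /= => /andP[a0 a1] <-.
rewrite /half_ball /eball /= subr0 stub_ray enormZ t1 mulr1 ltr_norml.
have r0 : 0 < 2^-1 - rho by rewrite subr_gt0.
have := mulr_gt0 a0 r0; have : a * (2^-1 - rho) < 2^-1 - rho by rewrite gtr_pMl.
lra.
Qed.

Lemma stubs_meet_once : meet_once (stub (- 2^-1)) (stub rho).
Proof.
move=> x y [a /= aI xE] [a' /= aI' xE'] _ _; exfalso.
move: xE'; rewrite -xE !stub_ray => /(congr1 (fun u => dot t u)).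
rewrite !dotZr -enorm_sq t1 expr1n !mulr1.
move: aI aI'; rewrite !in_itv /= => /andP[a0 a1] /andP[a'0 a'1].
have r0 : 0 < 2^-1 - rho by rewrite subr_gt0.
have := mulr_ge0 a'0 (ltW r0); have : a * (2^-1 - rho) <= 2^-1 - rho by rewrite ger_pMl.
move: rho0; lra.
Qed.

Lemma off_stub c x : off (axis t) x -> off (stub c) x.
Proof.
rewrite /off /axis /stub /orig /disp /= /cross; apply: contra => /eqP h; apply/eqP.
have r0 : 2^-1 - rho != 0 by rewrite subr_eq0 gt_eqF.
by apply: (mulfI r0); rewrite mulr0 -[RHS]h !mxE; ring.
Qed.

Lemma stub_inner_meet_once c s : inner t rho' s -> meet_once (stub c) s.
Proof.
move=> [_ _ _ /orP[] h]; apply: off_meet_once; rewrite (off_stub _ h) ?orbT //.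
Qed.

Lemma completed_good S : (forall s, s \in S -> inner t rho' s) -> once S ->
  good [:: stub (- 2^-1), stub rho & S].
Proof.
move=> Sin oS; apply: good_once.
- by move=> s; rewrite !inE => /or3P[/eqP->|/eqP->|/Sin[]//]; exact: stub_disp.
- move=> s; rewrite !inE => /or3P[/eqP->|/eqP->|/Sin[_ h1 h2 _]].
  + by apply: stub_half_ball; rewrite lexx /=; move: rho0; lra.
  + by apply: stub_half_ball; rewrite lexx andbT; move: rho0; lra.
  + move=> x /(pset_enorm h1 h2) xr; rewrite /half_ball /eball /= subr0; move: rho12 xr; lra.
- split; [|split => //] => s; rewrite ?inE.
    by move=> /orP[/eqP->|/Sin]; [exact: stubs_meet_once|exact: stub_inner_meet_once].
  by move=> /Sin; exact: stub_inner_meet_once.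
Qed.

(** As [rho'] lies strictly between [rho] and [2^-1], the ball of radius [rho'] contains the inner
    network and both stubs reach into it; in the remaining annulus only the diameter is left. *)
Lemma completed_straight S : (forall s, s \in S -> inner t rho' s) ->
  let N := [:: stub (- 2^-1), stub rho & S] in
  straight_near_boundary b t (net_set N) (net_theta N) (net_tau N).
Proof.
move=> Sin N; exists 0, rho'; split; first by move: rho0; lra.
  have cl : closed [set x : 'rV[R]_2 | enorm x <= rho'].
    rewrite (_ : [set _ | _] = (@enorm R) @^-1` [set y | y <= rho']) //.
    by apply: preimage_closed; [move=> ? _; exact: enorm_continuous|exact: closed_le].
  have sub : eball 0 rho' `<=` [set x : 'rV[R]_2 | enorm x <= rho'].
    by move=> x; rewrite /eball /= subr0; exact: ltW.
  move=> x /(closure_subset sub); rewrite -(closure_id _).1 //= => h.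
  by rewrite /half_ball /eball /= subr0; move: rho12 h; lra.
move=> A _ AH.
have AE x : A x -> rho' <= enorm x < 2^-1.
  by move=> /AH[]; rewrite /half_ball /eball /= subr0 => -> /negP; rewrite -leNgt => ->.
have far x : A x -> ~ net_set S x.
  move=> /AE/andP[xr _] /net_piece[s [/Sin[_ h1 h2 _] sx _ _]].
  by have := pset_enorm h1 h2 sx; lra.
have r0 : 0 < 2^-1 - rho by rewrite subr_gt0.
have stubI c (a : R) : c < a -> a < c + (2^-1 - rho) -> pset (stub c) (a *: t).
  move=> ca ac; exists ((a - c) / (2^-1 - rho)); last by rewrite stub_ray divfK ?gt_eqF // addrC subrK.
  by rewrite /= in_itv /= divr_gt0 ?subr_gt0 //= ltr_pdivrMr // mul1r; move: ac; lra.
have gamE : net_set N `&` A = line t `&` @half_ball R `&` A.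
  apply/seteqP; split => x [].
    move=> xN xA; split => //; split; last by case: (AH _ xA).
    case: xN => [|[|/(far _ xA)//]] [a _ <-]; rewrite stub_ray; by eexists.
  move=> [[a _ xE] _] xA; split => //; have := AE _ xA.
  rewrite -xE enormZ t1 mulr1 => /andP[h1 h2].
  have [a0|a0] := leP 0 a.
    by right; left; apply: stubI; move: rho12 h1 h2; rewrite ger0_norm //; lra.
  by left; apply: stubI; move: rho12 h1 h2; rewrite ltr0_norm //; lra.
apply/matrixP => i j; rewrite !mxE -gamE; apply: eq_Rintegral => x /set_mem[xN xA].
rewrite !densityE /=.
have [_|xs] := ifPn; first by rewrite stub_dir.
have [_|xs'] := ifPn; first by rewrite stub_dir.
case: xN => [/mem_set|[/mem_set|/(far _ xA)//]] h; [by rewrite h in xs|by rewrite h in xs'].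
Qed.

Lemma envelope_le_radius (e : R) : 0 < e ->
  (envelope (psi eta) b t <= ((1 - 2 * rho) * pe b t +
     n%:R * (2 * rho * (pe b1 z + pe b2 z + pe (b1 + b2) (t - z)) + e))%:E)%E.
Proof.
move=> e0.
have rr' : rho < rho' by move: rho12; lra.
have [S [Sin oS Sflux Scost]] := inner_network heta t1 zw rho0 rr' b1n b2n b12n n e0.
apply: (le_trans (envelope_le_net eta (completed_good Sin oS) _ (completed_straight Sin))).
  (* The outer ends of the stubs lie on the sphere, where [phi] vanishes, and their inner ends
     cancel the flux of the inner network. *)
  move=> phi phi0 i; have h (c : R) : 2^-1 <= `|c| -> phi (c *: t) = 0.
    move=> hc; apply: phi0; rewrite /half_ball /eball /= subr0 enormZ t1 mulr1.
    by apply/negP; rewrite -leNgt.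
  rewrite !big_cons -/(flux S phi i) Sflux /mult /orig /disp /= -!scalerDl.
  have -> : rho + (2^-1 - rho) = 2^-1 by rewrite addrC subrK.
  have -> : - 2^-1 + (2^-1 - rho) = - rho by rewrite addrA addNr add0r.
  rewrite (h 2^-1) ?(h (- 2^-1)) ?normrN ?ger0_norm ?invr_ge0 //.
  by rewrite !mxE intrM; ring.
have r0 : 0 <= 2^-1 - rho by rewrite subr_ge0 ltW.
rewrite lee_fin !big_cons -/(cost eta S) /mult /disp /= !psi_eZ //.
rewrite addrA -mulrDl (_ : 2^-1 - rho + _ = 1 - 2 * rho); last by field.
by rewrite lerD2l.
Qed.

End at_radius.

Lemma envelope_le_splitting :
  (envelope (psi eta) b t <= (n%:R * (pe b1 z + pe b2 z + pe (b1 + b2) (t - z)))%:E)%E.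
Proof.
apply/lee_addgt0Pr => e e0; set F := _ + pe (b1 + b2) _.
have F0 : 0 <= F by rewrite !addr_ge0 ?psi_e_ge0.
have K0 : 0 <= pe b t by rewrite psi_e_ge0.
have n0 : 0 < n%:R + 1 :> R by rewrite ltr_wpDl.
have nn : 0 <= n%:R :> R by [].
(* With [rho = (1 - d) / 2] the stubs have total length [d], so they cost at most [e / 2]; the other
   half of [e] is shared among the [n] loops. *)
pose d := Num.min 2^-1 (e / 2 / (pe b t + 1)).
have d0 : 0 < d by rewrite lt_min invr_gt0 ltr0n !divr_gt0 // ltr_wpDl.
have d1 : d <= 2^-1 by rewrite ge_min lexx.
have dK : d * pe b t <= e / 2.
  have : d <= e / 2 / (pe b t + 1) by rewrite ge_min lexx orbT.
  rewrite ler_pdivlMr ?ltr_wpDl // mulrDr mulr1; lra.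
have e10 : 0 < e / 2 / (n%:R + 1) by rewrite !divr_gt0.
have ne : n%:R * (e / 2 / (n%:R + 1)) <= e / 2.
  by rewrite mulrA ler_pdivrMr // mulrC ler_wpM2l ?divr_ge0 ?(ltW e0) // lerDl.
have [r1 r2] : 0 < (1 - d) / 2 /\ (1 - d) / 2 < 2^-1 by lra.
apply: (le_trans (envelope_le_radius r1 r2 e10)).
rewrite -EFinD lee_fin -/F.
have := mulr_ge0 (ltW d0) (mulr_ge0 nn F0).
set k := _ / (n%:R + 1) in ne *.
have -> : (1 - 2 * ((1 - d) / 2)) * pe b t = d * pe b t by field.
have -> : n%:R * (2 * ((1 - d) / 2) * F + k) = n%:R * F - d * (n%:R * F) + n%:R * k by field.
lra.
Qed.

End upper_bound.
Theorem lemma4p6 (R : realType) (eta : R) (heta : 0 <= eta <= 1)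
    (beta : int) (t : 'rV[R]_2) (ht : enorm t = 1) :
  let e1 := evec int 0 in
  let e2 := evec int 1 in
  let F z := psi_e eta e1 z + psi_e eta e2 z + psi_e eta (e1 + e2) (t - z) in
  exists2 z : 'rV[R]_2, (forall z' : 'rV[R]_2, F z <= F z') &
    envelope (psi eta) (beta *: (e1 + e2)) t = (`|beta|%:~R * F z)%:E.
Proof.
move=> e1 e2 F; have [z [zmin zcase [m1 [m2 [mF mpsi]]]]] := calibration heta ht.
exists z => //.
have b1n : enorm (toR R e1) ^+ 2 <= 1.
  by rewrite enorm_sq dotE !mxE /= mulr0 addr0 mulr1.
have b2n : enorm (toR R e2) ^+ 2 <= 1.
  by rewrite enorm_sq dotE !mxE /= mulr0 add0r mulr1.
have b12n : enorm (toR R (e1 + e2)) ^+ 2 <= 2 by rewrite enorm_e12.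
(* In the degenerate cases the product is 0, and the construction only asks for a nonnegative
   one. *)
have zw : 0 <= dot z (t - z).
  by case: zcase => [->|->|/ltW //]; rewrite ?dot0l ?dot0r.
have toRN b : enorm (toR R (- b)) = enorm (toR R b).
  by rewrite -[RHS]enormN; congr enorm; apply/rowP => i; rewrite !mxE rmorphN.
apply/le_anti/andP; split.
  have [n [-> | ->]] : exists n : nat, beta = n \/ beta = - n%:Z.
    by case: beta => n; [exists n; left|exists n.+1; right; rewrite NegzE].
  - by have := envelope_le_splitting heta n ht zw b1n b2n b12n; rewrite ger0_norm.
  (* For negative [beta] the networks carry [- e1] and [- e2], at the same cost since the energy is
     even in the multiplicity. *)
  - have := envelope_le_splitting heta (b1 := - e1) (b2 := - e2) n ht zw.
    rewrite -opprD !toRN !psi_eNl scalerN -scaleNr normrN ger0_norm //; exact.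
have [h0 _] := andP heta.
have FE : F z = dot m1 t + dot m2 t by rewrite -dotDl mF.
have b0 : (beta *: (e1 + e2)) 0 0 = beta by rewrite !mxE /= addr0 mulr1.
have b1 : (beta *: (e1 + e2)) 0 1 = beta by rewrite !mxE /= add0r mulr1.
apply: le_ereal_inf_tmp => _ [gam [theta [tau [gM gS ->]]]].
have [beta0|beta0] := leP 0 beta.
  apply: le_trans (calibrated_lower_bound ht gM gS h0 mpsi).
  by rewrite lee_fin FE b0 b1 ger0_norm // mulrDr.
(* The energy is even in the direction, so the opposite vectors calibrate as well and give the bound
   with [- beta]. *)
have mpsiN (b : 'rV[int]_2) (u : 'rV[R]_2) : enorm u = 1 ->
    (b 0 0)%:~R * dot (- m1) u + (b 0 1)%:~R * dot (- m2) u <= psi eta b u.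
  move=> u1; have := mpsi b (- u); rewrite enormN !dotNr !dotNl /psi dotNr sqrrN.
  exact.
apply: le_trans (calibrated_lower_bound ht gM gS h0 mpsiN).
by rewrite lee_fin FE b0 b1 ltr0_norm // !dotNl !mulrN rmorphN mulrDr !mulNr.
Qed.
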